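(* Let $G=(V,E)$ be an undirected graph with $n$ vertices and $m$ edges, with positive edge capacities $c:E\to\mathbb{R}_{>0}$, and let $k\in\mathbb{N}$. Given a feasible solution $x$ to the linear program (C): minimize $\sum_e c_ex_e$ over $x:E\to\mathbb{R}$ subject to $\sum_{e\in F}x_e\ge |F|+k-n$ for all forests $F\subseteq E$ and $x_e\ge0$ for all $e\in E$, one can compute a $k$-cut $C$ with cost $\sum_{e\in C}c_e\le 2(1-1/n)\sum_{e\in E}c_ex_e$ in $O(m\log n)$ time.
   Context: A $k$-cut is a set of edges $C\subseteq E$ whose removal leaves $G$ with at least $k$ connected components. A forest is an acyclic edge set and $|F|$ is its number of edges. *)

(* Defs.v *)
From HB Require Import structures.
From mathcomp Require Import all_boot all_order all_algebra.
From mathcomp Require Import reals exp.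

Set Implicit Arguments.
Unset Strict Implicit.
Unset Printing Implicit Defensive.

Import Order.TTheory GRing.Theory Num.Theory.
Local Open Scope ring_scope.

(* Graphs have vertex set 'I_n and edge set 'I_m; [ends e] lists the two      *)
(* endpoints of e, in an irrelevant order.                                    *)

Section Graphs.
Variables (n m : nat) (ends : 'I_m -> 'I_n * 'I_n).
Implicit Types A F C : {set 'I_m}.

Definition simple_graph : Prop :=
  (forall e, (ends e).1 != (ends e).2) /\
  injective (fun e => [set (ends e).1; (ends e).2]).

Definition adj A : rel 'I_n := fun u v =>
  [exists e in A, (ends e == (u, v)) || (ends e == (v, u))].

Definition num_components A : nat := n_comp (adj A) 'I_n.

Definition is_kcut (k : nat) C : Prop := (k <= num_components (~: C))%N.

(* In a simple graph a cycle is a cyclic sequence of at least three distinct  *)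
(* vertices; [:: u; v] is a [ucycle] that runs twice through the same edge.   *)
Definition is_forest F : Prop :=
  forall p : seq 'I_n, ucycle (adj F) p -> (size p <= 2)%N.

Definition lpC_feasible (R : realType) (k : nat) (x : 'I_m -> R) : Prop :=
  (forall F, is_forest F -> \sum_(e in F) x e >= #|F|%:R + k%:R - n%:R) /\
  (forall e, 0 <= x e).

End Graphs.

(* Computation model: a unit-cost real RAM.  A program has finitely many      *)
(* integer arrays and real arrays, each named by a numeral of the program     *)
(* text; scalar variables are arrays used at index 0 only.  Integers are      *)
(* machine words: evaluating an integer (sub)expression to a value >= W is an *)
(* error.  Reals are exact, and influence integers only through comparisons.  *)

Inductive iexp : Type :=
  | IConst of nat
  | IRead of nat & iexp
  | IAdd of iexp & iexp
  | ISub of iexp & iexp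
  | IMul of iexp & iexp
  | IDiv of iexp & iexp.

Inductive rexp : Type :=
  | ROfInt of iexp
  | RRead of nat & iexp
  | RAdd of rexp & rexp
  | RSub of rexp & rexp
  | RMul of rexp & rexp
  | RDiv of rexp & rexp.

Inductive bexp : Type :=
  | BIEq of iexp & iexp
  | BILt of iexp & iexp
  | BRLt of rexp & rexp
  | BNot of bexp
  | BAnd of bexp & bexp.

Inductive cmd : Type :=
  | Skip
  | IWrite of nat & iexp & iexp
  | RWrite of nat & iexp & rexp
  | Seq of cmd & cmd
  | If of bexp & cmd & cmd
  | While of bexp & cmd.

Fixpoint icost (e : iexp) : nat :=
  match e with
  | IConst _ => 1
  | IRead _ e1 => (icost e1).+1
  | IAdd e1 e2 | ISub e1 e2 | IMul e1 e2 | IDiv e1 e2 =>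
      (icost e1 + icost e2).+1
  end.

Fixpoint rcost (e : rexp) : nat :=
  match e with
  | ROfInt e1 | RRead _ e1 => (icost e1).+1
  | RAdd e1 e2 | RSub e1 e2 | RMul e1 e2 | RDiv e1 e2 =>
      (rcost e1 + rcost e2).+1
  end.

Fixpoint bcost (b : bexp) : nat :=
  match b with
  | BIEq e1 e2 | BILt e1 e2 => (icost e1 + icost e2).+1
  | BRLt e1 e2 => (rcost e1 + rcost e2).+1
  | BNot b1 => (bcost b1).+1
  | BAnd b1 b2 => (bcost b1 + bcost b2).+1
  end.

Section Semantics.
Variable R : realType.

Record state : Type := State {
  imem : nat -> nat -> nat;
  rmem : nat -> nat -> R
}.

Definition upd (T : Type) (mem : nat -> nat -> T) (a i : nat) (y : T) :
    nat -> nat -> T :=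
  fun a' i' => if (a' == a) && (i' == i) then y else mem a' i'.

Fixpoint ieval (s : state) (e : iexp) : nat :=
  match e with
  | IConst j => j
  | IRead a e1 => imem s a (ieval s e1)
  | IAdd e1 e2 => ieval s e1 + ieval s e2
  | ISub e1 e2 => ieval s e1 - ieval s e2
  | IMul e1 e2 => ieval s e1 * ieval s e2
  | IDiv e1 e2 => ieval s e1 %/ ieval s e2
  end%N.

Fixpoint reval (s : state) (e : rexp) : R :=
  match e with
  | ROfInt e1 => (ieval s e1)%:R
  | RRead a e1 => rmem s a (ieval s e1)
  | RAdd e1 e2 => reval s e1 + reval s e2
  | RSub e1 e2 => reval s e1 - reval s e2
  | RMul e1 e2 => reval s e1 * reval s e2
  | RDiv e1 e2 => reval s e1 / reval s e2
  end.

Fixpoint beval (s : state) (b : bexp) : bool :=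
  match b with
  | BIEq e1 e2 => ieval s e1 == ieval s e2
  | BILt e1 e2 => (ieval s e1 < ieval s e2)%N
  | BRLt e1 e2 => reval s e1 < reval s e2
  | BNot b1 => ~~ beval s b1
  | BAnd b1 b2 => beval s b1 && beval s b2
  end.

(* [isafe], [rsafe], [bsafe]: no overflow and no division by zero. *)
Fixpoint isafe (W : nat) (s : state) (e : iexp) : bool :=
  (ieval s e < W)%N &&
  match e with
  | IConst _ => true
  | IRead _ e1 => isafe W s e1
  | IAdd e1 e2 | ISub e1 e2 | IMul e1 e2 => isafe W s e1 && isafe W s e2
  | IDiv e1 e2 => [&& isafe W s e1, isafe W s e2 & ieval s e2 != 0%N]
  end.

Fixpoint rsafe (W : nat) (s : state) (e : rexp) : bool :=
  match e with
  | ROfInt e1 | RRead _ e1 => isafe W s e1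
  | RAdd e1 e2 | RSub e1 e2 | RMul e1 e2 => rsafe W s e1 && rsafe W s e2
  | RDiv e1 e2 => [&& rsafe W s e1, rsafe W s e2 & reval s e2 != 0]
  end.

Fixpoint bsafe (W : nat) (s : state) (b : bexp) : bool :=
  match b with
  | BIEq e1 e2 | BILt e1 e2 => isafe W s e1 && isafe W s e2
  | BRLt e1 e2 => rsafe W s e1 && rsafe W s e2
  | BNot b1 => bsafe W s b1
  | BAnd b1 b2 => bsafe W s b1 && bsafe W s b2
  end.

(* [exec W s p s' t]: with word bound W, the program p started in s halts     *)
(* without error in s' after t elementary operations.  The relation is        *)
(* deterministic; there is no derivation for an erroneous or diverging run.   *)
Inductive exec (W : nat) : state -> cmd -> state -> nat -> Prop :=
  | exec_skip s : exec W s Skip s 1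
  | exec_iwrite s a e1 e2 :
      isafe W s e1 -> isafe W s e2 ->
      exec W s (IWrite a e1 e2)
        (State (upd (imem s) a (ieval s e1) (ieval s e2)) (rmem s))
        (icost e1 + icost e2).+1
  | exec_rwrite s a e1 e2 :
      isafe W s e1 -> rsafe W s e2 ->
      exec W s (RWrite a e1 e2)
        (State (imem s) (upd (rmem s) a (ieval s e1) (reval s e2)))
        (icost e1 + rcost e2).+1
  | exec_seq s1 s2 s3 p q t1 t2 :
      exec W s1 p s2 t1 -> exec W s2 q s3 t2 ->
      exec W s1 (Seq p q) s3 (t1 + t2)
  | exec_if_true s s' b p q t :
      bsafe W s b -> beval s b -> exec W s p s' t ->
      exec W s (If b p q) s' (bcost b + t).+1
  | exec_if_false s s' b p q t :
      bsafe W s b -> ~~ beval s b -> exec W s q s' t ->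
      exec W s (If b p q) s' (bcost b + t).+1
  | exec_while_true s1 s2 s3 b p t1 t2 :
      bsafe W s1 b -> beval s1 b ->
      exec W s1 p s2 t1 -> exec W s2 (While b p) s3 t2 ->
      exec W s1 (While b p) s3 (bcost b + t1 + t2).+1
  | exec_while_false s b p :
      bsafe W s b -> ~~ beval s b ->
      exec W s (While b p) s (bcost b).+1.

Lemma exec_deterministic W s p s1 t1 s2 t2 :
  exec W s p s1 t1 -> exec W s p s2 t2 -> s1 = s2 /\ t1 = t2.
Proof.
move=> H; elim: H s2 t2 => {s p s1 t1}.
- by move=> s s2 t2 H; inversion H.
- by move=> s a e1 e2 _ _ s2 t2 H; inversion H.
- by move=> s a e1 e2 _ _ s2 t2 H; inversion H.
- move=> s1 s2 s3 p q t1 t2 _ IH1 _ IH2 s4 t4 H; inversion H; subst.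
  have [? ?] := IH1 _ _ H3; subst; by have [-> ->] := IH2 _ _ H6.
- move=> s s' b p q t _ Hb _ IH s2 t2 H; inversion H; subst.
    by have [-> ->] := IH _ _ H8.
  by rewrite Hb in H7.
- move=> s s' b p q t _ Hb _ IH s2 t2 H; inversion H; subst.
    by rewrite H7 in Hb.
  by have [-> ->] := IH _ _ H8.
- move=> s1 s2 s3 b p t1 t2 _ Hb _ IH1 _ IH2 s4 t4 H; inversion H; subst.
    have [? ?] := IH1 _ _ H5; subst; by have [-> ->] := IH2 _ _ H8.
  by rewrite Hb in H6.
- move=> s b p _ Hb s2 t2 H; inversion H; subst => //.
  by rewrite H3 in Hb.
Qed.

(* Input: integer array 0 holds n, m, k; integer arrays 1 and 2 the edge      *)
(* list; real arrays 0 and 1 the capacities c and the LP solution x.  All     *)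
(* other memory is 0.                                                         *)
Definition input_state (n m k : nat) (ends : 'I_m -> 'I_n * 'I_n)
    (c x : 'I_m -> R) : state :=
  State
    (fun a i =>
       match a with
       | 0 => nth 0 [:: n; m; k] i
       | 1 => if insub i is Some e then val (ends e).1 else 0
       | 2 => if insub i is Some e then val (ends e).2 else 0
       | _ => 0
       end%N)
    (fun a i =>
       match a with
       | 0 => if insub i is Some e then c e else 0
       | 1 => if insub i is Some e then x e else 0
       | _ => 0
       end).

(* Output: the edge set whose characteristic vector is integer array 3. *)
Definition output_set (m : nat) (s : state) : {set 'I_m} :=
  [set e : 'I_m | imem s 3 e != 0%N].

End Semantics.

(* The summand 1 only matters when m = 0: a simple graph with an edge has     *)
(* n >= 2, so that m ln n >= ln 2.                                            *)
Definition mlogn (R : realType) (n m : nat) : R := m%:R * ln n%:R + 1.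

(* Main.v *)
(* Sort the edges by x and let A_t be the first t of them, with n - cn_t      *)
(* components and a remaining capacity of w_t; let V be the LP value.         *)
(* Averaging over a threshold for x in [0, 1], feasibility for the Kruskal    *)
(* forest of the edges with x < 1 says that the points (n - cn_t, w_t) have   *)
(* an average with first coordinate at least k and second at most V.  Hence   *)
(* either some A_t has at least k components and w_t <= V, and the remaining  *)
(* edges are the cut, or two points with n - cn_i > k > n - cn_j span a chord *)
(* of height at most V above k; it is found by one scan for the extreme       *)
(* slopes seen from (k, V).                                                   *)
(* In the second case, cut all edges beyond A_j.  Inside each component of    *)
(* A_j discard the component of A_i with the largest capacity towards the     *)
(* others, which accounts for at least 1/n of the total (twice w_i - w_j at   *)
(* most), and split off the k - (n - cn_j) cheapest of the others.            *)
(* The time is dominated by two tournament sorts and by O(m) root searches in *)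
(* a union-find forest linked by rank, whose links carry a time stamp so that *)
(* every partition A_t remains accessible.  Vertices are only touched through *)
(* edges, since n may be much larger than m.                                  *)
Require Import Defs.
From HB Require Import structures.
From mathcomp Require Import all_boot all_order all_algebra.
From mathcomp Require Import reals exp.
From mathcomp Require Import zify ring lra.

Set Implicit Arguments.
Unset Strict Implicit.
Unset Printing Implicit Defensive.

Import Order.TTheory GRing.Theory Num.Theory.
Local Open Scope ring_scope.

(** * Running times of programs *)

(** Let [V] be the LP value. In the order of increasing x, the first t edges leave [n - cn t]
    components, and the other edges cost [w t].

    Lagrangian step: for every s >= 0 some t satisfies [w t + s * cn t <= V + s * (n - k)]
    ([lagrangian_bound]). For a threshold uniform in [0, 1], an edge lies beyond the prefix below
    the threshold with probability min(x, 1). So [w t] averages to at most [V], and [cn t] averages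
    to the sum of 1 - min(x, 1) over the links of Kruskal's algorithm. That sum is at most n - k by
    the LP constraint for the forest of links with x < 1 ([forest_slack]). A minimum is at most an
    average ([abel_min]).

    If some prefix with at least k components has [w t <= V], the edges beyond it are the cut; its
    cost is within the bound because n >= 2 as soon as there is an edge. Otherwise [chord_below]
    compares slopes seen from (k, V). With A = n - k - cn_i > 0 and B = k + cn_j - n > 0, the
    extreme prefixes i and j satisfy B * w_i + A * w_j <= (A + B) * V.

    Rounding step: cut everything beyond prefix j, which leaves k - B components, and split B
    classes of prefix i off. At least A + B classes remain as candidates after one has been
    discarded per group ([cand_count]). The B cheapest of them cost at most B / (A + B) of the
    candidates' total D ([sorted_prefix_sum]). That total is at most 1 - 1/n of the D of all listed
    classes ([sum_D_cand]), which counts each crossing edge at most twice ([sum_D_lst]).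
    [rounding_arith] combines these bounds, and [rounding_components] counts the components.

    Time: the sorts have tournaments of depth O(log n), root searches have length at most log2 n by
    union by rank, and all other loops do O(1) work per edge or listed class. Time and correctness
    are proved together, through the triples [runs]. *)

Fixpoint iwritten (c : cmd) : seq nat :=
  match c with
  | IWrite a _ _ => [:: a]
  | Seq p q | If _ p q => iwritten p ++ iwritten q
  | While _ p => iwritten p
  | _ => [::]
  end.

Fixpoint rwritten (c : cmd) : seq nat :=
  match c with
  | RWrite a _ _ => [:: a]
  | Seq p q | If _ p q => rwritten p ++ rwritten q
  | While _ p => rwritten p
  | _ => [::]
  end.

Fixpoint loop_free (c : cmd) : bool :=
  match c with
  | Seq p q | If _ p q => loop_free p && loop_free q
  | While _ _ => false
  | _ => true
  end.

(** The value for [While] is a dummy: this worst-case time is applied to loop-free programs only. *)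
Fixpoint cmd_time (c : cmd) : nat :=
  match c with
  | Skip => 1
  | IWrite _ e1 e2 => (icost e1 + icost e2).+1
  | RWrite _ e1 e2 => (icost e1 + rcost e2).+1
  | Seq p q => cmd_time p + cmd_time q
  | If b p q => (bcost b + maxn (cmd_time p) (cmd_time q)).+1
  | While _ _ => 0
  end.

Definition ivar (a : nat) : iexp := IRead a (IConst 0).
Definition rvar (a : nat) : rexp := RRead a (IConst 0).
Definition iset (a : nat) (e : iexp) : cmd := IWrite a (IConst 0) e.
Definition rset (a : nat) (e : rexp) : cmd := RWrite a (IConst 0) e.
Definition incr (a : nat) : cmd := iset a (IAdd (ivar a) (IConst 1)).
Definition for_loop (a h j : nat) (c : cmd) : cmd :=
  While (BILt (ivar a) (IRead h (IConst j))) (Seq c (incr a)).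

Section Runs.
Variables (R : realType) (W : nat).
Local Notation state := (state R).
Implicit Types (s : state) (c : cmd) (Q : state -> Prop).

(** Straight-line code is run as a function, so that goals about it become computations. A loop is
    passed over here; the lemmas that use [srun] ask for [loop_free]. *)
Fixpoint srun s c : state :=
  match c with
  | IWrite a e1 e2 =>
      State (upd (imem s) a (ieval s e1) (ieval s e2)) (rmem s)
  | RWrite a e1 e2 =>
      State (imem s) (upd (rmem s) a (ieval s e1) (reval s e2))
  | Seq p q => srun (srun s p) q
  | If b p q => if beval s b then srun s p else srun s q
  | _ => s
  end.

Fixpoint ssafe s c : Prop :=
  match c with
  | IWrite a e1 e2 => isafe W s e1 && isafe W s e2
  | RWrite a e1 e2 => isafe W s e1 && rsafe W s e2
  | Seq p q => ssafe s p /\ ssafe (srun s p) q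
  | If b p q =>
      bsafe W s b /\ if beval s b then ssafe s p else ssafe s q
  | _ => True
  end.

(** The frame condition, read off the program text. [runs_weaken] and [runs_seq] supply it for free,
    so that postconditions and invariants only describe arrays that are written. *)
Definition same c s s' : Prop :=
  (forall a i, a \notin iwritten c -> imem s' a i = imem s a i) /\
  (forall a i, a \notin rwritten c -> rmem s' a i = rmem s a i).

Lemma same_trans c s1 s2 s3 : same c s1 s2 -> same c s2 s3 -> same c s1 s3.
Proof.
move=> [i1 r1] [i2 r2]; split=> a i ha; first by rewrite i2 // i1.
by rewrite r2 // r1.
Qed.

Lemma same_imem c s s' a : same c s s' -> a \notin iwritten c -> imem s' a = imem s a.
Proof. by move=> [h _] ha; apply: boolp.funext => i; apply: h. Qed.

Lemma same_rmem c s s' a : same c s s' -> a \notin rwritten c -> rmem s' a = rmem s a.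
Proof. by move=> [_ h] ha; apply: boolp.funext => i; apply: h. Qed.

Lemma exec_same s c s' t : exec W s c s' t -> same c s s'.
Proof.
elim=> {s c s' t} //=.
- move=> s a e1 e2 _ _; split=> //= a' i; rewrite inE /upd => /negbTE ->.
  by [].
- move=> s a e1 e2 _ _; split=> //= a' i; rewrite inE /upd => /negbTE ->.
  by [].
- move=> s1 s2 s3 p q t1 t2 _ [i1 r1] _ [i2 r2]; split=> a i /=;
    rewrite mem_cat negb_or => /andP[hp hq]; first by rewrite i2 // i1.
  by rewrite r2 // r1.
- move=> s s' b p q t _ _ _ [i1 r1]; split=> a i /=;
    rewrite mem_cat negb_or => /andP[hp hq]; first by rewrite i1.
  by rewrite r1.
- move=> s s' b p q t _ _ _ [i1 r1]; split=> a i /=;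
    rewrite mem_cat negb_or => /andP[hp hq]; first by rewrite i1.
  by rewrite r1.
- move=> s1 s2 s3 b p t1 t2 _ _ _ h1 _ h2.
  exact: (@same_trans p s1 s2 s3).
Qed.

(** A total-correctness triple with a time bound: the existence of an [exec] derivation already
    excludes divergence, overflow and division by zero. *)
Definition runs s c (T : nat) Q : Prop :=
  exists s' t, [/\ exec W s c s' t, (t <= T)%N & Q s'].

Lemma runs_weaken s c T Q T' Q' :
  runs s c T Q -> (T <= T')%N -> (forall s', Q s' -> same c s s' -> Q' s') ->
  runs s c T' Q'.
Proof.
move=> [s' [t [ex lt q]]] lT h; exists s', t; split=> //.
  exact: leq_trans lt lT.
by apply: h => //; apply: exec_same ex.
Qed.

Lemma runs_time T s c T' Q : (T <= T')%N -> runs s c T Q -> runs s c T' Q.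
Proof. by move=> le h; apply: (runs_weaken h le). Qed.

Lemma runs_seq s p q Tp Tq Q :
  runs s p Tp (fun s' => same p s s' -> runs s' q Tq Q) ->
  runs s (Seq p q) (Tp + Tq) Q.
Proof.
move=> [s' [t [ex lt]]] /(_ (exec_same ex)) [s'' [t' [ex' lt' q']]].
exists s'', (t + t')%N; split=> //; first exact: exec_seq ex ex'.
by rewrite leq_add.
Qed.

Lemma runs_if s b p q T Q :
  bsafe W s b -> (beval s b -> runs s p T Q) -> (~~ beval s b -> runs s q T Q) ->
  runs s (If b p q) (bcost b + T).+1 Q.
Proof.
move=> sb hp hq; case: (boolP (beval s b)) => hb.
  have [s' [t [ex lt q']]] := hp hb.
  exists s', (bcost b + t).+1; split=> //; first exact: exec_if_true.
  by rewrite ltnS leq_add2l.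
have [s' [t [ex lt q']]] := hq hb.
exists s', (bcost b + t).+1; split=> //; first exact: exec_if_false.
by rewrite ltnS leq_add2l.
Qed.

Lemma runs_branch T s b p q T' Q :
  (bcost b + T < T')%N -> bsafe W s b ->
  (beval s b -> runs s p T Q) -> (~~ beval s b -> runs s q T Q) ->
  runs s (If b p q) T' Q.
Proof. by move=> le sb hp hq; apply: (runs_time le); apply: runs_if. Qed.

Lemma runs_straight s c Q :
  loop_free c -> ssafe s c -> Q (srun s c) -> runs s c (cmd_time c) Q.
Proof.
elim: c s Q => //=.
- by move=> s Q _ _ q; exists s, 1%N; split=> //; apply: exec_skip.
- move=> a e1 e2 s Q _ /andP[h1 h2] q; do 2 eexists; split; last exact: q.
    exact: exec_iwrite.
  exact: leqnn.
- move=> a e1 e2 s Q _ /andP[h1 h2] q; do 2 eexists; split; last exact: q.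
    exact: exec_rwrite.
  exact: leqnn.
- move=> p IHp q IHq s Q /andP[lp lq] [sp sq] h.
  by apply: runs_seq; apply: IHp => // _; apply: IHq.
- move=> b p IHp q IHq s Q /andP[lp lq] [sb sc] h.
  apply: runs_if => // hb.
    rewrite hb in sc h.
    by apply: (runs_weaken (IHp s Q lp sc h)) => //; apply: leq_maxl.
  rewrite (negbTE hb) in sc h.
  by apply: (runs_weaken (IHq s Q lq sc h)) => //; apply: leq_maxr.
Qed.

Lemma runs_cmd s c T Q :
  loop_free c -> (cmd_time c <= T)%N -> ssafe s c -> Q (srun s c) ->
  runs s c T Q.
Proof. by move=> lf le sf q; apply: (runs_time le); apply: runs_straight. Qed.

Lemma runs_cons s p q Tp Tq Q :
  loop_free p -> (cmd_time p <= Tp)%N -> ssafe s p ->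
  runs (srun s p) q Tq Q -> runs s (Seq p q) (Tp + Tq) Q.
Proof. by move=> lf le sf h; apply: runs_seq; apply: runs_cmd. Qed.

(** The index of [I] counts completed iterations, and a true guard forces it below N, so at most N
    iterations occur. The last summand pays for the failing test. *)
Lemma runs_while (I : nat -> state -> Prop) s b c T N :
  I 0%N s ->
  (forall i s', I i s' -> same c s s' ->
     bsafe W s' b /\ (beval s' b -> (i < N)%N /\ runs s' c T (I i.+1))) ->
  runs s (While b c) (N * (bcost b + T).+1 + (bcost b).+1)
    (fun s' => exists2 i, I i s' & ~~ beval s' b).
Proof.
move=> I0 step.
suff H d : forall i s1, (N - i <= d)%N -> I i s1 -> same c s s1 ->
    runs s1 (While b c) (d * (bcost b + T).+1 + (bcost b).+1)
      (fun s' => exists2 i, I i s' & ~~ beval s' b).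
  by apply: (H N 0%N s) => //; rewrite subn0.
elim: d => [|d IHd] i s1 hd Ii sm; have [sb hb] := step _ _ Ii sm.
  case: (boolP (beval s1 b)) => [/hb[lt _]|nb].
    by move: hd; rewrite leqn0 subn_eq0 leqNgt lt.
  exists s1, (bcost b).+1; split=> //; first exact: exec_while_false.
  by exists i.
case: (boolP (beval s1 b)) => [bb|nb]; last first.
  exists s1, (bcost b).+1; split=> //; first exact: exec_while_false.
    by rewrite leq_addl.
  by exists i.
have [lt [s2 [t2 [ex2 lt2 I2]]]] := hb bb.
have sm2 := same_trans sm (exec_same ex2).
have [|s3 [t3 [ex3 lt3 q]]] := IHd i.+1 s2 _ I2 sm2.
  by rewrite subnS; lia.
exists s3, (bcost b + t2 + t3).+1; split=> //; first exact: exec_while_true ex3.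
by rewrite mulSn; lia.
Qed.

Definition set_imem s a i y : state := State (upd (imem s) a i y) (rmem s).

(** The 15 covers one guard test and one increment, the 6 the final test. The body must establish
    the invariant for the state whose counter has already advanced. *)
Lemma runs_for (I : nat -> state -> Prop) s a h j c T lo hi :
  imem s a 0 = lo -> imem s h j = hi -> (lo <= hi)%N ->
  (hi < W)%N -> (j < W)%N -> (1 < W)%N ->
  a \notin iwritten c -> h \notin a :: iwritten c ->
  I lo s ->
  (forall i s', (lo <= i < hi)%N -> imem s' a 0 = i -> I i s' ->
     same (Seq c (incr a)) s s' ->
     runs s' c T (fun s2 => same c s' s2 -> I i.+1 (set_imem s2 a 0 i.+1))) ->
  runs s (for_loop a h j c) ((hi - lo) * (T + 15) + 6)
    (fun s' => I hi s' /\ imem s' a 0 = hi).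
Proof.
move=> sa sh lohi hW jW W1 ac hc Ilo step.
pose J i s' := [/\ imem s' a 0 = (lo + i)%N, (lo + i <= hi)%N & I (lo + i)%N s'].
have W0 : (0 < W)%N by lia.
have hc' : h \notin iwritten (Seq c (incr a)).
  by rewrite /= mem_cat inE; move: hc; rewrite inE !negb_or andbC.
have H := @runs_while J s (BILt (ivar a) (IRead h (IConst j)))
            (Seq c (incr a)) (T + 8) (hi - lo).
apply: (runs_weaken (H _ _)).
- by split=> //; rewrite ?addn0.
- move=> i s' [s'a le Ii] sm /=; rewrite s'a (proj1 sm) // sh; split.
    by apply/andP; split; apply/andP; split=> //; lia.
  move=> lt; split; first by lia.
  apply: (@runs_seq _ _ _ T 8).
  have lt' : (lo <= lo + i < hi)%N by lia.
  have [s2 [t2 [ex2 lt2 I2]]] := step _ _ lt' s'a Ii sm.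
  exists s2, t2; split=> // sm2; have {}I2 := I2 sm2.
  have s2a : imem s2 a 0 = (lo + i)%N by rewrite (proj1 sm2).
  apply: (runs_weaken (runs_straight _ _ _) _ (fun s' q _ => q)) => //=.
    by rewrite s2a; apply/and5P; split=> //; try lia; apply/andP; split; lia.
  rewrite s2a addn1; split=> /=; rewrite ?addnS //.
  by rewrite /upd !eqxx.
- rewrite /= leq_add2r leq_mul2l; apply/orP; right; lia.
- move=> s' [i [s'a le Ii]] /= + sm; rewrite s'a (proj1 sm) // sh -leqNgt => ge.
  have e : (lo + i)%N = hi by lia.
  by rewrite -e.
Qed.

End Runs.

(** * Tournament sort *)

(* Tournament sort of the indices 0, ..., N - 1 by the keys in real array 2.  *)
(* Scalar 10 is N; array 11 is the tournament tree, with leaves N, ..., 2N-1, *)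
(* where i.+1 stands for contestant i and 0 for nobody; the sorted indices    *)
(* are written to array 12.                                                   *)
Definition play_match : cmd :=
  let l := IRead 11 (IMul (IConst 2) (ivar 14)) in
  let r := IRead 11 (IAdd (IMul (IConst 2) (ivar 14)) (IConst 1)) in
  If (BIEq l (IConst 0)) (IWrite 11 (ivar 14) r)
  (If (BIEq r (IConst 0)) (IWrite 11 (ivar 14) l)
  (If (BRLt (RRead 2 (ISub r (IConst 1))) (RRead 2 (ISub l (IConst 1))))
     (IWrite 11 (ivar 14) r) (IWrite 11 (ivar 14) l))).

Definition enter_leaf : cmd :=
  IWrite 11 (IAdd (ivar 10) (ivar 13)) (IAdd (ivar 13) (IConst 1)).

Definition build_tree : cmd :=
  While (BILt (IConst 0) (ivar 14))
    (Seq play_match (iset 14 (ISub (ivar 14) (IConst 1)))).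

Definition replay : cmd :=
  While (BILt (IConst 0) (ivar 14))
    (Seq play_match (iset 14 (IDiv (ivar 14) (IConst 2)))).

Definition pop_winner : cmd :=
  Seq (IWrite 12 (ivar 13) (ISub (IRead 11 (IConst 1)) (IConst 1)))
  (Seq (iset 14 (IAdd (ivar 10) (IRead 12 (ivar 13))))
  (Seq (IWrite 11 (ivar 14) (IConst 0))
       (iset 14 (IDiv (ivar 14) (IConst 2))))).

Definition sort_keys : cmd :=
  Seq (iset 13 (IConst 0))
  (Seq (for_loop 13 10 0 enter_leaf)
  (Seq (iset 14 (ISub (ivar 10) (IConst 1)))
  (Seq build_tree
  (Seq (iset 13 (IConst 0))
       (for_loop 13 10 0 (Seq pop_winner replay)))))).

Section Tournament.
Variables (R : realType) (key : nat -> R).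

Definition winner (a b : nat) : nat :=
  if a == 0%N then b else if b == 0%N then a
  else if key b.-1 < key a.-1 then b else a.

(** The preorder of the tournament: smaller keys win and 0, that is nobody, loses to everyone.
    [winner] picks a minimum for it. *)
Definition beats (a b : nat) : bool :=
  (b == 0%N) || (a != 0%N) && (key a.-1 <= key b.-1).

Lemma beats_refl a : beats a a.
Proof. by rewrite /beats lexx; case: eqP. Qed.

Lemma beats_trans a b c : beats a b -> beats b c -> beats a c.
Proof.
rewrite /beats; case: (c == 0%N) => //=.
case: (b == 0%N) => //= /andP[-> h1 h2] /=.
exact: le_trans h1 h2.
Qed.

Lemma winner_beats_l a b : beats (winner a b) a.
Proof.
rewrite /winner /beats; case: (a =P 0%N) => //= a0; case: (b =P 0%N) => //= b0.
  by rewrite lexx; case: eqP a0.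
by case: ltP => [/ltW ->|]; rewrite ?lexx; [case: eqP b0|case: eqP a0].
Qed.

Lemma winner_beats_r a b : beats (winner a b) b.
Proof.
rewrite /winner /beats; case: (b =P 0%N) => //= b0.
case: (a =P 0%N) => //= a0; first by rewrite lexx; case: eqP b0.
by case: ltP => [_|->]; rewrite ?lexx; [case: eqP b0|case: eqP a0].
Qed.

Lemma winner_or a b : winner a b = a \/ winner a b = b.
Proof. by rewrite /winner; do !case: ifP => _; auto. Qed.

Definition node_ok (T : nat -> nat) v : Prop :=
  T v = winner (T (2 * v)%N) (T (2 * v + 1)%N).

Section Tree.
Variables (N : nat) (T : nat -> nat).
Hypothesis T_ok : forall v, (0 < v < N)%N -> node_ok T v.
Hypothesis T_leaf : forall i, (i < N)%N -> T (N + i)%N = 0%N \/ T (N + i)%N = i.+1.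

(** An internal entry is copied from a child, so following the copies downwards ends at a leaf still
    occupied by the contestant that the entry names. *)
Lemma tree_entry v : (0 < v < 2 * N)%N ->
  T v = 0%N \/ exists2 i, (i < N)%N & T v = i.+1 /\ T (N + i)%N = i.+1.
Proof.
have [d] := ubnP (2 * N - v)%N; elim: d v => // d IHd v ltd vN.
case: (ltnP v N) => [vlt|vge].
  rewrite T_ok ?vlt; last by lia.
  by case: (winner_or (T (2 * v)%N) (T (2 * v + 1)%N)) => ->; apply: IHd; lia.
have e : v = (N + (v - N))%N by lia.
case: (@T_leaf (v - N)%N); rewrite -?e; [lia|by left|move=> h; right].
by exists (v - N)%N; rewrite -?e //; lia.
Qed.

(** Climb from v to the root: for 1 < v < 2N the node v / 2 is internal, and its entry beats both
    children. *)
Lemma tree_beats v : (0 < v < 2 * N)%N -> beats (T 1) (T v).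
Proof.
have [d] := ubnP v; elim: d v => // d IHd v ltd vN.
case: (v =P 1%N) => [->|v1]; first exact: beats_refl.
apply: (@beats_trans _ (T (v %/ 2)%N)).
  by apply: IHd; [have := divn_eq v 2; lia|lia].
rewrite (@T_ok (v %/ 2)%N); last by lia.
have : v = (2 * (v %/ 2))%N \/ v = (2 * (v %/ 2) + 1)%N by lia.
by case=> e; rewrite [X in beats _ (T X)]e; [apply: winner_beats_l|apply: winner_beats_r].
Qed.

Lemma tree_le v : (0 < v < 2 * N)%N -> (T v <= N)%N.
Proof. by move/tree_entry => [->|[i iN [-> _]]]. Qed.

End Tree.

End Tournament.

(** * Time and correctness of the tournament sort *)

Section SortRuns.
Variables (R : realType) (W : nat).
Local Notation state := (state R).

Lemma play_match_runs (s : state) v :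
  imem s 14 0 = v -> (2 * v + 10 < W)%N -> (imem s 11 (2 * v) < W)%N ->
  (imem s 11 (2 * v + 1) < W)%N ->
  runs W s play_match (cmd_time play_match)
   (fun s' => s' = set_imem s 11 v
      (winner (rmem s 2) (imem s 11 (2 * v)) (imem s 11 (2 * v + 1)))).
Proof.
move=> vE vW lW rW; apply: runs_straight => //=; rewrite vE; last first.
  rewrite /winner !subn1.
  by case: eqP => //= _; case: eqP => //= _; case: ltP.
split; first by lia.
case: eqP => _; first by lia.
split; first by lia.
case: eqP => _; first by lia.
split; first by lia.
by case: ltP => _; lia.
Qed.

Lemma upd_neq (T : Type) (mem : nat -> nat -> T) a i y j :
  j <> i -> upd mem a i y a j = mem a j.
Proof. by move=> /eqP/negbTE ne; rewrite /upd ne andbF. Qed.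

Lemma node_ok_upd (key : nat -> R) (T : nat -> nat -> nat) a v y u :
  (0 < u)%N -> u <> v -> u <> (v %/ 2)%N -> node_ok key (T a) u ->
  node_ok key (upd T a v y a) u.
Proof. by move=> u0 uv u2 h; rewrite /node_ok !upd_neq //; lia. Qed.

Lemma build_tree_runs (s : state) N :
  imem s 14 0 = N.-1 -> (2 * N + 10 < W)%N ->
  (forall i, (i < N)%N -> imem s 11 (N + i)%N = i.+1) ->
  runs W s build_tree (N * 100 + 10)
   (fun s' => (forall i, (i < N)%N -> imem s' 11 (N + i)%N = i.+1) /\
      (forall v, (0 < v < N)%N -> node_ok (rmem s 2) (imem s' 11) v)).
Proof.
move=> vE NW leaf.
(* Nodes are settled from N - 1 downwards, so both children of a node are final when it is
   played. *)
pose I i (s' : state) := [/\ imem s' 14 0 = (N.-1 - i)%N,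
  (forall j, (j < N)%N -> imem s' 11 (N + j)%N = j.+1),
  (forall v, (N.-1 - i < v < N)%N -> node_ok (rmem s 2) (imem s' 11) v) &
  (forall v, (N.-1 - i < v < 2 * N)%N -> (imem s' 11 v <= N)%N)].
apply: (runs_weaken (@runs_while _ _ I _ _ _ (cmd_time play_match + 8) N _ _)).
- split=> //; first by rewrite subn0.
    by move=> v; lia.
  move=> v vN; rewrite (_ : v = N + (v - N))%N; last by lia.
  by rewrite leaf; lia.
- move=> i s' [v'E leaf' ok bd] sm /=; rewrite v'E; split; first by lia.
  move=> lt; split; first by lia.
  apply: runs_seq; apply: (runs_weaken (play_match_runs v'E _ _ _)) => //; try lia.
  + by apply: leq_ltn_trans (bd _ _) _; lia.
  + by apply: leq_ltn_trans (bd _ _) _; lia.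
  move=> s2 -> _ _.
  apply: runs_cmd => //=.
    by rewrite /upd /= v'E; lia.
  set v := (N.-1 - i)%N.
  have -> : rmem s' 2 = rmem s 2.
    by apply: boolp.funext => j; rewrite (proj2 sm).
  split=> /=.
  + by rewrite /upd /= v'E; lia.
  + by move=> j jN; rewrite [LHS]upd_neq ?leaf' //; lia.
  + move=> u uN; case: (u =P v) => [->|ne].
      by rewrite /node_ok /= /upd /= eqxx !ifN ?eqxx //=; lia.
    rewrite (_ : upd _ 14 _ _ 11 = upd (imem s') 11 v
       (winner (rmem s 2) (imem s' 11 (2 * v)) (imem s' 11 (2 * v + 1))) 11) //.
    by apply: node_ok_upd; try lia; apply: ok; lia.
  + move=> u uN; rewrite /upd /=; case: eqP => [_|ne]; last by apply: bd; lia.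
    by case: (winner_or (rmem s 2) (imem s' 11 (2 * v)) (imem s' 11 (2 * v + 1)))
      => ->; apply: bd; lia.
- by rewrite /=; lia.
- move=> s' [i [v'E leaf' ok bd] /=]; rewrite v'E => nlt _; split=> // v vN.
  by apply: ok; lia.
Qed.

(** Changing a leaf can only spoil its ancestors. After i rounds the one possibly wrong node is v0 /
    2^i, and L halvings bring it to 0, which is not a node. *)
Lemma replay_runs (s : state) N L (leaf : nat -> nat) v0 :
  imem s 14 0 = v0 -> (v0 < N)%N -> (N <= 2 ^ L)%N -> (2 * N + 10 < W)%N ->
  (forall v, (0 < v < N)%N -> v <> v0 -> node_ok (rmem s 2) (imem s 11) v) ->
  (forall v, (0 < v < 2 * N)%N -> (imem s 11 v <= N)%N) ->
  (forall i, (i < N)%N -> imem s 11 (N + i)%N = leaf i) ->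
  runs W s replay (L * 100 + 10)
   (fun s' => (forall i, (i < N)%N -> imem s' 11 (N + i)%N = leaf i) /\
      (forall v, (0 < v < N)%N -> node_ok (rmem s 2) (imem s' 11) v)).
Proof.
move=> vE v0N NL NW ok0 bd0 leaf0.
pose I i (s' : state) := [/\ imem s' 14 0 = (v0 %/ 2 ^ i)%N,
  (forall j, (j < N)%N -> imem s' 11 (N + j)%N = leaf j),
  (forall v, (0 < v < N)%N -> v <> (v0 %/ 2 ^ i)%N ->
     node_ok (rmem s 2) (imem s' 11) v) &
  (forall v, (0 < v < 2 * N)%N -> (imem s' 11 v <= N)%N)].
apply: (runs_weaken (@runs_while _ _ I _ _ _ (cmd_time play_match + 8) L _ _)).
- by split; rewrite ?expn0 ?divn1.
- move=> i s' [v'E leaf' ok bd] sm /=.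
  have vle : (v0 %/ 2 ^ i <= v0)%N by apply: leq_div.
  set v := (v0 %/ 2 ^ i)%N in v'E ok vle *.
  rewrite v'E; split; first by lia.
  move=> lt; split.
    rewrite ltnNge; apply/negP => Li.
    suff : v = 0%N by lia.
    by apply: divn_small; apply: leq_trans v0N _; apply: leq_trans NL _;
       rewrite leq_exp2l.
  apply: runs_seq; apply: (runs_weaken (play_match_runs v'E _ _ _)) => //; try lia.
  + by apply: leq_ltn_trans (bd _ _) _; lia.
  + by apply: leq_ltn_trans (bd _ _) _; lia.
  move=> s2 -> _ _.
  apply: runs_cmd => //=.
    by rewrite /upd /= v'E; lia.
  have -> : rmem s' 2 = rmem s 2.
    by apply: boolp.funext => j; rewrite (proj2 sm).
  split=> /=.
  + by rewrite /upd /= v'E expnSr divnMA.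
  + by move=> j jN; rewrite [LHS]upd_neq ?leaf' //; lia.
  + move=> u uN; rewrite expnSr divnMA -/v => ne2; case: (u =P v) => [->|ne].
      by rewrite /node_ok /= /upd /= eqxx !ifN ?eqxx //=; lia.
    rewrite (_ : upd _ 14 _ _ 11 = upd (imem s') 11 v
       (winner (rmem s 2) (imem s' 11 (2 * v)) (imem s' 11 (2 * v + 1))) 11) //.
    by apply: node_ok_upd; try lia; apply: ok; lia.
  + move=> u uN; rewrite /upd /=; case: eqP => [_|ne]; last by apply: bd; lia.
    by case: (winner_or (rmem s 2) (imem s' 11 (2 * v)) (imem s' 11 (2 * v + 1)))
      => ->; apply: bd; lia.
- by rewrite /=; lia.
- move=> s' [i [v'E leaf' ok bd] /=]; rewrite v'E => nlt _; split=> // v vN.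
  by apply: ok => //; lia.
Qed.

Lemma eq_mkseq_in (T : Type) (f g : nat -> T) p :
  (forall q, (q < p)%N -> f q = g q) -> mkseq f p = mkseq g p.
Proof.
move=> h; apply: (@eq_from_nth _ (f 0%N)); rewrite !size_mkseq // => i ip.
by rewrite !nth_mkseq // h.
Qed.

Lemma mkseqSr (T : Type) (f : nat -> T) p : mkseq f p.+1 = rcons (mkseq f p) (f p).
Proof. by rewrite /mkseq -addn1 iotaD map_cat cats1. Qed.

Lemma uniq_mkseq_perm (f : nat -> nat) N :
  uniq (mkseq f N) -> (forall q, (q < N)%N -> (f q < N)%N) ->
  perm_eq (mkseq f N) (iota 0 N).
Proof.
move=> u h; have sub : {subset mkseq f N <= iota 0 N}.
  by move=> x /mapP[q]; rewrite !mem_iota !add0n /= => /h qN ->.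
have [|_ e] := uniq_min_size u sub; first by rewrite size_mkseq size_iota.
by apply: uniq_perm => //; rewrite iota_uniq.
Qed.

Lemma sort_keys_runs (s : state) N L :
  imem s 10 0 = N -> (N <= 2 ^ L)%N -> (2 * N + 10 < W)%N ->
  runs W s sort_keys (300 * (N * L.+1).+1)
   (fun s' => perm_eq (mkseq (imem s' 12) N) (iota 0 N) /\
      (forall p q, (p <= q < N)%N ->
         rmem s 2 (imem s' 12 p) <= rmem s 2 (imem s' 12 q))).
Proof.
move=> NE NL NW.
apply: (@runs_time _ _ (4 + (N * (12 + 15) + 6 + (6 + (N * 100 + 10 +
   (4 + (N * (60 + (L * 100 + 10) + 15) + 6))))))); first by nia.
apply: runs_cons => //=; first by lia.
apply: runs_seq.
pose I1 p (s' : state) := forall i, (i < p)%N -> imem s' 11 (N + i)%N = i.+1.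
apply: (runs_weaken (@runs_for _ _ I1 _ _ _ _ _ 12 0 N _ _ _ _ _ _ _ _ _ _)) => //; try lia.
  move=> p s' pN pE Ip sm; apply: runs_cmd => //=.
    by rewrite pE (proj1 sm) //= /upd /= NE; lia.
  move=> _ j jp; rewrite /= /upd /= (proj1 sm) //= /upd /= NE pE.
  by rewrite eqn_add2l; case: eqP => [->|ne]; [rewrite addn1|apply: Ip; lia].
move=> s1 [I1N _] sm1 _.
have N1 : imem s1 10 0 = N by rewrite (proj1 sm1) //= /upd /= NE.
apply: runs_cons => //=; first by rewrite N1; lia.
apply: runs_seq.
apply: (runs_weaken (@build_tree_runs _ N _ _ _)) => //=.
  by rewrite /upd /= N1 subn1.
move=> s3 [leaf3 ok3] sm3 _.
have N3 : imem s3 10 0 = N by rewrite (proj1 sm3) //= /upd /= N1.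
have K1 : rmem s1 2 = rmem s 2.
  by apply: boolp.funext => j; rewrite (proj2 sm1).
have K3 : rmem s3 2 = rmem s 2.
  by apply: boolp.funext => j; rewrite (proj2 sm3) //= K1.
rewrite /= K1 in ok3.
apply: runs_cons => //=; first by lia.
set key := rmem s 2 in ok3 K3 *.
(* A leaf is blank exactly when its contestant has been output. The last clause says that each
   output key is minimal among the contestants not output before it, which yields sortedness at the
   end. *)
pose I p (s' : state) := [/\
  (forall v, (0 < v < N)%N -> node_ok key (imem s' 11) v),
  (forall i, (i < N)%N -> imem s' 11 (N + i)%N =
     if i \in mkseq (imem s' 12) p then 0%N else i.+1),
  uniq (mkseq (imem s' 12) p),
  (forall q, (q < p)%N -> (imem s' 12 q < N)%N) &
  (forall q i, (q < p)%N -> (i < N)%N -> i \notin mkseq (imem s' 12) q ->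
     key (imem s' 12 q) <= key i)].
apply: (runs_weaken (@runs_for _ _ I _ _ _ _ _ (60 + (L * 100 + 10)) 0 N
          _ _ _ _ _ _ _ _ _ _)) => //; try lia; last first.
  move=> s' [[_ _ u bd le] _] _; split; first exact: uniq_mkseq_perm.
  move=> p q /andP[pq qN]; apply: le; [lia|by apply: bd|].
  apply/mapP => -[r]; rewrite mem_iota /= add0n => rp e.
  have := mkseq_uniqP _ _ u; move/(_ q r); rewrite !inE => h.
  by have := h qN (ltn_trans rp (leq_ltn_trans pq qN)) e; lia.
move=> p s' /= pN pE [ok leaf u bd le] sm.
have N' : imem s' 10 0 = N by rewrite (proj1 sm) //= /upd /= N3.
have K' : rmem s' 2 = key by apply: boolp.funext => j; rewrite (proj2 sm) //= K3.
have leaf' i : (i < N)%N -> imem s' 11 (N + i)%N = 0%N \/ imem s' 11 (N + i)%N = i.+1.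
  by move=> /leaf ->; case: ifP; auto.
(* Pigeonhole: after p < N pops some contestant is left, so the root is not blank. *)
have [i iN iP] : exists2 i, (i < N)%N & i \notin mkseq (imem s' 12) p.
  case: (boolP (has (fun i => i \notin mkseq (imem s' 12) p) (iota 0 N))).
    by move=> /hasP[i]; rewrite mem_iota add0n /= => iN h; exists i.
  rewrite -all_predC => /allP h.
  have sub : {subset iota 0 N <= mkseq (imem s' 12) p}.
    by move=> j /h /=; rewrite negbK.
  by have := uniq_leq_size (iota_uniq _ _) sub; rewrite size_iota size_mkseq; lia.
have b1 := tree_beats ok.
have root0 : imem s' 11 1 <> 0%N.
  move=> e; have Ni : (0 < N + i < 2 * N)%N by lia.
  by have := b1 _ Ni; rewrite leaf // (negbTE iP) e.
have N1' : (0 < 1 < 2 * N)%N by lia.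
have [//|[w wN [wE wl]]] := tree_entry ok leaf' N1'.
have wP : w \notin mkseq (imem s' 12) p.
  by apply/negP => h; move: (leaf w wN); rewrite h wl.
have wmin j : (j < N)%N -> j \notin mkseq (imem s' 12) p -> key w <= key j.
  move=> jN jP; have Nj : (0 < N + j < 2 * N)%N by lia.
  by have := b1 _ Nj; rewrite leaf // (negbTE jP) wE.
apply: runs_cons => //=.
  by rewrite /upd /= pE N' wE !subn1 /= eqxx; lia.
rewrite /= /upd /= pE N' wE !subn1 /= eqxx.
set s5' := State _ _.
have ord5 q : (q < p)%N -> imem s5' 12 q = imem s' 12 q.
  by move=> qp; rewrite /= ifN //; lia.
have ord5p : imem s5' 12 p = w by rewrite /= eqxx.
have T5 j : imem s5' 11 j = if j == (N + w)%N then 0%N else imem s' 11 j by [].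
have seq5 q : (q <= p)%N -> mkseq (imem s5' 12) q = mkseq (imem s' 12) q.
  by move=> qp; apply: eq_mkseq_in => r rq; apply: ord5; lia.
have := @replay_runs s5' N L
  (fun i => if i \in mkseq (imem s5' 12) p.+1 then 0%N else i.+1) ((N + w) %/ 2)%N.
have K5 : rmem s5' 2 = key by [].
rewrite K5 => H; apply: (runs_weaken (H _ _ NL NW _ _ _)) => {H} //.
- by lia.
- move=> v vN ne.
  rewrite (_ : imem s5' 11 = upd (imem s') 11 (N + w)%N 0%N 11) //.
  by apply: node_ok_upd => //; try lia; apply: ok.
- move=> v vN; rewrite T5; case: ifP => // _.
  by apply: (tree_le ok leaf').
- move=> j jN; rewrite T5 eqn_add2l mkseqSr seq5 // ord5p mem_rcons inE.
  by case: eqP => //= _; apply: leaf.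
move=> s6 [leaf6 ok6] sm6 _.
have ord6 : imem s6 12 = imem s5' 12.
  by apply: boolp.funext => j; rewrite (proj1 sm6).
have ord7 : imem (set_imem s6 13 0 p.+1) 12 = imem s5' 12.
  by rewrite -ord6; apply: boolp.funext.
split; rewrite ?ord7 //.
- by rewrite mkseqSr seq5 // ord5p rcons_uniq wP.
- move=> q qp; case: (q =P p) => [->|ne]; first by rewrite ord5p.
  by rewrite ord5; [apply: bd|]; lia.
- move=> q j qp jN; rewrite seq5; last by lia.
  case: (q =P p) => [->|ne]; first by rewrite ord5p; apply: wmin.
  by rewrite ord5; [apply: le|]; lia.
Qed.

End SortRuns.

(** * Union-find *)

Section UnionFind.
Variables (n L : nat).
Implicit Types (par rnk tim cn : nat -> nat).

(* [par v = u.+1] is a link from v to u made at time [tim v]; [par v = 0]     *)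
(* marks a root.  Only links made before time t are followed, which gives     *)
(* access to all earlier partitions at once.                                  *)
Definition uf_step par tim t v : nat :=
  if (0 < par v)%N && (tim v < t)%N then (par v).-1 else v.

Definition uf_root par tim t v : nat := iter L (uf_step par tim t) v.

(** Ranks increase strictly along links and never exceed L. Hence L steps always end at a root,
    which justifies the fixed iteration count in [uf_root]. *)
Record uf_inv p par rnk tim : Prop := UfInv {
  uf_par : forall v, (v < n)%N -> (par v <= n)%N;
  uf_tim : forall v, (v < n)%N -> (0 < par v)%N -> (tim v < p)%N;
  uf_link : forall v, (v < n)%N -> (0 < par v)%N -> (rnk v < rnk (par v).-1)%N;
  uf_rnk : forall v, (v < n)%N -> (rnk v <= L)%N
}.

Section Basics.
Variables (p : nat) (par rnk tim : nat -> nat).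
Hypothesis inv : uf_inv p par rnk tim.
Local Notation step := (uf_step par tim).
Local Notation root := (uf_root par tim).

Lemma uf_step_lt t v : (v < n)%N -> (step t v < n)%N.
Proof.
by move=> vn; rewrite /uf_step; case: ifP => // /andP[h _]; have := uf_par inv vn; lia.
Qed.

Lemma uf_iter_lt i t v : (v < n)%N -> (iter i (step t) v < n)%N.
Proof. by elim: i => //= i IHi /IHi; apply: uf_step_lt. Qed.

Lemma uf_root_lt t v : (v < n)%N -> (root t v < n)%N.
Proof. exact: uf_iter_lt. Qed.

Lemma uf_step_rnk t v : (v < n)%N -> step t v <> v -> (rnk v < rnk (step t v))%N.
Proof.
by move=> vn; rewrite /uf_step; case: ifP => // /andP[h _] _; apply: (uf_link inv).
Qed.

Lemma uf_step_fixed t v : (v < n)%N ->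
  (step t v = v) <-> ~~ ((0 < par v)%N && (tim v < t)%N).
Proof.
move=> vn; rewrite /uf_step; case: ifP => // h; split=> // e.
by case/andP: h => /(uf_link inv vn) + _; rewrite e ltnn.
Qed.

Lemma uf_iter_rnk t v i : (v < n)%N ->
  step t (iter i (step t) v) = iter i (step t) v \/
  (i < rnk (step t (iter i (step t) v)))%N.
Proof.
move=> vn; elim: i => [|i IHi].
  by case: (step t v =P v) => [|/(uf_step_rnk vn)]; [left|right; rewrite /=; lia].
rewrite !iterS; case: IHi => [h|h]; first by left; rewrite !h.
set w := step t (iter i _ v) in h *.
case: (step t w =P w) => [|ne]; [by left|right].
by apply: leq_ltn_trans h _; apply: uf_step_rnk => //; apply: uf_step_lt; apply: uf_iter_lt.
Qed.

Lemma uf_step_root t v : (v < n)%N -> step t (root t v) = root t v.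
Proof.
move=> vn; case: (uf_iter_rnk t L vn) => // h.
by have := uf_rnk inv (uf_step_lt t (uf_iter_lt L t vn)); lia.
Qed.

Lemma uf_root_fixed t v : step t v = v -> root t v = v.
Proof. by move=> h; rewrite /uf_root; elim: L => //= i ->. Qed.

Lemma uf_root_step t v : (v < n)%N -> root t (step t v) = root t v.
Proof. by move=> vn; rewrite /uf_root -iterSr iterS uf_step_root. Qed.

Lemma uf_root_iter t i v : (v < n)%N -> root t (iter i (step t) v) = root t v.
Proof. by move=> vn; elim: i => //= i <-; apply/uf_root_step/uf_iter_lt. Qed.

Lemma uf_fixed_mono t t' v : (v < n)%N -> (t' <= t)%N ->
  step t v = v -> step t' v = v.
Proof. by move=> vn le /uf_step_fixed -/(_ vn) h; apply/uf_step_fixed => //; lia. Qed.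

Lemma uf_stepS v : (v < n)%N -> step p.+1 v = step p v.
Proof.
move=> vn; rewrite /uf_step; case: (ltnP 0 (par v)) => //= h.
by have lt := uf_tim inv vn h; rewrite lt ltnW.
Qed.

Lemma uf_rootS v : (v < n)%N -> root p.+1 v = root p v.
Proof.
move=> vn; rewrite /uf_root; elim: L => //= i ->.
by rewrite uf_stepS //; apply: uf_iter_lt.
Qed.

End Basics.

Section Kruskal.
Variables (eu ev : nat -> nat).

(** [kr_edge] and [kr_conn] together say that the classes at time t are the components of the first
    t edges: the ends of each such edge share a root, and a labelling respected by these edges
    agrees at a vertex and at its root. All times t <= p are covered at once. [kr_size] is the usual
    invariant of union by rank, and [kr_count] says that n - cn t roots are left. *)
Record kruskal_inv p par rnk tim cn : Prop := KruskalInv {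
  kr_uf : uf_inv p par rnk tim;
  kr_size : forall r, (r < n)%N -> par r = 0%N ->
    (2 ^ rnk r <= #|[set v : 'I_n | uf_root par tim p v == r]|)%N;
  kr_edge : forall q t, (q < t <= p)%N ->
    uf_root par tim t (eu q) = uf_root par tim t (ev q);
  kr_conn : forall t (g : nat -> bool) v, (t <= p)%N -> (v < n)%N ->
    (forall q, (q < t)%N -> g (eu q) = g (ev q)) -> g (uf_root par tim t v) = g v;
  kr_count : forall t, (t <= p)%N ->
    (cn t + #|[set v : 'I_n | uf_step par tim t v == v]|)%N = n;
  kr_cn0 : cn 0%N = 0%N;
  kr_cnS : forall t, (t < p)%N ->
    cn t.+1 = (cn t + (uf_root par tim t (eu t) != uf_root par tim t (ev t)))%N
}.


Hypotheses (eu_lt : forall q, (eu q < n)%N) (ev_lt : forall q, (ev q < n)%N).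
Hypothesis n_lt : (n < 2 ^ L.+1)%N.

Lemma leqS_or t p : (t <= p.+1)%N -> (t <= p)%N \/ t = p.+1.
Proof. by lia. Qed.

Lemma kruskal_skip p par rnk tim cn :
  kruskal_inv p par rnk tim cn ->
  uf_root par tim p (eu p) = uf_root par tim p (ev p) ->
  kruskal_inv p.+1 par rnk tim (fun i => if i == p.+1 then cn p else cn i).
Proof.
move=> [uf sz ed cc ct c0 cS] e.
have ufS : uf_inv p.+1 par rnk tim.
  by case: uf => h1 h2 h3 h4; split=> // v vn h; apply: ltnW; rewrite ltnS; apply: h2.
split=> //.
- move=> r rn r0; apply: leq_trans (sz r rn r0) _; apply/eq_leq/eq_card => v.
  by rewrite !inE (uf_rootS uf).
- move=> q t /andP[qt /leqS_or[tp|tE]]; first by apply: ed; rewrite qt.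
  rewrite tE !(uf_rootS uf) //; case: (q =P p) => [->//|ne].
  by apply: ed; rewrite leqnn andbT; lia.
- move=> t g v /leqS_or[tp|tE] vn h; first exact: cc.
  rewrite tE (uf_rootS uf) //; apply: cc => // q qp; apply: h.
  by rewrite tE; lia.
- move=> t /leqS_or[tp|->]; first by rewrite ifN ?ct //; lia.
  rewrite eqxx -[RHS](ct p) //; congr addn; apply: eq_card => v.
  by rewrite !inE (uf_stepS uf).
- move=> t tp; rewrite eqSS [if t == p.+1 then _ else _]ifN; last by lia.
  case: eqP => [->|ne]; first by rewrite e eqxx addn0.
  by apply: cS; lia.
Qed.

Section Link.
Variables (p : nat) (par rnk tim cn : nat -> nat) (a b r' : nat).
Hypothesis inv : kruskal_inv p par rnk tim cn.
Let uf := kr_uf inv.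
Let u := uf_root par tim p (eu p).
Let v := uf_root par tim p (ev p).
Hypothesis uv : u <> v.
Hypothesis ab : a = u /\ b = v \/ a = v /\ b = u.
(** Root a is hung below root b, whose rank becomes r'. These conditions cover both cases of union
    by rank: r' = rnk b when a has smaller rank, and r' = rnk b + 1 when the ranks are equal. *)
Hypotheses (rb : (rnk b <= r')%N) (ra : (rnk a < r')%N)
  (r'_le : (2 ^ r' <= 2 ^ rnk a + 2 ^ rnk b)%N).

Let par' i := if i == a then b.+1 else par i.
Let tim' i := if i == a then p else tim i.
Let rnk' i := if i == b then r' else rnk i.
Let cn' i := if i == p.+1 then (cn p).+1 else cn i.

Let a_lt : (a < n)%N.
Proof. by case: ab => -[-> _]; apply: uf_root_lt uf _ _ _. Qed.

Let b_lt : (b < n)%N.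
Proof. by case: ab => -[_ ->]; apply: uf_root_lt uf _ _ _. Qed.

Let ab_neq : a <> b.
Proof. by case: ab => -[-> ->] // /esym. Qed.

Let par0 w : (w < n)%N -> uf_step par tim p w = w -> par w = 0%N.
Proof.
move=> wn /(uf_step_fixed uf _ wn); case: (posnP (par w)) => // h.
by rewrite (uf_tim uf wn h).
Qed.

Let a_fix : uf_step par tim p a = a.
Proof. by case: ab => -[-> _]; apply: uf_step_root uf _ _ _. Qed.

Let b_fix : uf_step par tim p b = b.
Proof. by case: ab => -[_ ->]; apply: uf_step_root uf _ _ _. Qed.

(** The new link is stamped p, hence invisible at every time t <= p, and the vertex that receives it
    was a root until now. This is why old partitions survive. *)
Let step_old t : (t <= p)%N -> uf_step par' tim' t = uf_step par tim t.
Proof.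
move=> tp; apply: boolp.funext => w; rewrite /uf_step /par' /tim'.
by case: eqP => // ->; rewrite [(p < t)%N]ltnNge tp /= par0.
Qed.

Let root_old t : (t <= p)%N -> uf_root par' tim' t = uf_root par tim t.
Proof. by move=> tp; apply: boolp.funext => w; rewrite /uf_root step_old. Qed.

Let step_new w : (w < n)%N ->
  uf_step par' tim' p.+1 w = if w == a then b else uf_step par tim p w.
Proof.
move=> wn; rewrite -(uf_stepS uf wn) /uf_step /par' /tim'.
by case: eqP => //= _; rewrite ltnS leqnn.
Qed.

Let card_merge :
  #|[set w : 'I_n | (if uf_root par tim p w == a then b else uf_root par tim p w) == b]|
  = (#|[set w : 'I_n | uf_root par tim p w == a]| +
     #|[set w : 'I_n | uf_root par tim p w == b]|)%N.
Proof.
set A := [set w : 'I_n | _ == a].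
set B := [set w : 'I_n | uf_root _ _ _ _ == b].
have -> : (#|A| + #|B| = #|A :|: B|)%N.
  rewrite -cardsUI (_ : A :&: B = set0) ?cards0 ?addn0 //.
  by apply/setP => w; rewrite !inE; case: eqP => //= ->; apply/eqP.
by apply: eq_card => w; rewrite !inE; case: (uf_root par tim p w =P a); rewrite ?eqxx.
Qed.

Lemma uf_inv_link : uf_inv p.+1 par' rnk' tim'.
Proof.
split=> w wn; rewrite /par' /tim' /rnk'.
- by case: ifP => // _; apply: uf_par uf _ _.
- by case: eqP => // _ h; apply: ltnW; rewrite ltnS; apply: uf_tim uf _ _ _.
- case: eqP => [->|ne] h /=; first by rewrite eqxx ifN //; apply/eqP.
  have lt := uf_link uf wn h; case: eqP => [wb|_].
    by move: h; rewrite wb par0.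
  by case: eqP => // e; apply: leq_trans rb; rewrite -e.
- case: eqP => [_|_]; last exact: uf_rnk uf _ _.
  (* The merged class contains at least 2^r' of the n < 2^(L+1) vertices, so r' <= L. *)
  rewrite -ltnS -(@ltn_exp2l 2) //; apply: leq_ltn_trans n_lt.
  apply: leq_trans r'_le _; rewrite -[X in (_ <= X)%N]card_ord.
  apply: leq_trans (_ : #|[set w : 'I_n |
    (if uf_root par tim p w == a then b else uf_root par tim p w) == b]| <= _)%N.
    by rewrite card_merge; apply: leq_add; apply: (kr_size inv) => //; apply: par0.
  exact: max_card.
Qed.

Let root_new w : (w < n)%N ->
  uf_root par' tim' p.+1 w = if uf_root par tim p w == a then b else uf_root par tim p w.
Proof.
(* The claimed new root g is unchanged by a new step, hence along the whole new path. The path ends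
   at a fixed point other than a, where g is the identity. *)
pose g w := if uf_root par tim p w == a then b else uf_root par tim p w.
have ufS := uf_inv_link.
have gstep x : (x < n)%N -> g (uf_step par' tim' p.+1 x) = g x.
  move=> xn; rewrite step_new // /g; case: (x =P a) => [->|_].
    rewrite (uf_root_fixed a_fix) (uf_root_fixed b_fix) eqxx ifN //.
    by apply/eqP => /esym.
  by rewrite (uf_root_step uf).
have giter i x : (x < n)%N -> g (iter i (uf_step par' tim' p.+1) x) = g x.
  by move=> xn; elim: i => //= i <-; apply: gstep; apply: (uf_iter_lt ufS).
move=> wn; rewrite -/(g w) -(giter L) // -/(uf_root _ _ _ _).
have rn := uf_root_lt ufS p.+1 wn; have := uf_step_root ufS p.+1 wn.
set r := uf_root par' tim' p.+1 w in rn *; rewrite step_new //.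
case: eqP => [-> /esym//|ne fx]; rewrite /g (uf_root_fixed fx) ifN //.
by apply/eqP.
Qed.

Lemma kruskal_link : kruskal_inv p.+1 par' rnk' tim' cn'.
Proof.
have [_ sz ed cc ct c0 cS] := inv.
split=> //; first exact: uf_inv_link.
- move=> r rn; rewrite {1}/par'; case: eqP => // ra' r0.
  rewrite /rnk'; case: eqP => [->|rb'].
    apply: leq_trans r'_le _; apply: leq_trans (leq_add (sz a _ _) (sz b _ _)) _ => //;
      try exact: par0.
    by rewrite -card_merge; apply/eq_leq/eq_card => w; rewrite !inE root_new.
  apply: leq_trans (sz r rn r0) _; apply/subset_leq_card/subsetP => w.
  by rewrite !inE root_new // => /eqP ->; rewrite (introF eqP ra').
- move=> q t /andP[qt /leqS_or[tp|tE]]; first by rewrite root_old //; apply: ed; rewrite qt.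
  rewrite tE !root_new //; case: (q =P p) => [->|ne]; last first.
    by rewrite (ed q p) // leqnn andbT; lia.
  rewrite -/u -/v; case: ab => -[-> ->]; rewrite !eqxx; case: eqP => //.
- move=> t g w /leqS_or[tp|tE] wn h; first by rewrite root_old //; exact: cc.
  have h' q : (q < p)%N -> g (eu q) = g (ev q) by move=> qp; apply: h; rewrite tE; lia.
  have uvE : g u = g v.
    by rewrite /u /v !(cc p) //; apply: h; rewrite tE.
  rewrite tE root_new //; case: eqP => [e|_]; last exact: cc.
  rewrite -(cc p g w) // e.
  by case: ab => -[-> ->].
- move=> t /leqS_or[tp|->]; rewrite /cn'; first by rewrite ifN ?step_old ?ct //; lia.
  rewrite eqxx -[RHS](ct p) // addSnnS; congr addn.
  rewrite [RHS](cardsD1 (Ordinal a_lt)) !inE a_fix eqxx add1n; congr _.+1.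
  apply: eq_card => w; rewrite !inE step_new // -val_eqE /=.
  by case: (nat_of_ord w =P a) => [->|_] //=; apply/eqP => /esym.
- rewrite /cn' => t tp; rewrite eqSS [if t == p.+1 then _ else _]ifN; last by lia.
  rewrite root_old //.
  case: eqP => [->|ne]; last by apply: cS; lia.
  by rewrite -/u -/v; case: eqP => // _; rewrite addn1.
Qed.

End Link.
End Kruskal.
End UnionFind.

(** * Kruskal's algorithm *)

(* Arrays 20, 21, 22 are the parents, ranks and link times of the union-find  *)
(* forest; [find_root] replaces the vertex in scalar 30 by its root with      *)
(* respect to the links made before the time in scalar 31.                    *)
Definition find_root : cmd :=
  While (BAnd (BILt (IConst 0) (IRead 20 (ivar 30)))
              (BILt (IRead 22 (ivar 30)) (ivar 31)))
    (iset 30 (ISub (IRead 20 (ivar 30)) (IConst 1))).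

(* Kruskal's algorithm on the edge list in array 28.  After t edges, entry t  *)
(* of array 23 is the number of links made, and entry t of real array 3 the   *)
(* total capacity of the remaining edges.                                     *)
Definition load_first : cmd :=
  Seq (iset 25 (IRead 28 (ivar 24)))
  (Seq (iset 30 (IRead 1 (ivar 25))) (iset 31 (ivar 24))).

Definition load_second : cmd :=
  Seq (iset 26 (ivar 30)) (iset 30 (IRead 2 (ivar 25))).

Definition link : cmd :=
  let p1 := IAdd (ivar 24) (IConst 1) in
  Seq (iset 27 (ivar 30))
  (Seq (RWrite 3 p1 (RSub (RRead 3 (ivar 24)) (RRead 0 (ivar 25))))
  (If (BIEq (ivar 26) (ivar 27)) (IWrite 23 p1 (IRead 23 (ivar 24)))
  (Seq (IWrite 23 p1 (IAdd (IRead 23 (ivar 24)) (IConst 1)))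
  (If (BILt (IRead 21 (ivar 26)) (IRead 21 (ivar 27)))
     (Seq (IWrite 20 (ivar 26) (IAdd (ivar 27) (IConst 1)))
          (IWrite 22 (ivar 26) (ivar 24)))
     (Seq (IWrite 20 (ivar 27) (IAdd (ivar 26) (IConst 1)))
     (Seq (IWrite 22 (ivar 27) (ivar 24))
     (If (BIEq (IRead 21 (ivar 26)) (IRead 21 (ivar 27)))
        (IWrite 21 (ivar 26) (IAdd (IRead 21 (ivar 26)) (IConst 1))) Skip))))))).

Definition kruskal_body : cmd :=
  Seq load_first (Seq find_root (Seq load_second (Seq find_root link))).

Definition kruskal : cmd :=
  Seq (iset 24 (IConst 0)) (for_loop 24 0 1 kruskal_body).

(** * Time and correctness of Kruskal's algorithm *)

Section KruskalRuns.
Variables (R : realType) (W n m L : nat).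
Local Notation state := (state R).
Hypotheses (nW : (n + 10 < W)%N) (mW : (m + 10 < W)%N).

Lemma find_root_runs (s : state) p t v rnk :
  uf_inv n L p (imem s 20) rnk (imem s 22) -> (p <= m)%N -> (t <= m)%N ->
  (forall u, (imem s 22 u <= m)%N) ->
  imem s 30 0 = v -> (v < n)%N -> imem s 31 0 = t ->
  runs W s find_root (20 * L.+1)
    (fun s' => imem s' 30 0 = uf_root L (imem s 20) (imem s 22) t v).
Proof.
move=> uf pm tm timW vE vn tE.
pose st := uf_step (imem s 20) (imem s 22) t.
(* After i steps the rank of the current vertex is at least i, so the search stops within L
   steps. *)
pose I i (s' : state) := imem s' 30 0 = iter i st v /\
   (0 < i -> (i <= rnk (iter i st v)))%N.
apply: (runs_weaken (@runs_while _ _ I _ _ _ 7 L _ _)) => //=; last 2 first.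
- by lia.
- move=> s' [i [cE _]] + sm.
  rewrite cE !(proj1 sm 20%N) // !(proj1 sm 22%N) // !(proj1 sm 31%N) // tE.
  move=> nb; have fx : st (iter i st v) = iter i st v.
    by rewrite /st /uf_step; case: ifP nb.
  by rewrite -(uf_root_iter uf t i vn) uf_root_fixed.
move=> i s' [cE ir] sm.
rewrite cE !(proj1 sm 20%N) // !(proj1 sm 22%N) // !(proj1 sm 31%N) // tE.
have cn := uf_iter_lt uf i t vn; rewrite -/st in cn.
have pn := uf_par uf cn; have tW := timW (iter i st v).
split; first by lia.
move=> b; have stE : st (iter i st v) = (imem s 20 (iter i st v)).-1.
  by rewrite {1}/st /uf_step b.
have lt : (rnk (iter i st v) < rnk (st (iter i st v)))%N.
  by rewrite stE; apply: (uf_link uf); lia.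
have iLt : (i.+1 <= rnk (st (iter i st v)))%N by case: (i) ir lt => [|j] h; lia.
split.
  by have := uf_rnk uf (uf_step_lt uf t cn); rewrite -/st; lia.
apply: runs_cmd => //=; first by rewrite cE (proj1 sm 20%N) //; lia.
by split=> //=; rewrite /upd /= cE (proj1 sm 20%N) // subn1 -stE.
Qed.

Lemma kruskal_init eu ev (par rnk tim cn : nat -> nat) :
  par =1 (fun=> 0%N) -> rnk =1 (fun=> 0%N) -> cn 0%N = 0%N ->
  kruskal_inv n L eu ev 0 par rnk tim cn.
Proof.
move=> p0 r0 c0.
have st t v : uf_step par tim t v = v by rewrite /uf_step p0.
have rt t v : uf_root L par tim t v = v by rewrite /uf_root; elim: (L) => //= i ->.
split=> //.
- by split=> v vn; rewrite ?p0 ?r0.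
- move=> r rn _; rewrite r0 expn0 card_gt0; apply/set0Pn; exists (Ordinal rn).
  by rewrite inE rt.
- by move=> q t; lia.
- by move=> t g v _ _ _; rewrite rt.
- move=> t; rewrite leqn0 => /eqP ->; rewrite c0 -[RHS]card_ord.
  by apply: eq_card => v; rewrite inE st eqxx.
Qed.

Hypotheses (Ln : (L <= n)%N) (n_lt : (n < 2 ^ L.+1)%N).

Lemma link_runs (s : state) p e u v :
  imem s 24 0 = p -> imem s 25 0 = e -> imem s 26 0 = u -> imem s 30 0 = v ->
  (p < m)%N -> (e < m)%N -> (u < n)%N -> (v < n)%N ->
  (imem s 21 u <= L)%N -> (imem s 21 v <= L)%N -> (imem s 23 p <= n)%N ->
  let lt := (imem s 21 u < imem s 21 v)%N in
  let a := if lt then u else v in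
  let b := if lt then v else u in
  let r := if imem s 21 u == imem s 21 v then (imem s 21 u).+1 else imem s 21 b in
  runs W s link 100 (fun s' => [/\
    rmem s' 3 = (fun t => if t == p.+1 then rmem s 3 p - rmem s 0 e else rmem s 3 t),
    imem s' 23 = (fun t => if t == p.+1 then (imem s 23 p + (u != v))%N else imem s 23 t) &
    if u == v then
      [/\ imem s' 20 = imem s 20, imem s' 21 = imem s 21 & imem s' 22 = imem s 22]
    else
      [/\ imem s' 20 = (fun i => if i == a then b.+1 else imem s 20 i),
          imem s' 21 = (fun i => if i == b then r else imem s 21 i) &
          imem s' 22 = (fun i => if i == a then p else imem s 22 i)]]).
Proof.
move=> s24 s25 s26 s30 pm em un vn ru rv cn lt a b r.
apply: (@runs_time _ _ (10 + (15 + 75))) => //.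
apply: runs_cons => //=; first by rewrite s30; lia.
rewrite /upd /= s30; apply: runs_cons => //=; first by rewrite s24 s25; lia.
rewrite /upd /= s24 s25 addn1; apply: (@runs_branch _ _ 60) => //=;
  rewrite ?s26; first by lia.
  move=> /eqP uv; apply: runs_cmd => //=; first by rewrite s24; lia.
  by rewrite /upd /= s24 addn1 uv eqxx addn0; split=> //; apply: boolp.funext => i;
    case: eqP.
move=> /eqP uv; apply: (@runs_time _ _ (12 + 48)) => //.
apply: runs_cons => //=; first by rewrite s24; lia.
rewrite /upd /= s24 !addn1 (introF eqP uv) /=.
apply: (@runs_branch _ _ 36) => //=; rewrite ?s26; first by lia.
  move=> h; apply: runs_cmd => //=; rewrite /upd /= ?s26 ?s24; first by lia.
  rewrite /r /b /a /lt h !addn1; split=> //; split=> //; apply: boolp.funext => i.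
  by case: (i =P v) => [->|//]; rewrite ifN //; lia.
move=> h; apply: (@runs_time _ _ (10 + (8 + 18))) => //.
apply: runs_cons => //=; rewrite /upd /= ?s26 ?s24; first by lia.
apply: runs_cons => //=; rewrite /upd /= ?s26 ?s24; first by lia.
apply: (@runs_branch _ _ 10) => //=; rewrite ?s26; first by lia.
  move=> e'; apply: runs_cmd => //=; rewrite /upd /= ?s26; first by lia.
  by rewrite /r /b /a /lt (negbTE h) e' !addn1; split.
move=> ne; apply: runs_cmd => //=.
rewrite /r /b /a /lt (negbTE h) (negbTE ne) !addn1; split=> //; split=> //.
by apply: boolp.funext => i; case: eqP => [->|].
Qed.

Lemma kruskal_runs (s : state) :
  imem s 0 1 = m -> (0 < n)%N ->
  (forall i, (imem s 1 i < n)%N) -> (forall i, (imem s 2 i < n)%N) ->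
  (forall p, (p < m)%N -> (imem s 28 p < m)%N) ->
  imem s 20 =1 (fun=> 0%N) -> imem s 21 =1 (fun=> 0%N) ->
  imem s 22 =1 (fun=> 0%N) -> imem s 23 0 = 0%N ->
  runs W s kruskal (300 * (m * L.+1).+1)
   (fun s' => kruskal_inv n L (fun p => imem s 1 (imem s 28 p))
       (fun p => imem s 2 (imem s 28 p)) m
       (imem s' 20) (imem s' 21) (imem s' 22) (imem s' 23) /\
     (forall u, (imem s' 22 u <= m)%N) /\
     (forall t, (t <= m)%N ->
        rmem s' 3 t = rmem s 3 0 - \sum_(q < t) rmem s 0 (imem s 28 q))).
Proof.
move=> mE n0 eun evn om par0 rnk0 tim0 cn0.
set eu := fun p => imem s 1 _; set ev := fun p => imem s 2 _.
apply: (@runs_time _ _ (4 + (m * (200 * L.+1 + 15) + 6))%N); first by nia.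
apply: runs_cons => //=; first by lia.
pose I p (s' : state) := [/\ kruskal_inv n L eu ev p
       (imem s' 20) (imem s' 21) (imem s' 22) (imem s' 23),
     (forall u, (imem s' 22 u <= m)%N) &
     (forall t, (t <= p)%N ->
        rmem s' 3 t = rmem s 3 0 - \sum_(q < t) rmem s 0 (imem s 28 q))].
have := @runs_for _ W I _ 24 0 1 kruskal_body (200 * L.+1) 0 m _ _ _ _ _ _ _ _ _ _.
move=> H; apply: (runs_weaken (H _ _ _ _ _ _ _ _ _ _ _)) => {H} //=; try lia; last first.
- by move=> s' [[h1 h2 h3] _] _.
- move=> p s' pm pE [kr timW wE] sm.
  have uf := kr_uf kr.
  have om' := om p pm.
  have eup : (eu p < n)%N by apply: eun.
  have evp : (ev p < n)%N by apply: evn.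
  pose u := uf_root L (imem s' 20) (imem s' 22) p (eu p).
  pose v := uf_root L (imem s' 20) (imem s' 22) p (ev p).
  have un : (u < n)%N by apply: (uf_root_lt uf).
  have vn : (v < n)%N by apply: (uf_root_lt uf).
  have e28 : imem s' 28 p = imem s 28 p by rewrite (proj1 sm).
  apply: (@runs_time _ _ (30 + (20 * L.+1 + (20 + (20 * L.+1 + 100))))%N); first by nia.
  apply: runs_cons => //=.
    rewrite /upd /= pE (proj1 sm) // (proj1 sm) //= /upd /=.
    by have := eun (imem s 28 p); lia.
  rewrite /upd /= pE (proj1 sm) // (proj1 sm) //= /upd /=; apply: runs_seq.
  apply: (runs_weaken (@find_root_runs _ p p (eu p) (imem s' 21) _ _ _ _ _ _ _)) => //=; try lia.
  move=> s1 r1 sm1 _; have {}r1 : imem s1 30 0 = u by [].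
  apply: runs_cons => //=.
    rewrite /upd /= r1 (proj1 sm1) //= (proj1 sm1) //= (proj1 sm) //= /upd /=.
    by rewrite -/(ev p); lia.
  rewrite /upd /= r1 (proj1 sm1) //= (proj1 sm1) //= (proj1 sm) //= /upd /=.
  set s2 := State _ _; apply: runs_seq.
  have a20 : imem s2 20 = imem s' 20.
    by apply: boolp.funext => j; rewrite /= (proj1 sm1).
  have a22 : imem s2 22 = imem s' 22.
    by apply: boolp.funext => j; rewrite /= (proj1 sm1).
  apply: (runs_weaken (@find_root_runs s2 p p (ev p) (imem s' 21) _ _ _ _ _ _ _));
    rewrite ?a20 ?a22 //=; try lia.
    by rewrite (proj1 sm1).
  move=> s3 r3 sm3 _.
  have fr a i : a \notin [:: 24; 25; 26; 30; 31]%N -> imem s3 a i = imem s' a i.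
    rewrite !inE !negb_or => /and5P[h1 h2 h3 h4 h5].
    rewrite (proj1 sm3) /=; last by rewrite inE.
    rewrite (negbTE h4) (negbTE h3) /= (proj1 sm1) /=; last by rewrite inE.
    by rewrite (negbTE h5) (negbTE h4) (negbTE h2).
  have s24 : imem s3 24 0 = p by rewrite (proj1 sm3) //= (proj1 sm1).
  have s25 : imem s3 25 0 = imem s 28 p.
    by rewrite (proj1 sm3) //= (proj1 sm1) //= (proj1 sm).
  have s26 : imem s3 26 0 = u.
    by rewrite (proj1 sm3).
  have rfr a i : rmem s3 a i = rmem s' a i.
    by rewrite (proj2 sm3) //= (proj2 sm1).
  have e0 i : rmem s' 0 i = rmem s 0 i by rewrite (proj2 sm).
  have {}r3 : imem s3 30 0 = v by [].
  have ru := uf_rnk uf un; have rv := uf_rnk uf vn.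
  have cnn : (imem s' 23 p <= n)%N by have := kr_count kr (leqnn p); lia.
  have fr' a : a \notin [:: 24; 25; 26; 30; 31]%N -> imem s3 a = imem s' a.
    by move=> ha; apply: boolp.funext => i; apply: fr.
  have rfr' a : rmem s3 a = rmem s' a by apply: boolp.funext => i; apply: rfr.
  have := link_runs s24 s25 s26 r3 pm om' un vn.
  rewrite !fr' // !rfr' => H.
  apply: (runs_weaken (H ru rv cnn)) => // F [r3F c23] {H}.
  set a := if _ then u else v; set b := if _ then v else u; set r := if _ then _.+1 else _.
  move=> cF _ _.
  have wF t : (t <= p.+1)%N ->
      rmem F 3 t = rmem s 3 0 - \sum_(q < t) rmem s 0 (imem s 28 q).
    rewrite r3F; case: eqP => [->|ne] tp; last by apply: wE; lia.
    by rewrite wE // big_ord_recr /= opprD addrA e0.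
  case: (u =P v) cF c23 => uv /= [c20 c21 c22] c23.
    split=> //=; last by move=> w; rewrite /upd /= c22.
    rewrite /upd /= c20 c21 c22 c23 addn0; by apply: kruskal_skip => // q; [apply: eun|apply: evn].
  rewrite addn1 in c23; split=> //=; last first.
    by move=> w; rewrite /upd /= c22; case: eqP => // _; lia.
  rewrite /upd /= c20 c21 c22 c23; apply: kruskal_link => //.
  + by move=> q; apply: eun.
  + by move=> q; apply: evn.
  + by rewrite /a /b -/u -/v; case: ifP; auto.
  + by rewrite /r; case: eqP => // e; rewrite /b; case: ifP => _; lia.
  + by rewrite /r /a /b; case: (ltngtP (imem s' 21 u) (imem s' 21 v)) => e //; rewrite e.
  + rewrite /r /a /b; case: (ltngtP (imem s' 21 u) (imem s' 21 v)) => e; rewrite ?leq_addl //.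
    by rewrite e expnS mul2n addnn.
- split=> /=.
  + by apply: kruskal_init => // i; rewrite /upd /= ?par0 ?rnk0.
  + by move=> u; rewrite /upd /= tim0.
  + by move=> t; rewrite leqn0 => /eqP ->; rewrite big_ord0 subr0.
Qed.

End KruskalRuns.

(** * Components and forests *)

Section GraphFacts.
Variables (n m : nat) (ends : 'I_m -> 'I_n * 'I_n).
Implicit Types (A F : {set 'I_m}) (T : eqType).

Lemma adj_sym A : symmetric (adj ends A).
Proof. by move=> u v; apply: eq_existsb => e; rewrite orbC. Qed.

Lemma label_adj T (f : 'I_n -> T) A u v :
  (forall e, e \in A -> f (ends e).1 = f (ends e).2) -> adj ends A u v -> f u = f v.
Proof.
move=> h /existsP[e /andP[eA /orP[] /eqP E]]; have := h e eA; rewrite E //=.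
Qed.

Lemma label_path T (f : 'I_n -> T) A u p :
  (forall e, e \in A -> f (ends e).1 = f (ends e).2) ->
  path (adj ends A) u p -> f u = f (last u p).
Proof.
move=> h; elim: p u => //= v p IHp u /andP[uv /IHp <-].
exact: label_adj uv.
Qed.

(** Labels that agree along edges are constant on components, so vertices with different labels lie
    in different components. Cuts are certified this way. *)
Lemma num_components_ge T (f : 'I_n -> T) A (S : {set 'I_n}) :
  (forall e, e \in A -> f (ends e).1 = f (ends e).2) -> {in S &, injective f} ->
  (#|S| <= num_components ends A)%N.
Proof.
move=> h fS; have cs : connect_sym (adj ends A).
  by apply: sym_connect_sym; apply: adj_sym.
have rinj : {in S &, injective (fingraph.root (adj ends A))}.
  move=> u v uS vS e; apply: fS => //.
  have /connectP[p pth ->] : connect (adj ends A) u v by rewrite -(root_connect cs) e.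
  exact: label_path pth.
rewrite -(card_in_imset rinj); apply: subset_leq_card; apply/subsetP => w.
by move=> /imsetP[u _ ->]; rewrite !inE /= andbT; apply: roots_root.
Qed.

(* A cycle through the new edge e returns from one end of e to the other      *)
(* along old edges, on which the labels do not change.                        *)
Lemma forest_add_edge T (f : 'I_n -> T) F e :
  is_forest ends F ->
  (forall e', e' \in F -> f (ends e').1 = f (ends e').2) ->
  f (ends e).1 <> f (ends e).2 -> is_forest ends (e |: F).
Proof.
move=> fF h ne p /andP[cyc up].
case: (leqP (size p) 2) => // sz.
have adjU u v : adj ends (e |: F) u v -> ~~ adj ends F u v ->
    ends e = (u, v) \/ ends e = (v, u).
  move=> /existsP[e' /andP[]]; rewrite in_setU1 => /orP[/eqP ->|e'F] uv.
    by move=> _; case/orP: uv => /eqP; auto.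
  by case/negP; apply/existsP; exists e'; rewrite e'F.
case: (boolP (cycle (adj ends F) p)) => cF.
  by have := fF p; rewrite /ucycle cF up => /(_ isT); lia.
have [u up' nuv] : exists2 u, u \in p & ~~ adj ends F u (next p u).
  apply/hasP; apply: contraNT cF; rewrite -all_predC => /allP hF.
  by apply: cycle_from_next => // x /hF /=; rewrite negbK.
have [i p' rE] := rot_to up'.
move: nuv (up) cyc sz; rewrite -(next_rot i up) -(rot_uniq i) -(rot_cycle i) -(size_rot i) rE.
case: p' {rE} => // v q; rewrite /next /= eqxx => nuv uq /andP[uv pv] sz.
have uvE := adjU _ _ uv nuv.
have {}uq : u != v /\ u \notin v :: q /\ v \notin q.
  move: uq => /= /and3P[h1 h2 _]; split=> //.
  by move: h1; rewrite inE negb_or => /andP[].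
have no_u w s : u \notin w :: s -> path (adj ends (e |: F)) w s -> path (adj ends F) w s.
  elim: s w => //= w' s IHs w; rewrite inE negb_or => /andP[uw us] /andP[ww pw].
  rewrite IHs // andbT; apply: contraTT us => nF.
  move: uw; rewrite inE; case: (adjU _ _ ww nF) => E; case: uvE; rewrite E => -[] -> ->;
    by rewrite ?eqxx ?orbT.
have pF : path (adj ends F) v (rcons q u).
  move: pv; rewrite !rcons_path => /andP[pq lu].
  rewrite (no_u _ _ _ pq) ?andTb; last by case: uq => _ [].
  case: (boolP (adj ends F (last v q) u)) => // nF.
  have lq : last v q \in q by case: (q) sz => //= a q' _; apply: mem_last.
  case: uq => uv' [_ vq]; move: vq lq.
  case: (adjU _ _ lu nF) => E; case: uvE; rewrite E => -[].
  + by move=> -> E2; rewrite E2 eqxx in uv'.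
  + by move=> -> /negPf ->.
  + by move=> -> /negPf ->.
  + by move=> E2 E3; rewrite E2 eqxx in uv'.
have fuv : f v = f u by have := label_path h pF; rewrite last_rcons.
by case: uvE => E; case: ne; rewrite E /= fuv.
Qed.

End GraphFacts.

(** * The Lagrangian bound *)

Section Lagrangian.
Variable R : realType.

Lemma exists_min_nat (phi : nat -> R) m :
  exists2 t, (t <= m)%N & forall q, (q <= m)%N -> phi t <= phi q.
Proof.
elim: m => [|m [t tm h]]; first by exists 0%N => // q; rewrite leqn0 => /eqP ->.
case: (leP (phi t) (phi m.+1)) => le.
  exists t; first exact: leqW.
  by move=> q; rewrite leq_eqVlt => /orP[/eqP ->//|]; apply: h.
exists m.+1 => // q; rewrite leq_eqVlt => /orP[/eqP ->//|qm].
exact: le_trans (ltW le) (h q qm).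
Qed.

(* The right-hand side is the average of phi with respect to the increments   *)
(* of z, extended by z m = 1.                                                 *)
Lemma abel_min (phi z : nat -> R) m :
  (forall p, (p < m)%N -> 0 <= z p <= 1) ->
  (forall p q, (p <= q < m)%N -> z p <= z q) ->
  exists2 t, (t <= m)%N & phi t <= phi m - \sum_(p < m) z p * (phi p.+1 - phi p).
Proof.
move=> z01 zmono; have [t0 t0m tmin] := exists_min_nat phi m; exists t0 => //.
set M := phi t0 in tmin *.
(* The bound zeta on the earlier weights is left free for the induction on t; taking t = m and zeta
   = 1 finishes. *)
have claim t zeta : (t <= m)%N -> 0 <= zeta <= 1 ->
    (forall p, (p < t)%N -> z p <= zeta) ->
    \sum_(p < t) z p * (phi p.+1 - phi p) <= zeta * (phi t - M).
  elim: t zeta => [|t IHt] zeta tm /andP[z0 z1] zb.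
    by rewrite big_ord0 mulr_ge0 // subr_ge0 tmin.
  rewrite big_ord_recr /=; have zt := z01 t tm.
  have zt_max p : (p < t)%N -> z p <= z t by move=> pt; apply: zmono; lia.
  have IH := IHt (z t) (ltnW tm) zt zt_max.
  have ztz := zb t (ltnSn t); have := tmin _ tm => Mt.
  apply: (@le_trans _ _ (z t * (phi t.+1 - M))).
    by move: IH; set S := \sum_(_ < _) _; lra.
  by apply: ler_wpM2r => //; rewrite subr_ge0.
have z1 p : (p < m)%N -> z p <= 1 by move=> /z01/andP[].
have := claim m 1 (leqnn m) _ z1; rewrite ler01 lexx mul1r => /(_ isT).
by set S := \sum_(_ < _) _; lra.
Qed.

(** Apply [abel_min] with weights z = min(y, 1). The average becomes the sum of C z plus s times the
    sum of 1 - z over the links; the first is at most the sum of C y, and the second runs over links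
    with y < 1 and is at most B. *)
Lemma lagrangian_bound (C y : nat -> R) (lk : nat -> bool) m (B s : R) :
  (forall p, (p < m)%N -> 0 <= C p) -> (forall p, (p < m)%N -> 0 <= y p) ->
  (forall p q, (p <= q < m)%N -> y p <= y q) ->
  \sum_(p < m | lk p && (y p < 1)) (1 - y p) <= B -> 0 <= s ->
  exists2 t, (t <= m)%N &
    \sum_(q < m) C q - \sum_(q < t) C q + s * (\sum_(q < t) lk q)%N%:R
    <= \sum_(q < m) C q * y q + s * B.
Proof.
move=> C0 y0 ymono hB s0.
pose z p := Order.min (y p) 1.
pose phi t := \sum_(q < m) C q - \sum_(q < t) C q + s * (\sum_(q < t) lk q)%N%:R.
have [p pm|p q pq|t tm h] := @abel_min phi z m.
- by rewrite /z ge_min lexx orbT andbT le_min y0 // ler01.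
- by rewrite /z le_min !ge_min ymono // lexx orbT.
exists t => //; apply: le_trans h _.
have -> : phi m = s * \sum_(q < m) (lk q)%:R.
  by rewrite /phi subrr add0r natr_sum.
have dphi p : phi p.+1 - phi p = - C p + s * (lk p)%:R.
  by rewrite /phi !big_ord_recr /= natrD; lra.
under [X in _ - X]eq_bigr => p _ do rewrite dphi.
rewrite mulr_sumr -sumrB.
rewrite (_ : \sum_(i < m) _ =
  \sum_(q < m) C q * z q + s * \sum_(q < m | lk q && (y q < 1)) (1 - y q)).
  apply: lerD; last exact: ler_wpM2l.
  apply: ler_sum => q _; apply: ler_wpM2l; first exact: C0.
  by rewrite /z ge_min lexx.
rewrite mulr_sumr [X in _ = _ + X]big_mkcond -big_split /=; apply: eq_bigr => q _.
rewrite /z; case: (lk q) => /=; last by rewrite mulr0; lra.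
by case: ltP => h; lra.
Qed.

(** * A chord passing below the point (k, V) *)

Section Chord.
Variables (n k m : nat) (w : nat -> R) (cn : nat -> nat) (V : R).
Hypothesis kn : (k <= n)%N.
Hypothesis lag : forall s : R, 0 <= s -> exists2 t, (t <= m)%N &
  w t + s * (cn t)%:R <= V + s * (n%:R - k%:R).
Hypothesis bad : forall t, (t <= m)%N -> (k + cn t <= n)%N -> V < w t.

Definition slope_fine t : R := (w t - V) / (n - (k + cn t))%N%:R.
Definition slope_coarse t : R := (V - w t) / (k + cn t - n)%N%:R.

Lemma coarse_exists :
  exists t, [/\ (t <= m)%N, (n < k + cn t)%N & 0 <= slope_coarse t].
Proof.
have [t tm] := lag (lexx 0); rewrite !mul0r !addr0 => wV; exists t.
have lt : (n < k + cn t)%N.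
  by rewrite ltnNge; apply/negP => /(bad tm); rewrite ltNge wV.
by split=> //; apply: divr_ge0; rewrite ?subr_ge0.
Qed.

(** The prefix that [lag] yields for s cannot be coarse, since its coarse slope would be at least s.
    It cannot have exactly k components either, since then [w t <= V] would contradict [bad]. So it
    is fine, and the same inequality bounds its slope by s. *)
Lemma fine_exists b (s : R) :
  (forall t, (t <= m)%N -> (n < k + cn t)%N -> slope_coarse t <= slope_coarse b) ->
  slope_coarse b < s ->
  exists t, [/\ (t <= m)%N, (k + cn t < n)%N & slope_fine t <= s].
Proof.
move=> bmax bs; have [t0 [t0m t0n t0s]] := coarse_exists.
have s0 : 0 <= s by apply: ltW; apply: le_lt_trans bs; apply: le_trans (bmax t0 _ _).
have [t tm h] := lag s0; exists t.
case: (ltngtP (k + cn t)%N n) => e.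
- split=> //; rewrite /slope_fine ler_pdivrMr ?ltr0n ?subn_gt0 //.
  by rewrite natrB ?natrD; [lra|lia].
- have := le_lt_trans (bmax t tm e) bs.
  rewrite /slope_coarse ltr_pdivrMr ?ltr0n ?subn_gt0 //.
  by rewrite natrB ?natrD; [lra|lia].
- have := bad tm; rewrite e leqnn => /(_ isT) Vw.
  have : (k%:R : R) + (cn t)%:R = n%:R by rewrite -natrD e.
  by move=> E; have : s * (cn t)%:R = s * (n%:R - k%:R); [congr (_ * _); lra|lra].
Qed.

(** Otherwise [fine_exists], used with the midpoint of the two slopes, would give a fine slope below
    the minimal one. *)
Lemma chord_below a b :
  (forall t, (t <= m)%N -> (k + cn t < n)%N -> slope_fine a <= slope_fine t) ->
  (forall t, (t <= m)%N -> (n < k + cn t)%N -> slope_coarse t <= slope_coarse b) ->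
  slope_fine a <= slope_coarse b.
Proof.
move=> amin bmax; rewrite leNgt; apply/negP => lt.
have := @fine_exists b ((slope_fine a + slope_coarse b) / 2) bmax.
have h : slope_coarse b < (slope_fine a + slope_coarse b) / 2 by lra.
by move=> /(_ h) [t [tm tn ts]]; have := amin t tm tn; lra.
Qed.

End Chord.
End Lagrangian.

(** * Rounding two nested partitions *)

(** The k smallest terms have at most the overall average: cancel the common part and compare each
    of the first k terms with each of the last N - k. *)
Lemma sorted_prefix_sum (R : realType) (f : nat -> R) N k :
  (k <= N)%N -> (forall p q, (p <= q < N)%N -> f p <= f q) ->
  N%:R * \sum_(0 <= l < k) f l <= k%:R * \sum_(0 <= l < N) f l.
Proof.
move=> kN fm; rewrite [X in _ <= _ * X](big_cat_nat (n := k)) //= mulrDr.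
have -> : N%:R = k%:R + (N - k)%N%:R :> R by rewrite -natrD subnKC.
rewrite mulrDl lerD2l.
have -> : (N - k)%N%:R * \sum_(0 <= l < k) f l =
    \sum_(k <= l' < N) \sum_(0 <= l < k) f l.
  by rewrite sumr_const_nat mulr_natl.
have -> : k%:R * \sum_(k <= l < N) f l = \sum_(k <= l' < N) \sum_(0 <= l < k) f l'.
  rewrite mulr_sumr; apply: eq_bigr => l' _.
  by rewrite sumr_const_nat subn0 mulr_natl.
rewrite big_nat_cond [X in _ <= X]big_nat_cond.
apply: ler_sum => l' /andP[hl' _]; rewrite big_nat_cond [X in _ <= X]big_nat_cond.
by apply: ler_sum => l /andP[hl _]; apply: fm; lia.
Qed.

Section Instance.
Variables (R : realType) (n m L : nat) (ends : 'I_m -> 'I_n * 'I_n).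
Variables (edge : 'I_m -> 'I_m) (eu ev par rnk tim cn : nat -> nat).
Hypothesis edge_inj : injective edge.
Hypothesis euE : forall p : 'I_m, eu p = (ends (edge p)).1.
Hypothesis evE : forall p : 'I_m, ev p = (ends (edge p)).2.
Hypotheses (eu_lt : forall p, (eu p < n)%N) (ev_lt : forall p, (ev p < n)%N).
Hypothesis kr : kruskal_inv n L eu ev m par rnk tim cn.
Local Notation root := (uf_root L par tim).
Let uf := kr_uf kr.

Definition linked t : bool := root t (eu t) != root t (ev t).

Lemma cn_sum t : (t <= m)%N -> cn t = (\sum_(q < t) linked q)%N.
Proof.
elim: t => [_|t IHt tm]; first by rewrite big_ord0 (kr_cn0 kr).
by rewrite big_ord_recr /= (kr_cnS kr tm) IHt // ltnW.
Qed.

Lemma cn_mono t t' : (t <= t' <= m)%N -> (cn t <= cn t')%N.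
Proof.
elim: t' => [|t' IH]; first by rewrite leqn0 => /andP[/eqP ->].
move=> /andP[]; rewrite leq_eqVlt => /orP[/eqP ->//|tt'] t'm.
by rewrite (kr_cnS kr t'm); apply: leq_trans (IH _) (leq_addr _ _); lia.
Qed.

(** With P the condition x < 1 and t = m, this is the forest whose LP constraint is used. *)
Definition kruskal_set (P : pred 'I_m) t : {set 'I_m} :=
  edge @: [set p : 'I_m | [&& (p < t)%N, linked p & P p]].

(** The roots at time t are labels that agree along all earlier edges and differ at the ends of a
    link made at time t, as [forest_add_edge] requires. *)
Lemma kruskal_forest P t : (t <= m)%N -> is_forest ends (kruskal_set P t).
Proof.
elim: t => [_|t IHt tm].
  have no_adj u v : adj ends (kruskal_set P 0) u v = false.
    apply/existsP => -[e /andP[/imsetP[p]]]; rewrite inE.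
    by rewrite ltn0.
  by move=> [|u [|v p]] // /andP[] /=; rewrite no_adj.
have {}IHt := IHt (ltnW tm); pose pt := Ordinal tm.
case: (boolP (linked t && P pt)) => h; last first.
  suff -> : kruskal_set P t.+1 = kruskal_set P t by [].
  congr (edge @: (_ : {set _})); apply/setP => p; rewrite !inE ltnS leq_eqVlt andb_orl.
  case: eqP => //= e; have -> : p = pt by apply: val_inj.
  by rewrite (negbTE h) ltnn.
have -> : kruskal_set P t.+1 = edge pt |: kruskal_set P t.
  apply/setP => e; rewrite !inE; apply/imsetP/orP.
    move=> [p + ->]; rewrite inE ltnS leq_eqVlt andb_orl => /orP[/andP[/eqP e' _]|hp].
      by left; rewrite (_ : p = pt) //; apply: val_inj.
    by right; apply: imset_f; rewrite inE.
  case=> [/eqP ->|/imsetP[p + ->]]; first by exists pt; rewrite // inE /= ltnSn h.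
  by rewrite inE => /andP[hp h']; exists p; rewrite // inE h' ltnW.
apply: (forest_add_edge (f := fun v : 'I_n => root t v)) => //.
  move=> e /imsetP[p]; rewrite inE => /andP[pt' _] ->.
  by rewrite -euE -evE; apply: (kr_edge kr); rewrite pt' ltnW.
by rewrite -euE -evE; case/andP: h => /eqP.
Qed.

Lemma forest_slack k (x : 'I_m -> R) : lpC_feasible ends k x ->
  \sum_(p : 'I_m | linked p && (x (edge p) < 1)) (1 - x (edge p)) <= n%:R - k%:R.
Proof.
move=> [hF _].
have := hF _ (@kruskal_forest (fun p => x (edge p) < 1) m (leqnn m)).
rewrite /kruskal_set big_imset /=; last by move=> p q _ _; apply: edge_inj.
rewrite card_imset // => h.
rewrite (eq_bigl (fun p : 'I_m => p \in
   [set p : 'I_m | [&& (p < m)%N, linked p & x (edge p) < 1]])); last first.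
  by move=> p; rewrite inE ltn_ord.
by rewrite sumrB sumr_const; lra.
Qed.

Section Rounding.
Variables (i j : nat).
Hypotheses (ij : (i <= j)%N) (jm : (j <= m)%N).
Variables (lst : seq nat) (best : nat -> nat) (D C : nat -> R).

Definition crossing p : bool :=
  [&& (i <= p)%N, (p < j)%N & root i (eu p) != root i (ev p)].

Definition load r p : R := ((root i (eu p) == r) + (root i (ev p) == r))%N%:R.

Hypothesis lst_uniq : uniq lst.
Hypothesis lst_mem : forall r, reflect
  (exists2 p, crossing p & r = root i (eu p) \/ r = root i (ev p)) (r \in lst).
Hypothesis bestP : forall r, r \in lst -> exists r',
  [/\ best (root j r) = r'.+1, r' \in lst, root j r' = root j r & D r <= D r'].

Definition cand : seq nat := [seq r <- lst | best (root j r) != r.+1].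

Lemma lst_lt r : r \in lst -> (r < n)%N.
Proof.
by move=> /lst_mem[p _ [->|->]]; apply: uf_root_lt uf _ _ _.
Qed.

Lemma lst_fixed r : r \in lst -> uf_step par tim i r = r.
Proof.
by move=> /lst_mem[p _ [->|->]]; apply: uf_step_root uf _ _ _.
Qed.

Lemma lst_root r : r \in lst -> root i r = r.
Proof. by move=> /lst_fixed; apply: uf_root_fixed. Qed.

(* A class of the finer partition that no crossing edge touches is still a    *)
(* class of the coarser one.                                                  *)
Lemma unlisted_class r v : (r < n)%N -> (v < n)%N -> root i r = r -> r \notin lst ->
  root j v = root j r -> root i v = r.
Proof.
move=> rn vn ri rl vr; pose g w := root i w == r.
have gj q : (q < j)%N -> g (eu q) = g (ev q).
  move=> qj; rewrite /g; case: (ltnP q i) => qi.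
    by rewrite (kr_edge kr) //; lia.
  case: (root i (eu q) =P root i (ev q)) => [->//|ne].
  have cq : crossing q by rewrite /crossing qi qj; apply/eqP.
  have h1 : root i (eu q) \in lst by apply/lst_mem; exists q; auto.
  have h2 : root i (ev q) \in lst by apply/lst_mem; exists q; auto.
  by case: eqP h1 rl => [->->//|_ _]; case: eqP h2 => [->->|].
have := kr_conn kr jm vn gj; have := kr_conn kr jm rn gj.
by rewrite vr {2}/g ri eqxx => -> /esym/eqP.
Qed.

Lemma card_val_seq (s : seq nat) (A : {set 'I_n}) :
  (forall v : 'I_n, v \in A -> val v \in s) -> (#|A| <= size s)%N.
Proof.
move=> h; rewrite cardE -(size_map val); apply: uniq_leq_size.
  by rewrite map_inj_uniq ?enum_uniq //; apply: val_inj.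
by move=> w /mapP[v]; rewrite mem_enum => /h hv ->.
Qed.

(** Send each class at time i to its class at time j. On the non-candidates this is injective: an
    unlisted class is alone in its group, and at most one listed class per group is discarded. So
    the classes at time i number at most those at time j plus the candidates. *)
Lemma cand_count : (cn j <= cn i + size cand)%N.
Proof.
pose A := [set v : 'I_n | uf_step par tim i v == v].
pose B := [set v : 'I_n | uf_step par tim j v == v].
pose q (v : 'I_n) : 'I_n := Ordinal (uf_root_lt uf j (ltn_ord v)).
have cA : (cn i + #|A| = n)%N by apply: (kr_count kr); lia.
have cB : (cn j + #|B| = n)%N by apply: (kr_count kr).
pose A' := [set v in A | val v \notin cand].
have qinj : {in A' &, injective q}.
  move=> u v; rewrite !inE => /andP[/eqP uA uc] /andP[/eqP vA vc] [] e.
  apply: val_inj => /=; case: (boolP (val u \in lst)) => ul; last first.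
    rewrite -(unlisted_class (ltn_ord u) (ltn_ord v) (uf_root_fixed L uA) ul (esym e)).
    by rewrite (uf_root_fixed L vA).
  case: (boolP (val v \in lst)) => vl; last first.
    rewrite -(unlisted_class (ltn_ord v) (ltn_ord u) (uf_root_fixed L vA) vl e).
    by rewrite (uf_root_fixed L uA).
  move: uc vc; rewrite !mem_filter ul vl !andbT !negbK => /eqP ub /eqP.
  by rewrite -e ub => -[].
have A'B : (#|A'| <= #|B|)%N.
  rewrite -(card_in_imset qinj); apply: subset_leq_card; apply/subsetP => w.
  by move=> /imsetP[u _ ->]; rewrite inE /= (uf_step_root uf).
have : (#|A| <= #|A'| + size cand)%N.
  rewrite -(cardsID [set v : 'I_n | val v \in cand] A) addnC; apply: leq_add.
    by apply: subset_leq_card; apply/subsetP => v; rewrite !inE andbC.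
  by apply: card_val_seq => v; rewrite !inE => /andP[].
lia.
Qed.

Hypothesis C_ge0 : forall p, (p < m)%N -> 0 <= C p.
Hypothesis D_E : forall r, D r = \sum_(p < m | crossing p) C p * load r p.

Lemma D_ge0 r : 0 <= D r.
Proof.
by rewrite D_E; apply: sumr_ge0 => p _; rewrite mulr_ge0 ?ler0n // C_ge0.
Qed.

Lemma sum_load (s : seq nat) p : uniq s ->
  \sum_(r <- s) load r p =
  ((root i (eu p) \in s) + (root i (ev p) \in s))%N%:R.
Proof.
move=> us; rewrite -natr_sum big_split /=; congr (_%:R).
have h a : (\sum_(r <- s) (a == r) = (a \in s))%N.
  rewrite -count_uniq_mem // -sum1_count [RHS]big_mkcond /=.
  by apply: eq_bigr => r _; rewrite /= eq_sym; case: eqP.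
by rewrite !h.
Qed.

Lemma sum_D (s : seq nat) : uniq s ->
  \sum_(r <- s) D r = \sum_(p < m | crossing p)
    C p * ((root i (eu p) \in s) + (root i (ev p) \in s))%N%:R.
Proof.
move=> us; under eq_bigr => r _ do rewrite D_E.
rewrite exchange_big /=; apply: eq_bigr => p _.
by rewrite -mulr_sumr sum_load.
Qed.

Lemma sum_D_lst : \sum_(r <- lst) D r <= 2 * \sum_(p < m | crossing p) C p.
Proof.
rewrite sum_D // mulr_sumr; apply: ler_sum => p _.
rewrite mulrC; apply: ler_wpM2r; first exact: C_ge0.
by rewrite ler_nat; do 2 case: (_ \in _).
Qed.

(* Each discarded class has the largest D in its group, so every listed D is  *)
(* at most the sum over the discarded classes.                                *)
Lemma sum_D_cand :
  n%:R * \sum_(r <- cand) D r <= (n%:R - 1) * \sum_(r <- lst) D r.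
Proof.
pose ex := [seq r <- lst | best (root j r) == r.+1].
have split_lst : \sum_(r <- lst) D r = \sum_(r <- ex) D r + \sum_(r <- cand) D r.
  by rewrite !big_filter (bigID (fun r => best (root j r) == r.+1)).
suff le : \sum_(r <- lst) D r <= n%:R * \sum_(r <- ex) D r.
  by rewrite mulrBl mul1r {1}split_lst mulrDr; lra.
have sl : (size lst <= n)%N.
  rewrite -[n](size_iota 0); apply: uniq_leq_size => // r /lst_lt.
  by rewrite mem_iota add0n.
apply: (@le_trans _ _ ((size lst)%:R * \sum_(r <- ex) D r)); last first.
  by apply: ler_wpM2r; rewrite ?ler_nat //; apply: sumr_ge0 => r _; apply: D_ge0.
have -> : (size lst)%:R * \sum_(r <- ex) D r = \sum_(r' <- lst) \sum_(r <- ex) D r.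
  by rewrite big_const_seq count_predT iter_addr_0 mulr_natl.
rewrite big_seq [X in _ <= X]big_seq.
apply: ler_sum => r /bestP[r' [br rl rr le]]; apply: le_trans le _.
have r'ex : r' \in ex by rewrite mem_filter rl rr br eqxx.
rewrite (big_rem r') //= lerDl; apply: sumr_ge0 => *; exact: D_ge0.
Qed.

Variable ch : seq nat.
Hypotheses (ch_uniq : uniq ch) (ch_sub : {subset ch <= cand}).
Variable O : {set 'I_m}.
Hypothesis O_mem : forall p : 'I_m, (edge p \in O) = (j <= p)%N ||
  crossing p && ((root i (eu p) \in ch) || (root i (ev p) \in ch)).

(** Label a vertex by its class at time i if that class is chosen, and by its class at time j
    otherwise. Every edge outside [O] respects the label f. Each chosen class has its own label, and
    each class at time j keeps an unchosen vertex, so all these labels occur. *)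
Lemma rounding_components : (size ch + (n - cn j) <= num_components ends (~: O))%N.
Proof.
have ch_lst r : r \in ch -> r \in lst by move=> /ch_sub; rewrite mem_filter => /andP[].
pose B := [set v : 'I_n | uf_step par tim j v == v].
have cB : (cn j + #|B| = n)%N by apply: (kr_count kr).
pose f (v : 'I_n) := if root i v \in ch then (true, root i v) else (false, root j v).
(* The unchosen vertex of the coarse class with root q: q itself if unlisted, else the root of the
   discarded class, which is never a candidate. *)
pose rep (q : 'I_n) : 'I_n := insubd q (if val q \in lst then (best q).-1 else q).
have insubdE (q : 'I_n) a : (a < n)%N -> nat_of_ord (insubd q a : 'I_n) = a.
  by move=> an; rewrite -[LHS]/(val _) val_insubd an.
have repP q : q \in B -> [/\ root i (rep q) = rep q, root j (rep q) = q
    & nat_of_ord (rep q) \notin ch].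
  rewrite inE => /eqP qB; rewrite /rep.
  case: (boolP (nat_of_ord q \in lst)) => ql; last first.
    rewrite insubdE ?ltn_ord // (uf_root_fixed L qB); split=> //.
      by apply: uf_root_fixed; apply: (uf_fixed_mono uf) qB.
    by apply: contraNN ql => /ch_lst.
  have [r' [br rl rr _]] := bestP ql; rewrite (uf_root_fixed L qB) in br rr.
  rewrite br /= insubdE ?lst_lt //; split=> //; first exact: lst_root.
  by apply/negP => /ch_sub; rewrite mem_filter rr br eqxx.
have rep_inj : {in B &, injective rep}.
  move=> q q' qB q'B e; apply: val_inj => /=.
  by case: (repP q qB) => _ <- _; case: (repP q' q'B) => _ <- _; rewrite e.
pose S1 := [set v : 'I_n | val v \in ch].
have cS1 : #|S1| = size ch.
  apply/eqP; rewrite eqn_leq; apply/andP; split.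
    by apply: card_val_seq => v; rewrite inE.
  rewrite cardE -(size_map val); apply: uniq_leq_size => // r rc.
  have rn := lst_lt (ch_lst r rc).
  by apply/mapP; exists (Ordinal rn); rewrite // mem_enum inE.
have dis : [disjoint S1 & rep @: B].
  rewrite disjoint_subset; apply/subsetP => v; rewrite !inE => vc.
  by apply/negP => /imsetP[q /repP[_ _ /negP h] e]; apply: h; rewrite -e.
have -> : (n - cn j)%N = #|rep @: B| by rewrite card_in_imset //; lia.
rewrite -cS1.
have := leq_card_setU S1 (rep @: B); rewrite dis => -[_ /eqP <-].
rewrite {dis cS1}; apply: (num_components_ge (f := f)).
  move=> e; have [p <-] : exists p, edge p = e.
    by exists (invF edge_inj e); rewrite f_invF.
  rewrite in_setC O_mem negb_or -ltnNge => /andP[pj ncr].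
  have pj' : root j (eu p) = root j (ev p) by apply: (kr_edge kr); rewrite pj.
  rewrite /f -euE -evE pj'; case: (root i (eu p) =P root i (ev p)) => [->//|/eqP ne].
  have cr : crossing p.
    apply/and3P; split=> //; rewrite leqNgt; apply: contraNN ne => pi.
    by rewrite (kr_edge kr) // pi; lia.
  by move: ncr; rewrite cr /= negb_or => /andP[/negbTE -> /negbTE ->].
have fS1 (v : 'I_n) : v \in S1 -> f v = (true, nat_of_ord v).
  by rewrite inE => vc; rewrite /f lst_root ?ch_lst // vc.
have fS2 q : q \in B -> f (rep q) = (false, nat_of_ord q).
  by move=> /repP[h1 h2 /negbTE h3]; rewrite /f h1 h2 h3.
move=> u v; rewrite !in_setU => /orP[uS|/imsetP[q qB ->]] /orP[vS|/imsetP[q' q'B ->]].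
- by rewrite !fS1 // => -[/val_inj].
- by rewrite fS2 // fS1.
- by rewrite fS2 // fS1.
- by rewrite !fS2 // => -[/val_inj ->].
Qed.

(** A cut edge before position j meets one or two chosen classes, so its capacity is counted at
    least once among their D. *)
Lemma rounding_cost (c : 'I_m -> R) : (forall p : 'I_m, C p = c (edge p)) ->
  \sum_(e in O) c e <= \sum_(p < m | (j <= p)%N) C p + \sum_(r <- ch) D r.
Proof.
move=> cE; rewrite (reindex_inj edge_inj) /= sum_D //.
under eq_bigl => p do rewrite O_mem.
under eq_bigr => p _ do rewrite -cE.
rewrite big_mkcond [X in _ <= X + _]big_mkcond [X in _ <= _ + X]big_mkcond.
rewrite -big_split /=; apply: ler_sum => p _; have C0 := C_ge0 (ltn_ord p).
case: (leqP j p) => jp /=.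
  by rewrite lerDl; case: ifP => // _; rewrite mulr_ge0.
rewrite add0r; case: (crossing p) => //=.
case: (_ \in ch); case: (_ \in ch) => //=; rewrite ?addn0 ?mulr1 ?mulr0 ?lexx //.
by rewrite ler_peMr // ler1n.
Qed.
End Rounding.
End Instance.

(** * Scanning the partitions *)

Lemma ltnS_or t p : (t < p.+1)%N -> (t < p)%N \/ t = p.
Proof. by lia. Qed.

Definition BOr (b1 b2 : bexp) : bexp := BNot (BAnd (BNot b1) (BNot b2)).

(* Real scalar 4 receives the objective value V = sum c x, entry 0 of real    *)
(* array 3 the total capacity, and real array 2 the sorting keys x.           *)
Definition prepare_body : cmd :=
  Seq (RWrite 2 (ivar 40) (RRead 1 (ivar 40)))
  (Seq (rset 4 (RAdd (rvar 4) (RMul (RRead 0 (ivar 40)) (RRead 1 (ivar 40)))))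
       (rset 3 (RAdd (rvar 3) (RRead 0 (ivar 40))))).

Definition prepare : cmd :=
  Seq (iset 10 (IRead 0 (IConst 1)))
  (Seq (iset 40 (IConst 0)) (for_loop 40 0 1 prepare_body)).

Definition copy_order : cmd :=
  Seq (iset 40 (IConst 0))
      (for_loop 40 0 1 (IWrite 28 (ivar 40) (IRead 12 (ivar 40)))).

(* Scalars 41, 42 and 43 hold t.+1, or 0 as long as there is no candidate,    *)
(* where after t edges, respectively: the remaining edges are already a       *)
(* k-cut of cost at most V; there are more than k components and the slope    *)
(* [slope_fine] is minimal; there are fewer than k components and             *)
(* [slope_coarse] is maximal.                                                 *)
Definition scan_coarse : cmd :=
  Seq (rset 8 (RDiv (RSub (rvar 4) (RRead 3 (ivar 40)))
         (ROfInt (ISub (IAdd (IRead 0 (IConst 2)) (IRead 23 (ivar 40)))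
                       (IRead 0 (IConst 0))))))
  (If (BOr (BIEq (ivar 43) (IConst 0)) (BRLt (rvar 6) (rvar 8)))
     (Seq (iset 43 (IAdd (ivar 40) (IConst 1))) (rset 6 (rvar 8))) Skip).

Definition scan_fine : cmd :=
  Seq (rset 8 (RDiv (RSub (RRead 3 (ivar 40)) (rvar 4))
         (ROfInt (ISub (IRead 0 (IConst 0))
                       (IAdd (IRead 0 (IConst 2)) (IRead 23 (ivar 40)))))))
  (If (BOr (BIEq (ivar 42) (IConst 0)) (BRLt (rvar 8) (rvar 5)))
     (Seq (iset 42 (IAdd (ivar 40) (IConst 1))) (rset 5 (rvar 8))) Skip).

Definition scan_body : cmd :=
  let h := IAdd (IRead 0 (IConst 2)) (IRead 23 (ivar 40)) in
  If (BILt (IRead 0 (IConst 0)) h) scan_coarse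
  (Seq (If (BRLt (rvar 4) (RRead 3 (ivar 40))) Skip
          (iset 41 (IAdd (ivar 40) (IConst 1))))
       (If (BILt h (IRead 0 (IConst 0))) scan_fine Skip)).

Definition scan : cmd :=
  Seq (iset 44 (IAdd (IRead 0 (IConst 1)) (IConst 1)))
  (Seq (iset 40 (IConst 0)) (for_loop 40 44 0 scan_body)).

Section ScanRuns.
Variables (R : realType) (W n m k : nat).
Local Notation state := (state R).
Hypothesis mW : (m + 10 < W)%N.

Lemma prepare_runs (s : state) :
  imem s 0 1 = m -> rmem s 4 0 = 0 -> rmem s 3 0 = 0 ->
  runs W s prepare (100 * m.+1)
   (fun s' => [/\ imem s' 10 0 = m,
      (forall p, (p < m)%N -> rmem s' 2 p = rmem s 1 p),
      rmem s' 4 0 = \sum_(p < m) rmem s 0 p * rmem s 1 p &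
      rmem s' 3 0 = \sum_(p < m) rmem s 0 p]).
Proof.
move=> mE V0 T0; apply: (@runs_time _ _ (10 + (10 + (m * (50 + 15) + 6)))%N);
  first by lia.
apply: runs_cons => //=; first by rewrite mE; lia.
apply: runs_cons => //=; first by lia.
rewrite /upd /= mE.
pose I p (s' : state) := [/\
      (forall q, (q < p)%N -> rmem s' 2 q = rmem s 1 q),
      rmem s' 4 0 = \sum_(q < p) rmem s 0 q * rmem s 1 q &
      rmem s' 3 0 = \sum_(q < p) rmem s 0 q].
have H := @runs_for _ W I _ 40 0 1 prepare_body 50 0 m.
rewrite subn0 in H.
apply: (runs_weaken (H _ _ _ _ _ _ _ _ _ _ _)) => {H} //=; try lia.
- by split; rewrite /= ?big_ord0.
- move=> p s' pm pE [h2 h4 h3] sm.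
  apply: runs_cmd => //=; first by rewrite /upd /= pE; lia.
  move=> _; rewrite /set_imem /= /upd /= pE.
  rewrite !(same_rmem sm (a := 0%N)) // !(same_rmem sm (a := 1%N)) //=.
  split=> /=; rewrite ?big_ord_recr /= ?h4 ?h3 //.
  by move=> q qp; case: eqP => [->//|ne]; apply: h2; lia.
- by move=> s' [[h2 h4 h3] _] sm; split=> //; rewrite (same_imem sm (a := 10%N)).
Qed.

Lemma copy_order_runs (s : state) :
  imem s 0 1 = m -> (forall p, (p < m)%N -> (imem s 12 p < m)%N) ->
  runs W s copy_order (100 * m.+1)
   (fun s' => forall p, (p < m)%N -> imem s' 28 p = imem s 12 p).
Proof.
move=> mE om; apply: (@runs_time _ _ (10 + (m * (50 + 15) + 6))%N); first by lia.
apply: runs_cons => //=; first by lia.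
pose I p (s' : state) := forall q, (q < p)%N -> imem s' 28 q = imem s 12 q.
have H := @runs_for _ W I _ 40 0 1 (IWrite 28 (ivar 40) (IRead 12 (ivar 40))) 50 0 m.
rewrite subn0 in H.
apply: (runs_weaken (H _ _ _ _ _ _ _ _ _ _ _)) => {H} //=; try lia.
- move=> p s' pm pE Ip sm.
  have e12 : imem s' 12 = imem s 12.
    by rewrite (same_imem sm) //; apply: boolp.funext.
  apply: runs_cmd => //=; first by rewrite pE e12; have := om p pm; lia.
  move=> _ q qp; rewrite /= /upd /= pE e12; case: eqP => [->//|ne].
  by apply: Ip; lia.
- by move=> s' [h _].
Qed.

Section Scan.
Hypothesis nW : (4 * n + 10 < W)%N.
Variables (w : nat -> R) (cn : nat -> nat) (V : R).
Local Notation fine_slope := (slope_fine n k w cn V).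
Local Notation coarse_slope := (slope_coarse n k w cn V).

(** For g = 0 and p = m + 1 this is the hypothesis [bad] of the chord argument. *)
Definition good_inv p g : Prop :=
  if g is t.+1 then [/\ (t < p)%N, (k + cn t <= n)%N & w t <= V]
  else forall t, (t < p)%N -> (k + cn t <= n)%N -> V < w t.

Definition fine_inv p a (sl : R) : Prop :=
  if a is t.+1 then [/\ (t < p)%N, (k + cn t < n)%N, sl = fine_slope t &
      forall t', (t' < p)%N -> (k + cn t' < n)%N -> fine_slope t <= fine_slope t']
  else forall t, (t < p)%N -> ~~ (k + cn t < n)%N.

Definition coarse_inv p b (sl : R) : Prop :=
  if b is t.+1 then [/\ (t < p)%N, (n < k + cn t)%N, sl = coarse_slope t &
      forall t', (t' < p)%N -> (n < k + cn t')%N -> coarse_slope t' <= coarse_slope t]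
  else forall t, (t < p)%N -> ~~ (n < k + cn t)%N.

Lemma good_keep p g : good_inv p g -> ((k + cn p <= n)%N -> V < w p) ->
  good_inv p.+1 g.
Proof.
case: g => [|t] /= h hp; last by case: h => h1 h2 h3; split=> //; apply: ltnW.
by move=> t /ltnS_or[/h|->].
Qed.

Lemma fine_keep p a sl : fine_inv p a sl ->
  ((k + cn p < n)%N -> a <> 0%N /\ sl <= fine_slope p) -> fine_inv p.+1 a sl.
Proof.
case: a => [|t] /= h hp.
  by move=> t /ltnS_or[/h//|->]; apply/negP => /hp[].
case: h => h1 h2 h3 h4; split=> //; first exact: ltnW.
by move=> t' /ltnS_or[/h4//|->] /hp[_]; rewrite h3.
Qed.

Lemma fine_set p a sl : fine_inv p a sl -> (k + cn p < n)%N ->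
  a = 0%N \/ fine_slope p < sl -> fine_inv p.+1 p.+1 (fine_slope p).
Proof.
move=> h kp hs; split=> // t' /ltnS_or[t'p|->//] kt'.
case: a h hs => [|t] /= h; first by case/negP: (h t' t'p).
case=> //; case: h => _ _ -> h /ltW /le_trans; apply; exact: h.
Qed.

Lemma coarse_keep p b sl : coarse_inv p b sl ->
  ((n < k + cn p)%N -> b <> 0%N /\ coarse_slope p <= sl) -> coarse_inv p.+1 b sl.
Proof.
case: b => [|t] /= h hp.
  by move=> t /ltnS_or[/h//|->]; apply/negP => /hp[].
case: h => h1 h2 h3 h4; split=> //; first exact: ltnW.
by move=> t' /ltnS_or[/h4//|->] /hp[_]; rewrite h3.
Qed.

Lemma coarse_set p b sl : coarse_inv p b sl -> (n < k + cn p)%N ->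
  b = 0%N \/ sl < coarse_slope p -> coarse_inv p.+1 p.+1 (coarse_slope p).
Proof.
move=> h kp hs; split=> // t' /ltnS_or[t'p|->//] kt'.
case: b h hs => [|t] /= h; first by case/negP: (h t' t'p).
case=> //; case: h => _ _ -> h /ltW; apply: le_trans; exact: h.
Qed.

Definition scan_inv p (s : state) : Prop :=
  [/\ good_inv p (imem s 41 0), fine_inv p (imem s 42 0) (rmem s 5 0) &
      coarse_inv p (imem s 43 0) (rmem s 6 0)].

Lemma good_lt p g : good_inv p g -> (g <= p)%N.
Proof. by case: g => //= t []. Qed.

Lemma fine_lt p a sl : fine_inv p a sl -> (a <= p)%N.
Proof. by case: a => //= t []. Qed.

Lemma coarse_lt p b sl : coarse_inv p b sl -> (b <= p)%N.
Proof. by case: b => //= t []. Qed.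

Lemma scan_runs (s : state) :
  imem s 0 0 = n -> imem s 0 1 = m -> imem s 0 2 = k -> (k <= n)%N ->
  (forall t, (t <= m)%N -> imem s 23 t = cn t) ->
  (forall t, (t <= m)%N -> (cn t <= n)%N) ->
  (forall t, (t <= m)%N -> rmem s 3 t = w t) -> rmem s 4 0 = V ->
  imem s 41 0 = 0%N -> imem s 42 0 = 0%N -> imem s 43 0 = 0%N ->
  runs W s scan (200 * m.+1) (scan_inv m.+1).
Proof.
move=> nE mE kE kn cnE cnn wE VE g0 a0 b0.
apply: (@runs_time _ _ (10 + (10 + (m.+1 * (100 + 15) + 6)))%N); first by lia.
apply: runs_cons => //=; first by rewrite mE; lia.
apply: runs_cons => //=; first by lia.
rewrite /upd /= mE addn1.
have H := @runs_for _ W scan_inv _ 40 44 0 scan_body 100 0 m.+1.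
rewrite subn0 in H.
apply: (runs_weaken (H _ _ _ _ _ _ _ _ _ _ _)) => {H} //=; try lia; [| |by move=> s' []].
  by split; rewrite /= ?g0 ?a0 ?b0.
move=> p s' pm pE [hg ha hb] sm.
have p_le : (p <= m)%N by lia.
have nE' : imem s' 0 0 = n by rewrite (same_imem sm).
have kE' : imem s' 0 2 = k by rewrite (same_imem sm).
have cnE' : imem s' 23 p = cn p by rewrite (same_imem sm) //= cnE.
have wE' : rmem s' 3 p = w p by rewrite (same_rmem sm) //= wE.
have VE' : rmem s' 4 0 = V by rewrite (same_rmem sm).
have cp := cnn p p_le.
have gW := good_lt hg; have aW := fine_lt ha; have bW := coarse_lt hb.
apply: (@runs_branch _ _ 80) => //=; rewrite ?pE ?nE' ?kE' ?cnE'; first by lia.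
  move=> co; apply: (@runs_time _ _ (20 + 60)) => //.
  have nz : (k + cn p - n)%N%:R != 0 :> R by rewrite pnatr_eq0; lia.
  apply: runs_cons => //=; rewrite ?pE ?nE' ?kE' ?cnE' ?wE' ?VE' ?nz.
    by lia.
  rewrite /upd /= -/(coarse_slope p).
  have h1 := good_keep hg (p := p); have h2 := fine_keep ha (p := p).
  apply: (@runs_branch _ _ 20) => //=; first by lia.
    move=> hset; apply: runs_cmd => //=; first by rewrite /upd /= pE; lia.
    move=> _; rewrite /set_imem /upd /= pE addn1; split=> /=.
    + by apply: h1; lia.
    + by apply: h2; lia.
    + apply: coarse_set hb co _; move: hset; rewrite negb_and !negbK.
      by case/orP => [/eqP ->|]; auto.
  move=> hset; apply: runs_cmd => //= _; split=> //=; rewrite /upd /=.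
  + by apply: h1; lia.
  + by apply: h2; lia.
  + apply: coarse_keep hb _ => _; move: hset; rewrite negbK => /andP[/eqP h].
    by rewrite -leNgt.
rewrite -leqNgt => nco.
have h3 := coarse_keep hb (p := p).
apply: (@runs_time _ _ (20 + 60)) => //; apply: runs_cons => //=.
  by rewrite ?pE ?VE' ?wE'; case: ltP => _ /=; rewrite ?pE; lia.
rewrite ?pE ?VE' ?wE'.
set s1 := (if _ then _ else _).
have hg1 : good_inv p.+1 (imem s1 41 0).
  rewrite /s1; case: ltP => Vw /=; first by apply: good_keep hg _.
  by rewrite /upd /= addn1; split.
have fr1 a : a != 41%N -> imem s1 a = imem s' a.
  rewrite /s1; case: ltP => Vw //= /negbTE na; apply: boolp.funext => q.
  by rewrite /upd na.
have fr1r : rmem s1 = rmem s' by rewrite /s1; case: ifP.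
have gW1 := good_lt hg1.
move: hg1 fr1 fr1r gW1; move: s1 => s1 hg1 fr1 fr1r gW1.
have e0 : imem s1 0 = imem s' 0 by apply: fr1.
have e40 : imem s1 40 0 = p by rewrite fr1.
have e23 : imem s1 23 p = cn p by rewrite fr1.
have e42 : imem s1 42 0 = imem s' 42 0 by rewrite fr1.
have e43 : imem s1 43 0 = imem s' 43 0 by rewrite fr1.
apply: (@runs_branch _ _ 50) => //=; rewrite ?e0 ?e40 ?e23 ?nE' ?kE'; first by lia.
  move=> fi; apply: (@runs_time _ _ (20 + 30)) => //.
  have nz : (n - (k + cn p))%N%:R != 0 :> R by rewrite pnatr_eq0; lia.
  apply: runs_cons => //=; rewrite ?e0 ?e40 ?e23 ?nE' ?kE' ?fr1r ?wE' ?VE' ?nz.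
    by lia.
  rewrite /upd /= -/(fine_slope p).
  apply: (@runs_branch _ _ 10) => //=; first by lia.
    move=> hset; apply: runs_cmd => //=; first by rewrite /upd /= e40; lia.
    move=> _; rewrite /set_imem /upd /= e40 addn1; split=> //=.
    + apply: fine_set ha fi _; move: hset; rewrite negb_and !negbK -e42.
      by case/orP => [/eqP ->|]; auto.
    + by rewrite e43; apply: h3; lia.
  move=> hset; apply: runs_cmd => //= _; split=> //=; rewrite /upd /=.
  + rewrite e42; apply: fine_keep ha _ => _; move: hset; rewrite negbK -e42 => /andP[/eqP h].
    by rewrite -leNgt.
  + by rewrite e43; apply: h3; lia.
move=> nfi; apply: runs_cmd => //= _; split=> //=; rewrite /upd /= ?fr1r.
+ by rewrite e42; apply: fine_keep ha _; lia.
+ by rewrite e43; apply: h3; lia.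
Qed.

End Scan.
End ScanRuns.

(** * The rounding program *)

(* Scalars 55 and 56 are the prefix lengths i <= j of the finer and coarser   *)
(* partition.  For i <= p < j, arrays 45 and 46 hold the classes of the ends  *)
(* of the p-th edge at time i; arrays 48 (of length scalar 49) and 47 list    *)
(* and mark the classes met by crossing edges, and real array 7 is the        *)
(* capacity of the crossing edges at each of them.                            *)
Definition touch : cmd :=
  Seq (RWrite 7 (ivar 54) (RAdd (RRead 7 (ivar 54)) (RRead 0 (ivar 25))))
  (If (BIEq (IRead 47 (ivar 54)) (IConst 0))
     (Seq (IWrite 47 (ivar 54) (IConst 1))
     (Seq (IWrite 48 (ivar 49) (ivar 54)) (incr 49))) Skip).

Definition collect_first : cmd :=
  Seq (iset 25 (IRead 28 (ivar 40)))
  (Seq (iset 30 (IRead 1 (ivar 25))) (iset 31 (ivar 55))).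

Definition collect_second : cmd :=
  Seq (IWrite 45 (ivar 40) (ivar 30)) (iset 30 (IRead 2 (ivar 25))).

Definition collect_touch : cmd :=
  Seq (IWrite 46 (ivar 40) (ivar 30))
  (If (BIEq (IRead 45 (ivar 40)) (IRead 46 (ivar 40))) Skip
    (Seq (iset 54 (IRead 45 (ivar 40)))
    (Seq touch
    (Seq (iset 54 (IRead 46 (ivar 40))) touch)))).

Definition collect_body : cmd :=
  Seq collect_first (Seq find_root (Seq collect_second (Seq find_root collect_touch))).

Definition collect : cmd :=
  Seq (iset 40 (ivar 55)) (for_loop 40 56 0 collect_body).

Section RoundRuns.
Variables (R : realType) (W n m L : nat).
Local Notation state := (state R).
Hypotheses (nW : (4 * n + 10 < W)%N) (mW : (4 * m + 10 < W)%N).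

Let nW' : (n + 10 < W)%N. Proof. by lia. Qed.
Let mW' : (m + 10 < W)%N. Proof. by lia. Qed.

Definition listed (s : state) (l : seq nat) : Prop :=
  [/\ mkseq (imem s 48) (imem s 49 0) = l, uniq l,
      (forall r, r \in l -> (r < n)%N) &
      forall r, (imem s 47 r != 0%N) = (r \in l)].

Lemma listed_size s l : listed s l -> size l = imem s 49 0 /\ (size l <= n)%N.
Proof.
move=> [h1 h2 h3 _]; split; first by rewrite -h1 size_mkseq.
rewrite -[n](size_iota 0); apply: uniq_leq_size => // r /h3.
by rewrite mem_iota add0n.
Qed.

Lemma listed_ext s s' l : imem s' 47 = imem s 47 -> imem s' 48 = imem s 48 ->
  imem s' 49 0 = imem s 49 0 -> listed s l -> listed s' l.
Proof. by rewrite /listed => -> -> ->. Qed.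

Lemma touch_runs (s : state) r e l :
  imem s 54 0 = r -> imem s 25 0 = e -> (r < n)%N -> (e < m)%N ->
  (imem s 47 r <= 1)%N -> listed s l ->
  runs W s touch 60 (fun s' => [/\
    rmem s' 7 = (fun q => if q == r then rmem s 7 r + rmem s 0 e else rmem s 7 q),
    listed s' (if r \in l then l else rcons l r) &
    (forall q, (imem s 47 q <= 1)%N -> (imem s' 47 q <= 1)%N)]).
Proof.
move=> rE eE rn em s1 hl; have [lnE ln] := listed_size hl.
have [h1 h2 h3 h4] := hl.
apply: (@runs_time _ _ (20 + 40)) => //; apply: runs_cons => //=; rewrite rE ?eE.
  by lia.
rewrite /upd /=; apply: (@runs_branch _ _ 30) => //=; rewrite rE; first by lia.
  move=> /eqP r0; have rl : r \notin l by rewrite -h4 r0.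
  rewrite (negbTE rl).
  have ln' : (size l < n)%N.
    have : (size (r :: l) <= n)%N.
      rewrite -[n](size_iota 0); apply: uniq_leq_size; first by rewrite /= rl.
      by move=> q; rewrite inE mem_iota add0n => /orP[/eqP ->//|/h3].
    by [].
  apply: runs_cmd => //=; rewrite /upd /= ?rE; first by lia.
  split=> //.
    split=> /=.
    + rewrite addn1 mkseqSr eqxx; congr rcons; rewrite -h1.
      by apply: eq_mkseq_in => q ql; rewrite ifN //; lia.
    + by rewrite rcons_uniq rl.
    + by move=> q; rewrite mem_rcons inE => /orP[/eqP ->//|/h3].
    + by move=> q; rewrite mem_rcons inE; case: (q =P r) => //= _; apply: h4.
  by move=> q; case: ifP.
move=> r0; have rl : r \in l by rewrite -h4.
by rewrite rl; apply: runs_cmd.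
Qed.

Section Collect.
Variables (par rnk tim eu ev : nat -> nat) (C : nat -> R).
Variables (i j : nat).
Hypotheses (ij : (i <= j)%N) (jm : (j <= m)%N).
Hypothesis uf : uf_inv n L m par rnk tim.
Hypothesis tim_le : forall u, (tim u <= m)%N.
Hypotheses (eu_lt : forall p, (eu p < n)%N) (ev_lt : forall p, (ev p < n)%N).
Local Notation root := (uf_root L par tim).

Definition collect_inv p (s : state) (l : seq nat) : Prop := [/\
  (forall q, (i <= q < p)%N ->
     imem s 45 q = root i (eu q) /\ imem s 46 q = root i (ev q)),
  (forall r, rmem s 7 r = \sum_(q < m | crossing L eu ev par tim i p q)
     C q * load R L eu ev par tim i r q),
  listed s l, (forall q, (imem s 47 q <= 1)%N) &
  forall r, r \in l <-> (exists2 q, crossing L eu ev par tim i p q &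
     r = root i (eu q) \/ r = root i (ev q))].

Lemma crossingS p q : crossing L eu ev par tim i p.+1 q =
  crossing L eu ev par tim i p q ||
  [&& q == p, (i <= p)%N & root i (eu p) != root i (ev p)].
Proof.
rewrite /crossing ltnS [(q <= p)%N]leq_eqVlt; case: (q =P p) => [->|ne] /=; last by rewrite orbF.
by rewrite ltnn andbF.
Qed.

Lemma collect_runs (s : state) :
  imem s 55 0 = i -> imem s 56 0 = j ->
  imem s 20 = par -> imem s 22 = tim ->
  (forall p, (p < m)%N -> (imem s 28 p < m)%N) ->
  (forall p, (p < m)%N -> imem s 1 (imem s 28 p) = eu p) ->
  (forall p, (p < m)%N -> imem s 2 (imem s 28 p) = ev p) ->
  (forall p, (p < m)%N -> rmem s 0 (imem s 28 p) = C p) ->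
  (forall r, rmem s 7 r = 0) -> (forall r, imem s 47 r = 0%N) -> imem s 49 0 = 0%N ->
  runs W s collect (500 * (m * L.+1).+1) (fun s' => exists l, collect_inv j s' l).
Proof.
move=> iE jE pE tE om euE evE CE D0 seen0 ln0.
apply: (@runs_time _ _ (10 + (((j - i) * (300 * L.+1 + 15) + 6)))%N); first by nia.
apply: runs_cons => //=; first by rewrite iE; lia.
rewrite /upd /= iE.
pose I p (s' : state) := exists l, collect_inv p s' l.
apply: (runs_weaken (@runs_for _ W I _ 40 56 0 collect_body (300 * L.+1) i j
          _ _ _ _ _ _ _ _ _ _)) => //=; try lia; [| |by move=> s' []].
  exists [::]; split=> //=.
  - by move=> q; lia.
  - move=> r; rewrite D0 big_pred0 // => q; rewrite /crossing; lia.
  - by split; rewrite /= ?ln0 // => r; rewrite seen0.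
  - by move=> q; rewrite seen0.
  - by move=> r; rewrite in_nil; split=> // -[q]; rewrite /crossing; lia.
move=> p s' pij p'E [l [hPQ hD hl hs hlst]] sm.
have pm : (p < m)%N by lia.
have a0 : imem s' 1 (imem s 28 p) = eu p by rewrite (same_imem sm) //= euE.
have a1 : imem s' 2 (imem s 28 p) = ev p by rewrite (same_imem sm) //= evE.
have a28 : imem s' 28 p = imem s 28 p by rewrite (same_imem sm).
have a55 : imem s' 55 0 = i by rewrite (same_imem sm).
have a20 : imem s' 20 = par by rewrite (same_imem sm) // -pE; apply: boolp.funext.
have a22 : imem s' 22 = tim by rewrite (same_imem sm) // -tE; apply: boolp.funext.
have r0 : rmem s' 0 (imem s 28 p) = C p by rewrite (same_rmem sm) //= CE.
have oW := om p pm; set e := imem s 28 p in a0 a1 a28 r0 oW.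
have eup := eu_lt p; have evp := ev_lt p.
have un := uf_root_lt uf i eup; have vn := uf_root_lt uf i evp.
set u := root i (eu p) in un; set v := root i (ev p) in vn.
apply: (@runs_time _ _ (30 + (20 * L.+1 + (20 + (20 * L.+1 + 200))))%N); first by lia.
apply: runs_cons => //=.
  by rewrite /upd /= p'E a28 a0 a55; lia.
rewrite /upd /= p'E a28 a0 a55; apply: runs_seq.
set s1 := State _ _.
have e20 : imem s1 20 = par by rewrite -a20; apply: boolp.funext.
have e22 : imem s1 22 = tim by rewrite -a22; apply: boolp.funext.
(* The final forest, of time m, is queried at the earlier time i. *)
have := @find_root_runs R W n m L nW' mW' s1 m i (eu p) rnk.
rewrite e20 e22 => H; apply: (runs_weaken (H uf _ _ _ _ _ _)) => {H} //=; try lia.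
rewrite -/u => s2 r2 sm2 _.
have b40 : imem s2 40 0 = p by rewrite (same_imem sm2).
have b25 : imem s2 25 0 = e by rewrite (same_imem sm2).
have b2 : imem s2 2 e = ev p by rewrite (same_imem sm2).
apply: runs_cons => //=.
  by rewrite /upd /= b40 b25 r2 b2; lia.
rewrite /upd /= b40 b25 r2 b2; apply: runs_seq.
set s3 := State _ _.
have f20 : imem s3 20 = par by rewrite -e20 -(same_imem sm2) //; apply: boolp.funext.
have f22 : imem s3 22 = tim by rewrite -e22 -(same_imem sm2) //; apply: boolp.funext.
have := @find_root_runs R W n m L nW' mW' s3 m i (ev p) rnk.
rewrite f20 f22 => H; apply: (runs_weaken (H uf _ _ _ _ _ _)) => {H} //=; try lia.
  by rewrite (same_imem sm2).
rewrite -/v => s4 r4 sm4 _.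
have c40 : imem s4 40 0 = p by rewrite (same_imem sm4) //= (same_imem sm2).
have c25 : imem s4 25 0 = e by rewrite (same_imem sm4) //= (same_imem sm2).
have fr a : a \in [:: 46; 47; 48; 49]%N -> imem s4 a = imem s' a.
  move=> ha; apply: boolp.funext => q; move: ha.
  by rewrite !inE => /or4P[] /eqP ->; rewrite (same_imem sm4) //= (same_imem sm2).
have rfr : rmem s4 = rmem s'.
  by apply: boolp.funext => q; rewrite (same_rmem sm4) //= (same_rmem sm2).
have c45 q : imem s4 45 q = if q == p then u else imem s' 45 q.
  by rewrite (same_imem sm4) //= (same_imem sm2).
have hl4 : listed s4 l by apply: listed_ext hl; rewrite fr.
have hs4 q : (imem s4 47 q <= 1)%N by rewrite fr.
have i_p : (i <= p)%N by lia.
apply: (@runs_time _ _ (10 + 190)) => //; apply: runs_cons => //=.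
  by rewrite c40 r4; lia.
rewrite /upd /= c40 r4; set s5 := State _ _.
have hl5 : listed s5 l by apply: listed_ext hl4 => //; apply: boolp.funext.
have r5 : rmem s5 = rmem s' by [].
have d45 : imem s5 45 p = u by rewrite /= c45 eqxx.
have d46 : imem s5 46 p = v by rewrite /= eqxx.
have PQ q : (i <= q < p.+1)%N ->
    imem s5 45 q = root i (eu q) /\ imem s5 46 q = root i (ev q).
  move=> hq; rewrite /= c45 fr //; case: eqP => [->//|ne].
  by apply: hPQ; lia.
have d40 : imem s5 40 0 = p by [].
have d25 : imem s5 25 0 = e by [].
have d47 q : (imem s5 47 q <= 1)%N by exact: hs4.
move: hl5 r5 d45 d46 PQ d40 d25 d47; move: s5 => s5 hl5 r5 d45 d46 PQ d40 d25 d47.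
apply: (@runs_branch _ _ 170) => //=; rewrite d40 d45 d46; first by lia.
  move=> /eqP uv; apply: runs_cmd => //= _; exists l; split=> //=.
  - move=> r; rewrite /= r5 hD; apply: eq_bigl => q; rewrite crossingS.
    by rewrite -/u -/v uv eqxx !andbF orbF.
  - move=> r; rewrite hlst; split=> -[q hq hr]; exists q => //.
      by rewrite crossingS hq.
    by move: hq; rewrite crossingS -/u -/v uv eqxx !andbF orbF.
move=> uv; apply: (@runs_time _ _ (10 + (60 + (10 + 60)))) => //.
apply: runs_cons => //=; rewrite d40 d45; first by lia.
rewrite /upd /=; apply: runs_seq.
set s6 := State _ _.
have hl6 : listed s6 l by apply: listed_ext hl5 => //; apply: boolp.funext.
have H6 : (imem s6 47 u <= 1)%N by exact: d47.
apply: (runs_weaken (touch_runs (e := e) (r := u) _ _ _ _ H6 hl6)) => //=.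
set l7 := if u \in l then _ else _ => s7 [D7 hl7 s7le] sm7 _.
have g40 : imem s7 40 0 = p by rewrite (same_imem sm7).
have g46 q : imem s7 46 q = imem s5 46 q by rewrite (same_imem sm7).
have g45 q : imem s7 45 q = imem s5 45 q by rewrite (same_imem sm7).
have g25 : imem s7 25 0 = e by rewrite (same_imem sm7).
have g0 q : rmem s7 0 q = rmem s5 0 q by rewrite (same_rmem sm7).
apply: runs_cons => //=; rewrite g40 g46 d46; first by lia.
rewrite /upd /=; set s8 := State _ _.
have hl8 : listed s8 l7 by apply: listed_ext hl7 => //; apply: boolp.funext.
have H8 : (imem s8 47 v <= 1)%N by apply: s7le; exact: d47.
apply: (runs_weaken (touch_runs (e := e) (r := v) _ _ _ _ H8 hl8)) => //=.
set l9 := if v \in l7 then _ else _ => s9 [D9 hl9 s9le] sm9 _.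
have memS (r : nat) a (l' : seq nat) :
    (r \in (if a \in l' then l' else rcons l' a)) = (r == a) || (r \in l').
  by case: ifP => al; rewrite ?mem_rcons ?inE //; case: eqP => [->|].
exists l9; split=> //=.
- by move=> q /PQ; rewrite /upd /= !(same_imem sm9) //= g45 g46.
- move=> r; rewrite D9 D7 g0 /= r5 r0.
  rewrite (eq_bigl (fun q : 'I_m => crossing L eu ev par tim i p q || (val q == p))); last first.
    by move=> q; rewrite crossingS i_p -/u -/v uv !andbT.
  rewrite (bigD1 (Ordinal pm)) /= ?eqxx ?orbT //.
  rewrite (eq_bigl (fun q : 'I_m => crossing L eu ev par tim i p q)); last first.
    move=> q; rewrite -val_eqE /= /crossing; case: (nat_of_ord q =P p) => [->|]; rewrite ?orbF ?andbT //.
    by rewrite ltnn !andbF.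
  rewrite -hD /load -/u -/v [v == r]eq_sym [u == r]eq_sym.
  have uv' : (v == u) = false by rewrite eq_sym (negbTE uv).
  case: (r =P v) => [->|_]; rewrite ?uv' /=; last first.
    by case: (r =P u) => [->|_]; rewrite ?mulr1 ?mulr0 ?add0r // addrC.
  by rewrite mulr1 addrC.
- move=> q; apply: s9le; apply: s7le; exact: d47.
- move=> r; rewrite /l9 memS /l7 memS.
  split.
    case/orP => [/eqP ->|/orP[/eqP ->|/hlst[q hq hr]]].
    + by exists p; [rewrite crossingS eqxx i_p -/u -/v uv orbT|right].
    + by exists p; [rewrite crossingS eqxx i_p -/u -/v uv orbT|left].
    + by exists q => //; rewrite crossingS hq.
  move=> [q]; rewrite crossingS => /orP[hq hr|/andP[/eqP -> _]].
    by apply/orP; right; apply/orP; right; apply/hlst; exists q.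
  by rewrite -/u -/v => -[->|->]; rewrite eqxx ?orbT.
Qed.

End Collect.
End RoundRuns.

(* For each listed class r, array 51 holds its class q at time j, and entry q *)
(* of array 50 is r.+1 for the listed class r inside q that has the largest   *)
(* crossing capacity.                                                         *)
Definition best_load : cmd :=
  Seq (iset 54 (IRead 48 (ivar 40)))
  (Seq (iset 30 (ivar 54)) (iset 31 (ivar 56))).

Definition best_update : cmd :=
  Seq (IWrite 51 (ivar 54) (ivar 30))
  (If (BOr (BIEq (IRead 50 (ivar 30)) (IConst 0))
           (BRLt (RRead 7 (ISub (IRead 50 (ivar 30)) (IConst 1))) (RRead 7 (ivar 54))))
     (IWrite 50 (ivar 30) (IAdd (ivar 54) (IConst 1))) Skip).

Definition find_best : cmd :=
  Seq (iset 40 (IConst 0))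
      (for_loop 40 49 0 (Seq best_load (Seq find_root best_update))).

Definition candidate_body : cmd :=
  Seq (iset 54 (IRead 48 (ivar 40)))
  (If (BIEq (IRead 50 (IRead 51 (ivar 54))) (IAdd (ivar 54) (IConst 1))) Skip
     (Seq (IWrite 52 (ivar 10) (ivar 54))
     (Seq (RWrite 2 (ivar 10) (RRead 7 (ivar 54))) (incr 10)))).

Definition list_candidates : cmd :=
  Seq (iset 10 (IConst 0))
  (Seq (iset 40 (IConst 0)) (for_loop 40 49 0 candidate_body)).

Definition choose_body : cmd := IWrite 53 (IRead 52 (IRead 12 (ivar 40))) (IConst 1).

Definition choose_cheapest : cmd :=
  Seq (iset 57 (ISub (IAdd (IRead 0 (IConst 2)) (IRead 23 (ivar 56)))
                     (IRead 0 (IConst 0))))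
  (Seq (iset 40 (IConst 0)) (for_loop 40 57 0 choose_body)).

Definition cut_body : cmd :=
  let u := IRead 45 (ivar 40) in
  let v := IRead 46 (ivar 40) in
  If (BAnd (BNot (BIEq u v)) (BILt (IConst 0) (IAdd (IRead 53 u) (IRead 53 v))))
    (IWrite 3 (IRead 28 (ivar 40)) (IConst 1)) Skip.

Definition cut_chosen : cmd :=
  Seq (iset 40 (ivar 55)) (for_loop 40 56 0 cut_body).

Definition cut_rest : cmd :=
  Seq (iset 40 (ivar 58))
      (for_loop 40 0 1 (IWrite 3 (IRead 28 (ivar 40)) (IConst 1))).

Lemma order_inj m (o : nat -> nat) q p : perm_eq (mkseq o m) (iota 0 m) ->
  (q < m)%N -> (p < m)%N -> (o q == o p) = (q == p).
Proof.
move=> oP qm pm; have u : uniq (mkseq o m) by rewrite (perm_uniq oP) iota_uniq.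
apply/eqP/eqP => [e|->//].
by have := mkseq_uniqP _ _ u; apply; rewrite ?inE.
Qed.

Lemma order_lt m (o : nat -> nat) p : perm_eq (mkseq o m) (iota 0 m) ->
  (p < m)%N -> (o p < m)%N.
Proof.
move=> oP pm; have : o p \in mkseq o m by apply: map_f; rewrite mem_iota.
by rewrite (perm_mem oP) mem_iota.
Qed.

Lemma cut_rest_runs (R : realType) W m (s : state R) st :
  (4 * m + 10 < W)%N -> imem s 58 0 = st -> (st <= m)%N ->
  imem s 0 1 = m -> perm_eq (mkseq (imem s 28) m) (iota 0 m) ->
  runs W s cut_rest (100 * m.+1) (fun s' => forall q, (q < m)%N ->
    (imem s' 3 (imem s 28 q) != 0%N) = (st <= q)%N || (imem s 3 (imem s 28 q) != 0%N)).
Proof.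
move=> mW stE stm mE oP.
apply: (@runs_time _ _ (10 + (((m - st) * (50 + 15) + 6)))%N); first by nia.
apply: runs_cons => //=; first by rewrite stE; lia.
rewrite /upd /= stE.
pose I p (s' : state R) := forall q, (q < m)%N ->
    (imem s' 3 (imem s 28 q) != 0%N) =
    (st <= q < p)%N || (imem s 3 (imem s 28 q) != 0%N).
apply: (runs_weaken (@runs_for _ W I _ 40 0 1
   (IWrite 3 (IRead 28 (ivar 40)) (IConst 1)) 50 st m
          _ _ _ _ _ _ _ _ _ _)) => //=; try lia.
- by move=> q qm /=; rewrite (_ : (st <= q < st)%N = false) //; lia.
- move=> p s' pij p'E hI sm; have pm : (p < m)%N by lia.
  have a28 : imem s' 28 p = imem s 28 p by rewrite (same_imem sm).
  have op := order_lt oP pm.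
  apply: runs_cmd => //=; rewrite p'E a28; first by lia.
  move=> _ q qm; rewrite /= /upd /= (order_inj oP) //.
  case: (q =P p) => [->|ne'] /=.
    by rewrite (_ : (st <= p < p.+1)%N) //; lia.
  by rewrite hI //; congr (_ || _); lia.
- by move=> s' [h _] _ q qm; rewrite h // qm andbT.
Qed.

(** * Selecting the classes to split off, and marking their edges *)

Section SelectRuns.
Variables (R : realType) (W n m L : nat).
Local Notation state := (state R).
Hypotheses (nW : (4 * n + 10 < W)%N) (mW : (4 * m + 10 < W)%N).

Let nW' : (n + 10 < W)%N. Proof. by lia. Qed.
Let mW' : (m + 10 < W)%N. Proof. by lia. Qed.

Section Best.
Variables (par rnk tim : nat -> nat) (j ln : nat).
Hypotheses (jm : (j <= m)%N) (ln_n : (ln <= n)%N).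
Hypothesis uf : uf_inv n L m par rnk tim.
Hypothesis tim_le : forall u, (tim u <= m)%N.
Local Notation root := (uf_root L par tim).
Variables (f : nat -> nat) (D : nat -> R).
Hypothesis f_lt : forall q, (q < ln)%N -> (f q < n)%N.

Definition best_inv p (s : state) : Prop :=
  (forall q, (q < p)%N -> imem s 51 (f q) = root j (f q)) /\
  forall c, if imem s 50 c is r.+1 then
      exists q, [/\ (q < p)%N, f q = r, root j r = c &
        forall q', (q' < p)%N -> root j (f q') = c -> D (f q') <= D r]
    else forall q', (q' < p)%N -> root j (f q') <> c.

Lemma find_best_runs (s : state) :
  imem s 56 0 = j -> imem s 49 0 = ln -> imem s 48 = f -> rmem s 7 = D ->
  imem s 20 = par -> imem s 22 = tim -> (forall c, imem s 50 c = 0%N) ->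
  runs W s find_best (300 * (ln * L.+1).+1) (best_inv ln).
Proof.
move=> jE lnE fE DE pE tE b0.
apply: (@runs_time _ _ (10 + ((ln * (200 * L.+1 + 15) + 6)))%N); first by nia.
apply: runs_cons => //=; first by lia.
have H := @runs_for _ W best_inv _ 40 49 0
   (Seq best_load (Seq find_root best_update)) (200 * L.+1) 0 ln.
rewrite subn0 in H.
apply: (runs_weaken (H _ _ _ _ _ _ _ _ _ _ _)) => {H} //=; try lia;
  [| |by move=> s' []].
  by split=> //= c; rewrite /upd /= b0.
move=> p s' pln p'E [h51 h50] sm.
have a48 : imem s' 48 = f by rewrite (same_imem sm) // -fE; apply: boolp.funext.
have a56 : imem s' 56 0 = j by rewrite (same_imem sm).
have a20 : imem s' 20 = par by rewrite (same_imem sm) // -pE; apply: boolp.funext.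
have a22 : imem s' 22 = tim by rewrite (same_imem sm) // -tE; apply: boolp.funext.
have r7 : rmem s' 7 = D by rewrite (same_rmem sm) //= DE.
have fpn := f_lt pln.
apply: (@runs_time _ _ (30 + (20 * L.+1 + 60))%N); first by lia.
apply: runs_cons => //=.
  by rewrite /upd /= p'E a48 a56; lia.
rewrite /upd /= p'E a48 a56; apply: runs_seq.
set s1 := State _ _.
have e20 : imem s1 20 = par by rewrite -a20; apply: boolp.funext.
have e22 : imem s1 22 = tim by rewrite -a22; apply: boolp.funext.
have := @find_root_runs R W n m L nW' mW' s1 m j (f p) rnk.
rewrite e20 e22 => H; apply: (runs_weaken (H uf _ _ _ _ _ _)) => {H} //=.
move=> s2 r2 sm2 _.
have b54 : imem s2 54 0 = f p by rewrite (same_imem sm2).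
have b50 q : imem s2 50 q = imem s' 50 q by rewrite (same_imem sm2).
have b51 q : imem s2 51 q = imem s' 51 q by rewrite (same_imem sm2).
have b7 : rmem s2 7 = D by rewrite (same_rmem sm2).
have cn := uf_root_lt uf j fpn; set c := root j (f p) in r2 cn.
have bW : (imem s' 50 c <= n)%N.
  have := h50 c; case: (imem s' 50 c) => // r [q [qp <- _ _]].
  by apply: f_lt; lia.
apply: (@runs_time _ _ (10 + 50)) => //; apply: runs_cons => //=.
  by rewrite b54 r2; lia.
rewrite /upd /= b54 r2.
apply: (@runs_branch _ _ 20) => //=; rewrite ?b54 ?r2 ?b50 ?b7; first by lia.
  move=> hset; apply: runs_cmd => //=; rewrite /upd /= ?b54 ?r2; first by lia.
  move=> _; split=> /=; rewrite /upd /=.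
    move=> q qp; case: eqP => [->//|ne]; rewrite b51; apply: h51.
    by move: ne; case: (q =P p) => [->//|]; lia.
  move=> c'; case: eqP => [->|ne]; last first.
    rewrite b50; have := h50 c'; case: (imem s' 50 c') => [h q' /ltnS_or[/h//|->]|r].
      by move=> e; apply: ne.
    move=> [q [qp fq rc hmax]]; exists q; split=> //; first by lia.
    by move=> q' /ltnS_or[/hmax//|-> e]; case: ne.
  rewrite addn1; exists p; split=> // q' /ltnS_or[q'p|->//] e.
  have := h50 c; move: hset; rewrite negb_and !negbK.
  case: (imem s' 50 c) => [_ /(_ q' q'p)//|r /=].
  rewrite subn1 /= => lt [q [_ _ _ hmax]].
  by apply: le_trans (hmax q' q'p e) (ltW lt).
move=> hset; apply: runs_cmd => //= _; split=> /=; rewrite /upd /=.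
  move=> q qp; case: eqP => [->//|ne]; rewrite b51; apply: h51.
  by move: ne; case: (q =P p) => [->//|]; lia.
move=> c'; rewrite b50; have := h50 c'.
move: hset; rewrite negbK => /andP[/eqP bc]; rewrite -leNgt => le.
case: (c' =P c) => [->|ne].
  case E: (imem s' 50 c) bc le => [|r] // _; rewrite subn1 /= => le.
  move=> [q [qp fq rc hmax]]; exists q; split=> //; first by lia.
  by move=> q' /ltnS_or[/hmax//|->].
case: (imem s' 50 c') => [h q' /ltnS_or[/h//|->]|r]; first by move=> e; apply: ne.
move=> [q [qp fq rc hmax]]; exists q; split=> //; first by lia.
by move=> q' /ltnS_or[/hmax//|-> e]; case: ne.
Qed.

Lemma list_candidates_runs (s : state) :
  imem s 49 0 = ln -> imem s 48 = f -> rmem s 7 = D -> best_inv ln s ->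
  runs W s list_candidates (200 * ln.+1) (fun s' =>
    mkseq (imem s' 52) (imem s' 10 0) =
      [seq r <- mkseq f ln | imem s 50 (root j r) != r.+1] /\
    (forall q, (q < imem s' 10 0)%N -> rmem s' 2 q = D (imem s' 52 q))).
Proof.
move=> lnE fE DE [h51 h50].
apply: (@runs_time _ _ (10 + (10 + (ln * (100 + 15) + 6)))%N); first by lia.
apply: runs_cons => //=; first by lia.
apply: runs_cons => //=; first by lia.
set B := fun r => imem s 50 (root j r) != r.+1.
have [Fl FlE] : exists Fl, Fl = fun p => [seq r <- mkseq f p | B r] by eexists.
have FlS p : Fl p.+1 = if B (f p) then rcons (Fl p) (f p) else Fl p.
  by rewrite FlE mkseqSr filter_rcons.
pose I p (s' : state) := [/\
    mkseq (imem s' 52) (imem s' 10 0) = Fl p,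
    (imem s' 10 0 <= p)%N &
    (forall q, (q < imem s' 10 0)%N -> rmem s' 2 q = D (imem s' 52 q))].
have H := @runs_for _ W I _ 40 49 0 candidate_body 100 0 ln.
rewrite subn0 in H.
apply: (runs_weaken (H _ _ _ _ _ _ _ _ _ _ _)) => {H} //=; try lia;
  [by split; rewrite /= ?FlE| |by move=> s' [[h1 _ h3] _] _; rewrite h1 FlE].
move=> p s' pln p'E [hm hN hk] sm.
have a48 : imem s' 48 = f by rewrite (same_imem sm) // -fE; apply: boolp.funext.
have a50 c : imem s' 50 c = imem s 50 c by rewrite (same_imem sm).
have a51 : imem s' 51 (f p) = root j (f p) by rewrite (same_imem sm) //= /upd /= h51.
have r7 : rmem s' 7 = D by rewrite (same_rmem sm) //= DE.
have fpn := f_lt pln; have cn := uf_root_lt uf j fpn.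
have bW : (imem s 50 (root j (f p)) <= n)%N.
  have := h50 (root j (f p)); case: (imem s 50 _) => // r [q [qp <- _ _]].
  by apply: f_lt; lia.
apply: (@runs_time _ _ (10 + 90)) => //; apply: runs_cons => //=.
  by rewrite p'E a48; lia.
rewrite /upd /= p'E a48; apply: (@runs_branch _ _ 70) => //=; rewrite ?a51 ?a50.
- by lia.
- move=> b; apply: runs_cmd => //= _; split=> //=; rewrite /upd /=.
    by rewrite FlS /B (eqP b) addn1 eqxx.
  by lia.
move=> b; apply: runs_cmd => //=; rewrite /upd /= ?r7; first by lia.
move=> _; split=> /=; rewrite ?addn1 //.
- rewrite /upd /= mkseqSr /= eqxx FlS /B -[(f p).+1]addn1 b -hm; congr rcons.
  by apply: eq_mkseq_in => q qp; rewrite ifN //; lia.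
- by rewrite /upd /= => q /ltnS_or[qN|->]; [rewrite !ifN ?hk //; lia|rewrite !eqxx].
Qed.

End Best.

Lemma choose_cheapest_runs (s : state) (nc k j k0 : nat) :
  imem s 0 0 = n -> imem s 0 2 = k -> imem s 56 0 = j ->
  (j < W)%N -> (k <= n)%N -> (imem s 23 j <= n)%N ->
  k0 = (k + imem s 23 j - n)%N -> (k0 <= nc)%N -> (nc <= n)%N ->
  (forall q, (q < nc)%N -> (imem s 12 q < nc)%N) ->
  (forall q, (q < nc)%N -> (imem s 52 q < n)%N) ->
  (forall c, imem s 53 c = 0%N) ->
  runs W s choose_cheapest (100 * nc.+1) (fun s' =>
    (forall c, (imem s' 53 c <= 1)%N) /\
    (forall c, (imem s' 53 c != 0%N) =
       (c \in mkseq (fun q => imem s 52 (imem s 12 q)) k0))).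
Proof.
move=> nE kE jE jW kn cjn k0E k0nc ncn ho hc c0.
apply: (@runs_time _ _ (20 + (10 + (k0 * (20 + 15) + 6)))%N); first by lia.
apply: runs_cons => //=; first by rewrite nE kE jE; lia.
apply: runs_cons => //=; first by lia.
rewrite /upd /= nE kE jE -k0E.
set g := fun q => imem s 52 _.
pose I p (s' : state) := (forall c, (imem s' 53 c <= 1)%N) /\
    (forall c, (imem s' 53 c != 0%N) = (c \in mkseq g p)).
have H := @runs_for _ W I _ 40 57 0 choose_body 20 0 k0.
rewrite subn0 in H.
apply: (runs_weaken (H _ _ _ _ _ _ _ _ _ _ _)) => {H} //=; try lia;
  [| | by move=> s' []].
  by split=> c /=; rewrite c0.
move=> p s' pk p'E [h1 h2] sm.
have a12 : imem s' 12 p = imem s 12 p by rewrite (same_imem sm).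
have a52 : imem s' 52 (imem s 12 p) = g p by rewrite (same_imem sm).
have := ho p (leq_trans pk k0nc) => op; have := hc _ op; rewrite -/(g p) => gn.
apply: runs_cmd => //=; rewrite p'E a12 a52; first by lia.
move=> _; split=> c /=; rewrite /upd /=; first by case: ifP.
by rewrite mkseqSr mem_rcons inE -h2; case: (c =P g p).
Qed.

Section Cut.
Variables (eu ev par tim : nat -> nat) (i j : nat) (ch : seq nat).
Hypotheses (ij : (i <= j)%N) (jm : (j <= m)%N).
Local Notation root := (uf_root L par tim).

Lemma cut_chosen_runs (s : state) :
  imem s 55 0 = i -> imem s 56 0 = j -> perm_eq (mkseq (imem s 28) m) (iota 0 m) ->
  (forall q, (i <= q < j)%N ->
     imem s 45 q = root i (eu q) /\ imem s 46 q = root i (ev q)) ->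
  (forall q, (i <= q < j)%N -> (root i (eu q) < n)%N /\ (root i (ev q) < n)%N) ->
  (forall c, (imem s 53 c <= 1)%N) ->
  (forall c, (imem s 53 c != 0%N) = (c \in ch)) -> (forall e, imem s 3 e = 0%N) ->
  runs W s cut_chosen (100 * m.+1) (fun s' => forall q, (q < m)%N ->
    (imem s' 3 (imem s 28 q) != 0%N) = crossing L eu ev par tim i j q &&
       ((root i (eu q) \in ch) || (root i (ev q) \in ch))).
Proof.
move=> iE jE oP hPQ hn c1 hc o0.
apply: (@runs_time _ _ (10 + (((j - i) * (50 + 15) + 6)))%N); first by nia.
apply: runs_cons => //=; first by rewrite iE; lia.
rewrite /upd /= iE.
pose I p (s' : state) := forall q, (q < m)%N ->
    (imem s' 3 (imem s 28 q) != 0%N) = crossing L eu ev par tim i p q &&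
       ((root i (eu q) \in ch) || (root i (ev q) \in ch)).
apply: (runs_weaken (@runs_for _ W I _ 40 56 0 cut_body 50 i j
          _ _ _ _ _ _ _ _ _ _)) => //=; try lia; [| |by move=> s' []].
  by move=> q qm /=; rewrite o0 /crossing; case: (ltnP q i); rewrite ?andbF //; lia.
move=> p s' pij p'E hI sm.
have pm : (p < m)%N by lia.
have [h45 h46] := hPQ p pij; have [un vn] := hn p pij.
have a45 : imem s' 45 p = root i (eu p) by rewrite (same_imem sm).
have a46 : imem s' 46 p = root i (ev p) by rewrite (same_imem sm).
have a28 : imem s' 28 p = imem s 28 p by rewrite (same_imem sm).
have a53 c : imem s' 53 c = imem s 53 c by rewrite (same_imem sm).
have i_p : (i <= p)%N by lia.
have ouW := c1 (root i (eu p)); have ovW := c1 (root i (ev p)).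
have op := order_lt oP pm.
have sumE : (0 < imem s 53 (root i (eu p)) + imem s 53 (root i (ev p)))%N =
    (root i (eu p) \in ch) || (root i (ev p) \in ch).
  by rewrite -!hc addn_gt0 !lt0n.
apply: (@runs_branch _ _ 20) => //=; rewrite p'E a45 a46 !a53; first by lia.
  rewrite sumE => /andP[ne hch].
  apply: runs_cmd => //=; rewrite p'E a28; first by lia.
  move=> _ q qm; rewrite /= /upd /= (order_inj oP) // crossingS.
  case: (q =P p) => [->|ne'] /=; first by rewrite i_p ne orbT hch.
  by rewrite orbF; apply: hI.
rewrite sumE => nb; apply: runs_cmd => //= _ q qm.
rewrite /= /upd /= crossingS hI //; case: (q =P p) => [->|] /=; last by rewrite orbF.
rewrite i_p andb_orl; move: nb; case: (_ != _) => //=; last by rewrite orbF.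
by move=> /negbTE ->; rewrite !andbF.
Qed.

End Cut.
End SelectRuns.

Definition round_partition : cmd :=
  Seq (iset 55 (ISub (ivar 42) (IConst 1)))
  (Seq (iset 56 (ISub (ivar 43) (IConst 1)))
  (Seq collect
  (Seq find_best
  (Seq list_candidates
  (Seq sort_keys
  (Seq choose_cheapest
  (Seq cut_chosen (iset 58 (ivar 56))))))))).

(** * The rounding phase as a whole *)

Section RoundPartition.
Variables (R : realType) (W n m L k : nat).
Local Notation state := (state R).
Hypotheses (nW : (4 * n + 10 < W)%N) (mW : (4 * m + 10 < W)%N).
Hypothesis n_lt : (n < 2 ^ L.+1)%N.
Variables (par rnk tim cn eu ev : nat -> nat) (C : nat -> R) (i j : nat).
Hypotheses (eu_lt : forall p, (eu p < n)%N) (ev_lt : forall p, (ev p < n)%N).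
Hypothesis kr : kruskal_inv n L eu ev m par rnk tim cn.
Hypothesis tim_le : forall u, (tim u <= m)%N.
Hypotheses (ij : (i <= j)%N) (jm : (j <= m)%N) (kn : (k <= n)%N).
Hypotheses (fine_i : (k + cn i < n)%N) (coarse_j : (n < k + cn j)%N).
Local Notation root := (uf_root L par tim).
Local Notation cross := (crossing L eu ev par tim i j).
Local Notation cands := (cand L par tim j).

(* What the rounding phase leaves behind: the listed classes l, the choice    *)
(* [best] of the discarded ones, their crossing capacities D and the chosen   *)
(* classes ch.                                                                *)
Record rounded (out : nat -> bool) (l : seq nat) (best : nat -> nat)
    (D : nat -> R) (ch : seq nat) : Prop := Rounded {
  rd_uniq : uniq l;
  rd_mem : forall r, r \in l <->
    (exists2 q, cross q & r = root i (eu q) \/ r = root i (ev q));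
  rd_best : forall r, r \in l -> exists r',
    [/\ best (root j r) = r'.+1, r' \in l, root j r' = root j r & D r <= D r'];
  rd_D : forall r, D r =
    \sum_(q < m | cross q) C q * load R L eu ev par tim i r q;
  rd_ch_uniq : uniq ch;
  rd_ch_sub : {subset ch <= cands l best};
  rd_ch_size : size ch = (k + cn j - n)%N;
  rd_ch_cheap : (size (cands l best))%:R * \sum_(r <- ch) D r <=
    (size ch)%:R * \sum_(r <- cands l best) D r;
  rd_out : forall q, (q < m)%N -> out q =
    cross q && ((root i (eu q) \in ch) || (root i (ev q) \in ch))
}.

(** Every listed class is met by one of two ends of some edge. This bounds the later loops by the
    number of edges instead of n. *)
Lemma listed_le_edges l :
  uniq l -> (forall r, r \in l <->
    (exists2 q, cross q & r = root i (eu q) \/ r = root i (ev q))) ->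
  (size l <= 2 * m)%N.
Proof.
move=> ul hl; have -> : (2 * m = size (mkseq (fun q => root i (eu q)) m ++
    mkseq (fun q => root i (ev q)) m))%N by rewrite size_cat !size_mkseq mul2n addnn.
apply: uniq_leq_size => // r /hl[q /and3P[_ qj _] hr]; rewrite mem_cat.
have qm : q \in iota 0 m by rewrite mem_iota add0n (leq_trans qj jm).
by apply/orP; case: hr => ->; [left|right]; apply: map_f.
Qed.

Lemma round_partition_runs (s : state) :
  imem s 0 0 = n -> imem s 0 1 = m -> imem s 0 2 = k ->
  imem s 42 0 = i.+1 -> imem s 43 0 = j.+1 ->
  imem s 20 = par -> imem s 22 = tim -> imem s 23 = cn ->
  perm_eq (mkseq (imem s 28) m) (iota 0 m) ->
  (forall p, (p < m)%N -> imem s 1 (imem s 28 p) = eu p) ->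
  (forall p, (p < m)%N -> imem s 2 (imem s 28 p) = ev p) ->
  (forall p, (p < m)%N -> rmem s 0 (imem s 28 p) = C p) ->
  (forall a c, a \in [:: 3; 47; 49; 50; 53]%N -> imem s a c = 0%N) ->
  (forall r, rmem s 7 r = 0) ->
  runs W s round_partition (40 * 100 * (m * L.+1).+1) (fun s' =>
    imem s' 58 0 = j /\ exists l best D ch,
      rounded (fun q => imem s' 3 (imem s 28 q) != 0%N) l best D ch).
Proof.
move=> nE mE kE iE jE parE timE cnE oP euE evE CE z0 D0.
pose ln := (2 * m)%N.
apply: (@runs_time _ _ (10 + (10 + (500 * (m * L.+1).+1 + (300 * (ln * L.+1).+1 +
  (200 * ln.+1 + (300 * (ln * L.+2).+1 + (100 * ln.+1 + (100 * m.+1 + 10))))))))%N).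
  by rewrite /ln; nia.
apply: runs_cons => //=; first by rewrite iE; lia.
apply: runs_cons => //=; first by rewrite /upd /= jE; lia.
rewrite /upd /= iE jE !subn1 /=; apply: runs_seq.
set s1 := State _ _.
have uf := kr_uf kr.
have e20 : imem s1 20 = par by rewrite -parE; apply: boolp.funext.
have e22 : imem s1 22 = tim by rewrite -timE; apply: boolp.funext.
have om p : (p < m)%N -> (imem s 28 p < m)%N by apply: order_lt.
apply: (runs_weaken (collect_runs nW mW ij jm uf tim_le eu_lt ev_lt (C := C) (s := s1)
  _ _ e20 e22 _ _ _ _ _ _ _)) => //=; try by move=> *; apply: z0.
move=> s2 [l [hPQ hD hl hs hlst]] sm2 _.
have [lnE lnn] := listed_size hl; have [lE ul l_lt _] := hl.
have l2m := listed_le_edges ul hlst.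
have b a c : a \in [:: 0; 3; 20; 22; 23; 28; 50; 53; 55; 56]%N -> imem s2 a c = imem s1 a c.
  move=> ha; apply: (proj1 sm2); move: ha; rewrite !inE.
  by do 9 (case/orP => [/eqP -> //|]); move/eqP ->.
have bf a : a \in [:: 0; 3; 20; 22; 23; 28; 50; 53; 55; 56]%N -> imem s2 a = imem s1 a.
  by move=> ha; apply: boolp.funext => c; apply: b.
apply: runs_seq.
have f_lt q : (q < size l)%N -> (imem s2 48 q < n)%N.
  move=> ql; apply: l_lt; rewrite -lE; apply: map_f.
  by rewrite mem_iota add0n -lnE.
apply: (runs_weaken (find_best_runs nW mW (j := j) (ln := size l) jm lnn uf tim_le
  (f := imem s2 48) (D := rmem s2 7) f_lt (s := s2) _ _ _ _ _ _ _)) => //.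
- by rewrite b.
- by rewrite bf.
- by rewrite bf.
- by move=> c; rewrite b //; apply: z0.
- by rewrite leq_mul2l /= ltnS leq_mul2r l2m orbT.
move=> s3 hbest sm3 _.
have c48 : imem s3 48 = imem s2 48 by rewrite (same_imem sm3).
have c49 : imem s3 49 = imem s2 49 by rewrite (same_imem sm3).
have c7 : rmem s3 7 = rmem s2 7 by rewrite (same_rmem sm3).
apply: runs_seq.
apply: (runs_weaken (list_candidates_runs nW mW (j := j) (ln := size l) jm lnn uf
  (f := imem s2 48) (D := rmem s2 7) f_lt (s := s3) _ c48 c7 hbest)) => //.
- by rewrite c49.
- by rewrite leq_mul2l /= ltnS.
move=> s4 [hc hkey] sm4 _.
set best := imem s3 50; pose D := rmem s2 7.
have hc' : mkseq (imem s4 52) (imem s4 10 0) = cands l best.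
  by rewrite hc lnE lE.
set N := imem s4 10 0 in hc' hkey.
have NE : N = size (cands l best) by rewrite -hc' size_mkseq.
have Nl : (N <= size l)%N by rewrite NE size_filter count_size.
have bestP r : r \in l -> exists r',
    [/\ best (root j r) = r'.+1, r' \in l, root j r' = root j r & D r <= D r'].
  rewrite -{1}lE => /mapP[q]; rewrite mem_iota add0n -lnE => /= ql rE.
  have := proj2 hbest (root j r); rewrite -/best.
  case: (best _) => [/(_ q ql)|r' [q' [q'l fq' rr hmax]]]; first by rewrite rE.
  exists r'; split=> //; last by rewrite rE; apply: hmax; rewrite // -rE.
  by rewrite -lE -fq'; apply: map_f; rewrite mem_iota add0n -lnE.
have hmem r : reflect (exists2 q, cross q & r = root i (eu q) \/ r = root i (ev q))
    (r \in l) by apply: (equivP idP).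
have NL : (N <= 2 ^ L.+1)%N by apply: leq_trans (ltnW n_lt); apply: leq_trans Nl lnn.
(* There are enough candidates: at least cn j - cn i of them, and k + cn i < n. *)
have k0N : (k + cn j - n <= N)%N.
  by have := cand_count kr ij jm best ul hmem; rewrite -NE; lia.
apply: runs_seq.
apply: (runs_weaken (sort_keys_runs (N := N) (L := L.+1) (s := s4) _ NL _)) => //.
- by lia.
- by rewrite leq_mul2l /= ltnS leq_mul2r (leq_trans Nl) ?orbT.
move=> s5 [hperm hsort] sm5 _.
have d a c : a \in [:: 0; 3; 20; 22; 23; 28; 45; 46; 53; 55; 56]%N -> imem s5 a c = imem s2 a c.
  move=> ha; rewrite (proj1 sm5) ?(proj1 sm4) ?(proj1 sm3) //; move: ha; rewrite !inE;
  by do 10 (case/orP => [/eqP -> //|]); move/eqP ->.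
have db a c : a \in [:: 0; 3; 20; 22; 23; 28; 53; 55; 56]%N -> imem s5 a c = imem s1 a c.
  move=> ha; rewrite d ?b //; move: ha; rewrite !inE;
  by do 8 (case/orP => [/eqP -> //|]); move/eqP ->.
have d52 : imem s5 52 = imem s4 52 by rewrite (same_imem sm5).
apply: runs_seq.
have cjn : (cn j <= n)%N by have := kr_count kr jm; lia.
apply: (runs_weaken (choose_cheapest_runs nW mW (s := s5) (nc := N) (k := k) (j := j)
  (k0 := (k + cn j - n)%N) _ _ _ _ kn _ _ k0N _ _ _ _)) => //.
- by rewrite db.
- by rewrite db.
- by rewrite db.
- by lia.
- by rewrite db //= cnE.
- by rewrite db //= cnE.
- exact: leq_trans Nl lnn.
- by move=> q qN; apply: (order_lt hperm).
- move=> q qN; rewrite d52; apply: l_lt.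
  have : imem s4 52 q \in cands l best by rewrite -hc'; apply: map_f; rewrite mem_iota.
  by rewrite mem_filter => /andP[].
- by move=> c; rewrite db //=; apply: z0.
- by rewrite leq_mul2l /= ltnS; apply: leq_trans Nl l2m.
move=> s6 [h53 hch] sm6 _.
set ch := mkseq _ _ in hch.
have e a c : a \in [:: 0; 3; 28; 45; 46; 55; 56]%N -> imem s6 a c = imem s5 a c.
  move=> ha; rewrite (proj1 sm6) //; move: ha; rewrite !inE;
  by do 6 (case/orP => [/eqP -> //|]); move/eqP ->.
have e28 : imem s6 28 = imem s 28.
  by apply: boolp.funext => c; rewrite e // db.
apply: runs_seq.
apply: (runs_weaken (cut_chosen_runs nW mW (eu := eu) (ev := ev) (par := par) (tim := tim)
   (L := L) (i := i) (j := j) (ch := ch) ij jm (s := s6) _ _ _ _ _ h53 hch _)) => //.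
- by rewrite e // db.
- by rewrite e // db.
- by rewrite e28.
- by move=> q /hPQ; rewrite !e // !d.
- by move=> q _; split; apply: (uf_root_lt uf).
- by move=> c; rewrite e // db //=; apply: z0.
move=> s7 hout sm7 _.
have f56 : imem s7 56 0 = j by rewrite (same_imem sm7) // e // db.
apply: runs_cmd => //=; rewrite f56; first by lia.
rewrite /upd /=; split=> //.
exists l, best, D, ch.
have candE : cands l best = mkseq (imem s5 52) N by rewrite -hc' d52.
have chE : ch = mkseq (fun q => imem s5 52 (imem s5 12 q)) (k + cn j - n) by [].
have u12 : uniq (mkseq (imem s5 12) N) by rewrite (perm_uniq hperm) iota_uniq.
have ucand : uniq (mkseq (imem s5 52) N) by rewrite -candE filter_uniq.
have permc : perm_eq (mkseq (fun q => imem s5 52 (imem s5 12 q)) N) (mkseq (imem s5 52) N).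
  rewrite /mkseq (map_comp (imem s5 52) (imem s5 12)); apply: perm_map.
  exact: hperm.
(* The chosen classes are an initial segment of the candidates sorted by D, as [sorted_prefix_sum]
   needs. *)
have chT : ch = take (k + cn j - n) (mkseq (fun q => imem s5 52 (imem s5 12 q)) N).
  rewrite chE -map_take take_iota; congr map; congr iota.
  by apply/esym/minn_idPl.
split=> //.
- by rewrite chT; apply: take_uniq; rewrite (perm_uniq permc).
- by move=> r; rewrite chT => /mem_take; rewrite (perm_mem permc) candE.
- by rewrite chE size_mkseq.
- rewrite candE size_mkseq -(perm_big _ permc) /= chE size_mkseq.
  rewrite !big_map.
  have := @sorted_prefix_sum R (fun q => D (imem s5 52 (imem s5 12 q))) N _ k0N.
  rewrite /index_iota !subn0; apply=> p q pq.
  have pN : (imem s5 12 p < N)%N by apply: (order_lt hperm); lia.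
  have qN : (imem s5 12 q < N)%N by apply: (order_lt hperm); lia.
  have := hsort p q pq; rewrite !hkey // d52.
  by [].
- by move=> q qm; rewrite -hout // e28.
Qed.

End RoundPartition.

(** * The complete program *)

Definition kcut_program : cmd :=
  Seq prepare
  (Seq sort_keys
  (Seq copy_order
  (Seq kruskal
  (Seq scan
  (Seq (If (BIEq (ivar 41) (IConst 0)) round_partition
          (iset 58 (ISub (ivar 41) (IConst 1))))
       cut_rest))))).

(** * Arithmetic of the approximation ratio and of the logarithm *)

Section Arithmetic.
Variable R : realType.

(** With rho = 1 - 1/n, the bounds give (A + B) X <= 2 rho B (wi - wj). Since 2 rho >= 1 for n >= 2,
    also (A + B) wj <= 2 rho (A + B) wj. The sum of the right-hand sides is 2 rho (A wj + B wi), and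
    the slope inequality bounds this by 2 rho (A + B) V. *)
Lemma rounding_arith (n A B N : nat) (V wi wj X S D : R) :
  (1 < n)%N -> (0 < A)%N -> (0 < B)%N -> (A + B <= N)%N -> 0 <= wj -> 0 <= X ->
  N%:R * X <= B%:R * S -> n%:R * S <= (n%:R - 1) * D -> D <= 2 * (wi - wj) ->
  (wi - V) / A%:R <= (V - wj) / B%:R ->
  wj + X <= 2 * (1 - n%:R^-1) * V.
Proof.
move=> n1 A0 B0 ABN wj0 X0 hX hS hD.
have a0 : 0 < A%:R :> R by rewrite ltr0n.
have b0 : 0 < B%:R :> R by rewrite ltr0n.
have ab0 : 0 < A%:R + B%:R :> R by lra.
have n0 : 0 < n%:R :> R by rewrite ltr0n; lia.
rewrite ler_pdivrMr // mulrAC ler_pdivlMr // => hch.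
set rho := 1 - n%:R^-1.
have rho1 : 1 <= 2 * rho.
  rewrite /rho; have : n%:R^-1 <= 2^-1 :> R by rewrite lef_pV2 ?posrE ?ler_nat.
  by lra.
have hS' : S <= rho * D.
  rewrite -(ler_pM2l n0); apply: le_trans hS _.
  by rewrite mulrA /rho mulrBr mulr1 mulfV ?gt_eqF.
have hX' : (A%:R + B%:R) * X <= B%:R * (rho * (2 * (wi - wj))).
  apply: (@le_trans _ _ (N%:R * X)).
    by apply: ler_wpM2r; rewrite // -natrD ler_nat.
  apply: le_trans hX _; apply: ler_wpM2l; first exact: ltW.
  by apply: le_trans hS' _; apply: ler_wpM2l => //; lra.
rewrite -(ler_pM2l ab0).
have h1 : 0 <= (2 * rho - 1) * ((A%:R + B%:R) * wj).
  by apply: mulr_ge0; [lra|apply: mulr_ge0; lra].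
have h2 : 0 <= (2 * rho) * (A%:R * (V - wj) - B%:R * (wi - V)).
  by apply: mulr_ge0; lra.
by move: h1 h2 hX'; lra.
Qed.

Lemma suffix_sum (C : nat -> R) m j : (j <= m)%N ->
  \sum_(q < m) C q - \sum_(q < j) C q = \sum_(q < m | (j <= q)%N) C q.
Proof.
move=> jm; rewrite (big_ord_widen _ C jm).
apply/eqP; rewrite subr_eq addrC; apply/eqP.
rewrite [LHS](bigID (fun q : 'I_m => (q < j)%N)) /=; congr (_ + _).
by apply: eq_bigl => q; rewrite -leqNgt.
Qed.

Lemma sum_order (g : nat -> R) (o : nat -> nat) m :
  perm_eq (mkseq o m) (iota 0 m) -> \sum_(q < m) g (o q) = \sum_(q < m) g q.
Proof.
move=> oP; rewrite -(big_mkord xpredT g) -(big_mkord xpredT (g \o o)).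
by rewrite /index_iota subn0 -[RHS](perm_big _ oP) big_map.
Qed.

Lemma log_bound n : (0 < n)%N -> (trunc_log 2 n)%:R <= 2 * ln n%:R :> R.
Proof.
(* From ln (1 + z) <= z at z = -1/2. *)
move=> n0; have ln2 : 2^-1 <= ln 2 :> R.
  rewrite -[X in X <= _]opprK lerNl -lnV ?posrE //.
  have -> : 2^-1 = 1 + - 2^-1 :> R by lra.
  by apply: le_trans (le_ln1Dx _) _; lra.
have : ln (2 ^+ trunc_log 2 n) <= ln n%:R :> R.
  rewrite ler_ln ?posrE ?exprn_gt0 ?ltr0n //.
  by rewrite -natrX ler_nat trunc_logP.
rewrite lnXn // -[ln 2 *+ _]mulr_natl => h.
have := ler_wpM2l (ler0n R (trunc_log 2 n)) ln2.
by lra.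
Qed.

End Arithmetic.

Section InputFacts.
Variables (n m : nat) (ends : 'I_m -> 'I_n * 'I_n).

Lemma simple_graph_size : simple_graph ends -> (m <= n * n)%N.
Proof.
move=> [_ inj]; have einj : injective ends.
  by move=> e e' ee; apply: inj; rewrite /= ee.
by have := leq_card _ einj; rewrite card_prod !card_ord.
Qed.

Lemma simple_graph_order : simple_graph ends -> (0 < m)%N -> (1 < n)%N.
Proof.
move=> [ne _] m0; have := ne (Ordinal m0); case: (ends _) => -[u un] [v vn] /=.
by rewrite -val_eqE /=; lia.
Qed.

Lemma forest0 : is_forest ends set0.
Proof.
have no_adj u v : adj ends set0 u v = false.
  by apply/existsP => -[e]; rewrite inE.
by move=> [|u [|v p]] // /andP[] /=; rewrite no_adj.
Qed.

(** The constraint of the empty forest reads 0 >= k - n. *)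
Lemma feasible_order (R : realType) k (x : 'I_m -> R) :
  lpC_feasible ends k x -> (k <= n)%N.
Proof.
move=> [h _]; have := h _ forest0; rewrite cards0 big_set0 add0r subr_le0.
by rewrite ler_nat.
Qed.

End InputFacts.

(** * Correctness and running time of the complete program *)

Section Main.
Variables (R : realType) (n m k : nat) (ends : 'I_m -> 'I_n * 'I_n).
Variables (c x : 'I_m -> R).
Hypotheses (n_gt0 : (0 < n)%N) (simple : simple_graph ends).
Hypotheses (c_gt0 : forall e, 0 < c e) (feas : lpC_feasible ends k x).
Local Notation state := (state R).
Let L := trunc_log 2 n.
Let s0 : state := input_state k ends c x.

Let n_lt : (n < 2 ^ L.+1)%N.
Proof. exact: trunc_log_ltn. Qed.

Let L_le : (L <= n)%N.
Proof.
apply: leq_trans (_ : 2 ^ L <= n)%N; first exact/ltnW/ltn_expl.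
by apply: trunc_logP.
Qed.

Let k_le : (k <= n)%N.
Proof. exact: feasible_order feas. Qed.

Let s0_end1 i : (imem s0 1 i < n)%N.
Proof. by rewrite /=; case: insub. Qed.

Let s0_end2 i : (imem s0 2 i < n)%N.
Proof. by rewrite /=; case: insub. Qed.

Let s0_c (e : 'I_m) : rmem s0 0 e = c e.
Proof. by rewrite /= valK. Qed.

Let s0_x (e : 'I_m) : rmem s0 1 e = x e.
Proof. by rewrite /= valK. Qed.

Section Order.
Variable o : nat -> nat.
Hypothesis oP : perm_eq (mkseq o m) (iota 0 m).
Hypothesis o_sorted : forall p q, (p <= q < m)%N -> rmem s0 1 (o p) <= rmem s0 1 (o q).
Let eu q := imem s0 1 (o q).
Let ev q := imem s0 2 (o q).
Let C q := rmem s0 0 (o q).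
Let y q := rmem s0 1 (o q).
Let V := \sum_(q < m) C q * y q.
Let w t := \sum_(q < m) C q - \sum_(q < t) C q.

Definition edge_at (p : 'I_m) : 'I_m := insubd p (o p).

Lemma edge_atE p : val (edge_at p) = o p.
Proof. by rewrite val_insubd (order_lt oP). Qed.

Lemma edge_at_inj : injective edge_at.
Proof.
move=> p q /(congr1 val); rewrite !edge_atE => /eqP; rewrite (order_inj oP) //.
by move/eqP/val_inj.
Qed.

Lemma edge_at_end1 (p : 'I_m) : eu p = (ends (edge_at p)).1.
Proof. by rewrite /eu -edge_atE /= valK. Qed.

Lemma edge_at_end2 (p : 'I_m) : ev p = (ends (edge_at p)).2.
Proof. by rewrite /ev -edge_atE /= valK. Qed.

Lemma edge_at_c (p : 'I_m) : C p = c (edge_at p).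
Proof. by rewrite /C -edge_atE s0_c. Qed.

Lemma edge_at_x (p : 'I_m) : y p = x (edge_at p).
Proof. by rewrite /y -edge_atE s0_x. Qed.

Lemma C_gt0 q : (q < m)%N -> 0 < C q.
Proof. by move=> qm; rewrite (edge_at_c (Ordinal qm)). Qed.

Lemma y_ge0 q : (q < m)%N -> 0 <= y q.
Proof. by move=> qm; rewrite (edge_at_x (Ordinal qm)); apply: (proj2 feas). Qed.

Lemma objective : V = \sum_e c e * x e.
Proof.
rewrite /V (sum_order (fun q => rmem s0 0 q * rmem s0 1 q) oP).
by apply: eq_bigr => e _; rewrite s0_c s0_x.
Qed.

Lemma objective_ge0 : 0 <= V.
Proof.
by apply: sumr_ge0 => q _; apply: mulr_ge0; [apply/ltW/C_gt0|apply: y_ge0].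
Qed.

Section Cut.
Variables (par rnk tim cn : nat -> nat).
Hypothesis kr : kruskal_inv n L eu ev m par rnk tim cn.

Lemma lagrangian (s : R) : 0 <= s -> exists2 t, (t <= m)%N &
  w t + s * (cn t)%:R <= V + s * (n%:R - k%:R).
Proof.
move=> s_ge0.
have [p pm|p pm|p q pq||//|t tm h] := @lagrangian_bound R C y
   (linked L eu ev par tim) m (n%:R - k%:R) s.
- exact/ltW/C_gt0.
- exact: y_ge0.
- exact: o_sorted.
- have := forest_slack edge_at_inj edge_at_end1 edge_at_end2 kr feas.
  rewrite (eq_bigl (fun p : 'I_m => linked L eu ev par tim p && (y p < 1))); last first.
    by move=> p; rewrite edge_at_x.
  by under eq_bigr => p _ do rewrite -edge_at_x.
by exists t => //; rewrite (cn_sum kr tm).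
Qed.

Lemma w_ge0 t : (t <= m)%N -> 0 <= w t.
Proof.
by move=> tm; rewrite /w suffix_sum //; apply: sumr_ge0 => q _; apply/ltW/C_gt0.
Qed.

Variables (i j : nat) (l : seq nat) (best : nat -> nat) (D : nat -> R) (ch : seq nat).
Hypotheses (ij : (i <= j)%N) (jm : (j <= m)%N).
Variable out : nat -> bool.
Hypothesis rd : rounded n m L k par tim cn eu ev C i j out l best D ch.
Variable O : {set 'I_m}.
Hypothesis O_mem : forall p : 'I_m, (edge_at p \in O) = (j <= p)%N || out p.

Let eu_lt p : (eu p < n)%N. Proof. exact: s0_end1. Qed.
Let ev_lt p : (ev p < n)%N. Proof. exact: s0_end2. Qed.
Let l_mem r : reflect (exists2 p, crossing L eu ev par tim i j p &
  r = uf_root L par tim i (eu p) \/ r = uf_root L par tim i (ev p)) (r \in l).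
Proof. by apply: (equivP idP); apply: (rd_mem rd). Qed.
Let O_mem' (p : 'I_m) : (edge_at p \in O) = (j <= p)%N ||
  crossing L eu ev par tim i j p && ((uf_root L par tim i (eu p) \in ch) ||
                                     (uf_root L par tim i (ev p) \in ch)).
Proof. by rewrite O_mem (rd_out rd). Qed.

Lemma rounded_kcut : is_kcut ends k O.
Proof.
have := rounding_components edge_at_inj edge_at_end1 edge_at_end2 eu_lt ev_lt kr ij jm
  (rd_uniq rd) l_mem (rd_best rd) (rd_ch_uniq rd) (rd_ch_sub rd) O_mem'.
rewrite (rd_ch_size rd); apply: leq_trans.
by have := kr_count kr jm; lia.
Qed.

Lemma rounded_cost : \sum_(e in O) c e <= w j + \sum_(r <- ch) D r.
Proof.
rewrite /w suffix_sum //.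
apply: (rounding_cost edge_at_inj _ (rd_D rd) (rd_ch_uniq rd) O_mem' edge_at_c).
by move=> p pm; apply/ltW/C_gt0.
Qed.

Lemma rounded_cost_le : (1 < n)%N -> (k + cn i < n)%N -> (n < k + cn j)%N ->
  slope_fine n k w cn V i <= slope_coarse n k w cn V j ->
  \sum_(e in O) c e <= 2 * (1 - n%:R^-1) * V.
Proof.
move=> n1 fi cj chord; apply: le_trans rounded_cost _.
have C0 p : (p < m)%N -> 0 <= C p by move=> pm; apply/ltW/C_gt0.
have D0 r : 0 <= D r by apply: (D_ge0 C0 (rd_D rd)).
have im : (i <= m)%N by apply: leq_trans ij jm.
apply: (@rounding_arith R n (n - (k + cn i)) (k + cn j - n) (size (cand L par tim j l best))
   V (w i) (w j) (\sum_(r <- ch) D r) (\sum_(r <- cand L par tim j l best) D r)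
   (\sum_(r <- l) D r)) => //.
- by lia.
- by lia.
- by have := cand_count kr ij jm best (rd_uniq rd) l_mem; lia.
- exact: w_ge0.
- by apply: sumr_ge0.
- by rewrite -(rd_ch_size rd); apply: (rd_ch_cheap rd).
- exact: (sum_D_cand eu_lt ev_lt kr (rd_uniq rd) l_mem (rd_best rd) C0 (rd_D rd)).
apply: le_trans (sum_D_lst (rd_uniq rd) C0 (rd_D rd)) _.
apply: ler_wpM2l => //; rewrite /w !suffix_sum // lerBrDr.
rewrite big_mkcond [X in _ + X]big_mkcond [X in _ <= X]big_mkcond -big_split /=.
apply: ler_sum => q _; rewrite /crossing; have := C0 q (ltn_ord q).
by case: (leqP i q) => iq; case: (leqP j q) => jq; case: (_ != _);
  rewrite /= ?addr0 ?add0r //; lia.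
Qed.

End Cut.
End Order.

Lemma kcut_program_runs W : (4 * n + 10 < W)%N -> (4 * m + 10 < W)%N ->
  runs W s0 kcut_program (80 * 100 * (m * L.+1).+1) (fun s =>
    is_kcut ends k (output_set m s) /\
    \sum_(e in output_set m s) c e <= 2 * (1 - n%:R^-1) * \sum_e c e * x e).
Proof.
move=> nW mW.
have nW' : (n + 10 < W)%N by lia.
have mW' : (m + 10 < W)%N by lia.
apply: (@runs_time _ _ (100 * m.+1 + (300 * (m * (2 * L + 2).+1).+1 + (100 * m.+1 +
  (300 * (m * L.+1).+1 + (200 * m.+1 + ((40 * 100 * (m * L.+1).+1 + 10) +
   100 * m.+1))))))%N); first by nia.
apply: runs_seq; apply: (runs_weaken (prepare_runs mW' (s := s0) _ _ _)) => //.
move=> s1 [N1 key1 V1 T1] sm1 _.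
(* Simplicity gives m <= n^2 <= 2^(2L+2), so the tournament on the edges has depth O(log n). *)
apply: runs_seq; apply: (runs_weaken (sort_keys_runs (L := (2 * L + 2)%N) N1 _ _)) => //.
- apply: leq_trans (simple_graph_size simple) _.
  rewrite (_ : 2 * L + 2 = L.+1 + L.+1)%N; last by lia.
  by rewrite expnD; apply: leq_mul; apply: ltnW.
- by lia.
move=> s2 [perm2 sort2] sm2 _.
apply: runs_seq; apply: (runs_weaken (copy_order_runs mW' (s := s2) _ _)) => //.
- by rewrite (same_imem sm2) // (same_imem sm1).
- by move=> p; apply: (order_lt perm2).
move=> s3 copy3 sm3 _.
set o := imem s3 28.
have oP : perm_eq (mkseq o m) (iota 0 m) by rewrite (eq_mkseq_in copy3).
have o_lt p : (p < m)%N -> (o p < m)%N by apply: (order_lt oP).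
have o_sorted p q : (p <= q < m)%N -> rmem s0 1 (o p) <= rmem s0 1 (o q).
  move=> pq; rewrite -!key1; try by apply: o_lt; lia.
  by rewrite /o !copy3; [apply: sort2|lia|lia].
pose w t : R := \sum_(q < m) rmem s0 0 (o q) - \sum_(q < t) rmem s0 0 (o q).
pose V : R := \sum_(q < m) rmem s0 0 (o q) * rmem s0 1 (o q).
have fr3 a : a \in [:: 0; 1; 2; 3; 20; 21; 22; 23; 41; 42; 43; 47; 49; 50; 53]%N ->
    imem s3 a = imem s0 a.
  move=> ha; rewrite (same_imem sm3) ?(same_imem sm2) ?(same_imem sm1) //; move: ha;
  by rewrite !inE; do 14 (case/orP => [/eqP -> //|]); move/eqP ->.
have r3 a : a \in [:: 0; 1; 7]%N -> rmem s3 a = rmem s0 a.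
  move=> ha; rewrite (same_rmem sm3) ?(same_rmem sm2) ?(same_rmem sm1) //; move: ha;
  by rewrite !inE => /or3P[] /eqP ->.
have V3 : rmem s3 4 0 = V.
  rewrite (same_rmem sm3) // (same_rmem sm2) // V1.
  by rewrite /V (sum_order (fun q => rmem s0 0 q * rmem s0 1 q) oP).
have T3 : rmem s3 3 0 = \sum_(q < m) rmem s0 0 (o q).
  by rewrite (same_rmem sm3) // (same_rmem sm2) // T1 (sum_order _ oP).
apply: runs_seq.
have := kruskal_runs nW' mW' L_le n_lt (s := s3).
rewrite T3 (r3 0%N) // (fr3 0%N) // (fr3 1%N) // (fr3 2%N) // (fr3 20%N) //.
rewrite (fr3 21%N) // (fr3 22%N) // (fr3 23%N) // => H.
apply: (runs_weaken (H _ n_gt0 s0_end1 s0_end2 o_lt _ _ _ _)) => {H} //.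
move=> s4 [kr [tim4 w4]] sm4 _.
set par := imem s4 20 in kr; set rnk := imem s4 21 in kr; set tim := imem s4 22 in kr tim4.
set cn := imem s4 23 in kr.
have fr4 a : a \in [:: 0; 1; 2; 3; 28; 41; 42; 43; 47; 49; 50; 53]%N ->
    imem s4 a = imem s3 a.
  move=> ha; rewrite (same_imem sm4) //; move: ha;
  by rewrite !inE; do 11 (case/orP => [/eqP -> //|]); move/eqP ->.
have cn_le t : (t <= m)%N -> (cn t <= n)%N by move=> tm; have := kr_count kr tm; lia.
apply: runs_seq.
apply: (runs_weaken (scan_runs mW' nW (s := s4) (k := k) (w := w) (cn := cn) (V := V)
   _ _ _ k_le _ cn_le _ _ _ _ _)) => //; try by rewrite fr4 // fr3.
- by rewrite (same_rmem sm4).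
move=> s5 [good5 fine5 coarse5] sm5 _.
have fr5 a : a \in [:: 0; 1; 2; 3; 20; 22; 23; 28; 47; 49; 50; 53]%N ->
    imem s5 a = imem s4 a.
  move=> ha; rewrite (same_imem sm5) //; move: ha;
  by rewrite !inE; do 11 (case/orP => [/eqP -> //|]); move/eqP ->.
have e28 : imem s5 28 = o by rewrite fr5 // fr4.
have fr50 a : a \in [:: 0; 1; 2; 3; 47; 49; 50; 53]%N -> imem s5 a = imem s0 a.
  move=> ha; rewrite fr5 ?fr4 ?fr3 //; move: ha;
  by rewrite !inE; do 7 (case/orP => [/eqP -> //|]); move/eqP ->.
have r5 a : a \in [:: 0; 7]%N -> rmem s5 a = rmem s0 a.
  move=> ha; rewrite (same_rmem sm5) ?(same_rmem sm4) ?r3 //; move: ha;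
  by rewrite !inE => /orP[] /eqP ->.
pose eu q := imem s0 1 (o q); pose ev q := imem s0 2 (o q).
pose C q := rmem s0 0 (o q).
(* Both branches fit one description: a prefix that is already good counts as a rounding with i = j
   and no chosen classes. *)
pose result (s : state) := exists i j l best D ch,
  [/\ (i <= j)%N, (j <= m)%N, imem s 58 0 = j,
      rounded n m L k par tim cn eu ev C i j (fun q => imem s 3 (o q) != 0%N) l best D ch &
      (ch = [::] /\ w j <= V) \/ [/\ (k + cn i < n)%N, (n < k + cn j)%N &
        slope_fine n k w cn V i <= slope_coarse n k w cn V j]].
apply: runs_seq.
have step6 : runs W s5 (If (BIEq (ivar 41) (IConst 0)) round_partition
    (iset 58 (ISub (ivar 41) (IConst 1)))) (40 * 100 * (m * L.+1).+1 + 10) result.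
  have g5 := good_lt good5.
  apply: (@runs_branch _ _ (40 * 100 * (m * L.+1).+1)%N) => /=.
  - by lia.
  - by lia.
  - move=> /eqP g0; rewrite g0 /= in good5.
    have bad t : (t <= m)%N -> (k + cn t <= n)%N -> V < w t by apply: good5.
    have lag := @lagrangian o oP o_sorted par rnk tim cn kr.
    have [tb [tbm tbn _]] := coarse_exists lag bad.
    case Eb: (imem s5 43 0) coarse5 => [|j] /=; first by move/(_ tb tbm); rewrite tbn.
    move=> [jm cj _ jmax]; rewrite ltnS in jm.
    have jmax' t : (t <= m)%N -> (n < k + cn t)%N ->
      slope_coarse n k w cn V t <= slope_coarse n k w cn V j by apply: jmax.
    (* Any s above the maximal coarse slope would do, for instance that slope plus 1: this only
       shows that a fine prefix exists, so that the scan has found one. *)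
    have [ta [tam tan _]] := @fine_exists R n k m w cn V k_le lag bad j
      (slope_coarse n k w cn V j + 1) jmax' ltac:(by rewrite ltrDl).
    case Ea: (imem s5 42 0) fine5 => [|i] /=; first by move/(_ ta tam); rewrite tan.
    move=> [im fi _ imin]; rewrite ltnS in im.
    have imin' t : (t <= m)%N -> (k + cn t < n)%N ->
      slope_fine n k w cn V i <= slope_fine n k w cn V t by apply: imin.
    have chord := chord_below k_le lag bad imin' jmax'.
    have ij : (i <= j)%N.
      rewrite leqNgt; apply/negP => ji.
      have ji' : (j <= i <= m)%N by lia.
      by have := cn_mono kr ji'; lia.
    have := @round_partition_runs R W n m L k nW mW n_lt par rnk tim cn eu ev C i j
      (fun q => s0_end1 (o q)) (fun q => s0_end2 (o q)) kr tim4 ij jm k_le fi cj s5.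
    rewrite e28 (fr50 0%N) // (fr50 1%N) // (fr50 2%N) // (r5 0%N) // (r5 7%N) //.
    rewrite (fr5 20%N) // (fr5 22%N) // (fr5 23%N) // => H.
    apply: (runs_weaken (H _ _ _ Ea Eb _ _ _ oP _ _ _ _ _)) => {H} //.
    + move=> a q ha; rewrite fr50; move: ha; rewrite !inE;
      by do 4 (case/orP => [/eqP -> //|]); move/eqP ->.
    + move=> s6 [h58 [l [best [D [ch rd]]]]] _.
      by exists i, j, l, best, D, ch; split=> //; right.
  - case Eg: (imem s5 41 0) good5 => [|t] //= [tm kt wV] _; rewrite ltnS in tm.
    apply: runs_cmd => //=; [by lia|by rewrite Eg; lia|].
    exists t, t, [::], (fun=> 0%N), (fun=> 0), [::]; split=> //.
    + by rewrite /= /upd /= Eg subn1.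
    + have nocr q : crossing L eu ev par tim t t q = false.
        by rewrite /crossing; case: (leqP t q); rewrite ?andbF.
      split=> //=.
      * by move=> r; split=> // -[q]; rewrite nocr.
      * by move=> r; rewrite big_pred0 // => q; rewrite nocr.
      * by lia.
      * by move=> q qm; rewrite /upd /= fr50 // nocr.
    + by left.
apply: (runs_weaken step6) => // s6 [i [j [l [best [D [ch [ij jm h58 rd cost]]]]]]] sm6 _.
have f28 : imem s6 28 = o by rewrite (same_imem sm6).
apply: (runs_weaken (cut_rest_runs mW h58 jm _ _)) => //.
- by rewrite (same_imem sm6) // fr50.
- by rewrite f28.
rewrite f28 => s7 out7 _.
have O_mem (p : 'I_m) : (edge_at o p \in output_set m s7) =
    (j <= p)%N || (imem s6 3 (o p) != 0%N).
  by rewrite inE -[nat_of_ord (edge_at o p)]/(val _) (edge_atE oP) out7.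
split; first exact: (rounded_kcut oP kr ij jm rd O_mem).
rewrite -(objective oP).
(* Without edges n may be 1 and the factor 0, but then both sides vanish. With an edge n >= 2, so
   the factor is at least 1. *)
have m0 : m = 0%N -> \sum_(e in output_set m s7) c e <= 2 * (1 - n%:R^-1) * V.
  move=> m0; rewrite /V !big1 ?mulr0 //.
    by move=> q; have := ltn_ord q; rewrite {2}m0.
  by move=> q; have := ltn_ord q; rewrite {2}m0.
case: (posnP m) => [/m0//|m_gt0].
have n1 := simple_graph_order simple m_gt0.
case: cost => [[ch0 wV]|[fi cj chord]].
  have := rounded_cost oP jm rd O_mem.
  rewrite ch0 big_nil addr0 -/(w j) => h; apply: le_trans h _; apply: le_trans wV _.
  have V0 : 0 <= V by apply: objective_ge0.
  rewrite ler_peMl // -/V.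
  have : n%:R^-1 <= 2^-1 :> R by rewrite lef_pV2 ?posrE ?ltr0n ?ler_nat.
  by lra.
exact: (rounded_cost_le oP kr ij jm rd O_mem).
Qed.

End Main.

(* The program P, the time constant K and the word-size constant d (words of  *)
(* d log (n + 2) bits) are chosen before the instance.                        *)
Theorem theorem4 (R : realType) :
  exists (P : cmd) (K d : nat),
  forall (n m k : nat) (ends : 'I_m -> 'I_n * 'I_n) (c x : 'I_m -> R),
    (0 < n)%N ->
    simple_graph ends ->
    (forall e, 0 < c e) ->
    lpC_feasible ends k x ->
    exists (s : state R) (t : nat),
      [/\ exec ((n + 2) ^ d)%N (input_state k ends c x) P s t,
          is_kcut ends k (output_set m s),
          \sum_(e in output_set m s) c e
            <= 2 * (1 - n%:R^-1) * \sum_e c e * x e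
        & t%:R <= K%:R * mlogn R n m].
Proof.
(* The factor 4 comes from L + 1 <= 2 L <= 4 ln n for n >= 2. The exponent 4 makes room for 4n + 10
   and, as m <= n^2, for 4m + 10. *)
exists kcut_program, (80 * 100 * 4)%N, 4%N.
move=> n m k ends c x n0 simple c_gt0 feas.
have mn := simple_graph_size simple.
have nW : (4 * n + 10 < (n + 2) ^ 4)%N.
  by rewrite (expnM _ 2 2) -![(_ ^ 2)%N]mulnn; nia.
have mW : (4 * m + 10 < (n + 2) ^ 4)%N.
  by rewrite (expnM _ 2 2) -![(_ ^ 2)%N]mulnn; nia.
have [s [t [ex lt [kcut cost]]]] := kcut_program_runs n0 simple c_gt0 feas nW mW.
exists s, t; split=> //.
move: lt; rewrite -(ler_nat R) natrM => /le_trans; apply.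
rewrite (natrM _ (80 * 100) 4) -mulrA; apply: ler_wpM2l => //.
rewrite /mlogn -addn1 natrD natrM -natr1.
case: (posnP m) => [->|m_gt0]; first by rewrite !mul0r; lra.
have n1 := simple_graph_order simple m_gt0.
have L1 : 1 <= (trunc_log 2 n)%:R :> R.
  by rewrite ler1n trunc_log_gt0.
have := ler_wpM2l (ler0n R m) (log_bound R n0).
have := ler_wpM2l (ler0n R m) L1.
by lra.
Qed.
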